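(* Let $1<p\le 2$ and let $f\in L^1$ be a first-order Haar chaos, $f=\sum_{k\ge0}c_kh_{2^k}$. Suppose the symbol $\hat f(z)=\sum_k c_kz^k$ is analytic and has no zeros in the disk $\mathbb D_{2^{-1/p}}$, but it is not the case that both $\hat f$ and $1/\hat f$ are bounded analytic functions on $\mathbb D_{2^{-1/2}}$. Then for every $1<q<p$ the system of dilations and translations $\{f_n\}_{n\ge1}$ of $f$ is a Schauder basis of $L^q_0$ (in the natural order $n=1,2,\dots$) which is not equivalent to the Haar system.
   Context: All functions are complex-valued on $I=(0,1]$; $L^q_0$ is the closed subspace of mean-zero functions in $L^q(0,1)$; $\mathbb D_R=\{z\in\mathbb C:|z|<R\}$. Let $h=\chi_{(0,1/2]}-\chi_{(1/2,1]}$. For $n=2^k+j$ with $k\ge0$, $0\le j\le 2^k-1$, $h_n(t)=h(2^kt-j)$ for $t\in(j2^{-k},(j+1)2^{-k}]$ and $0$ otherwise. For mean-zero $f\in L^1$, the system of dilations and translations is $f_n(t)=f(2^kt-j)$ on $(j2^{-k},(j+1)2^{-k}]$, $0$ otherwise. A first-order Haar chaos is a function $f=\sum_{k\ge0}c_kh_{2^k}$, $c_k\in\mathbb C$; its symbol is $\hat f(z)=\sum_k c_kz^k$. A basis $\{f_n\}$ of $L^q_0$ is equivalent to $\{h_n\}$ if there is a linear isomorphism of $L^q_0$ onto itself mapping $h_n$ to $f_n$ for all $n$. *)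

(* Defs.v *)
From HB Require Import structures.
From mathcomp Require Import all_boot all_order all_algebra.
From mathcomp Require Import all_classical all_reals all_analysis.
From mathcomp Require Import complex.
Set Implicit Arguments. Unset Strict Implicit. Unset Printing Implicit Defensive.
Import Order.TTheory GRing.Theory Num.Theory.
Import numFieldNormedType.Exports.
Local Open Scope classical_set_scope.
Local Open Scope ring_scope.

Section Defs.
Variable R : realType.
Local Notation C := R[i].
Local Notation mu := (@lebesgue_measure R).

Definition I01 : set R := `]0, 1].

Definition cabs (z : C) : R := Num.sqrt (complex.Re z ^+ 2 + complex.Im z ^+ 2).

Definition cmeasurable (g : R -> C) : Prop :=
  measurable_fun I01 (fun t => complex.Re (g t)) /\ measurable_fun I01 (fun t => complex.Im (g t)).

Definition intpow (q : R) (g : R -> C) : \bar R :=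
  (\int[mu]_(t in I01) ((cabs (g t)) `^ q)%:E)%E.

Definition inLq (q : R) (g : R -> C) : Prop :=
  cmeasurable g /\ (intpow q g < +oo)%E.

Definition Lqnorm (q : R) (g : R -> C) : R := (fine (intpow q g)) `^ (q^-1).

Definition inLq0 (q : R) (g : R -> C) : Prop :=
  inLq q g /\ Rintegral mu I01 (fun t => complex.Re (g t)) = 0
           /\ Rintegral mu I01 (fun t => complex.Im (g t)) = 0.

Definition fsub (g1 g2 : R -> C) : R -> C := fun t => g1 t - g2 t.
Definition fcomb (a : C) (g1 g2 : R -> C) : R -> C := fun t => a * g1 t + g2 t.

Definition Lq_eq (q : R) (g1 g2 : R -> C) : Prop := intpow q (fsub g1 g2) = 0%E.

Definition haar (t : R) : C :=
  if (0 < t) && (t <= 2^-1) then 1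
  else if (2^-1 < t) && (t <= 1) then -1 else 0.

(* for n = 2^k + j (k >= 0, 0 <= j < 2^k): k = trunc_log 2 n, j = n - 2^k *)
Definition lev (n : nat) : nat := trunc_log 2 n.
Definition pos (n : nat) : nat := (n - 2 ^ lev n)%N.

Definition dil (g : R -> C) (n : nat) (t : R) : C :=
  if ((pos n)%:R / 2 ^+ lev n < t) && (t <= (pos n).+1%:R / 2 ^+ lev n)
  then g (2 ^+ lev n * t - (pos n)%:R) else 0.

Definition haar_sys (n : nat) : R -> C := dil haar n.

(* g is the first-order Haar chaos sum_k c_k h_{2^k}: at each point the
   series is (eventually constant, i.e.) a finite sum equal to g *)
Definition haar_chaos (c : nat -> C) (g : R -> C) : Prop :=
  forall t : R, exists N : nat, forall n : nat, (N <= n)%N ->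
    g t = \sum_(k < n) c k * haar_sys (2 ^ k) t.

Definition cseries_to (u : nat -> C) (s : C) : Prop :=
  (fun n => complex.Re (\sum_(k < n) u k)) @ \oo --> complex.Re s /\
  (fun n => complex.Im (\sum_(k < n) u k)) @ \oo --> complex.Im s.

Definition symbol_analytic_on (c : nat -> C) (r : R) : Prop :=
  forall z : C, cabs z < r -> exists s, cseries_to (fun k => c k * z ^+ k) s.

Definition symbol_nonvanishing_on (c : nat -> C) (r : R) : Prop :=
  forall z : C, cabs z < r -> forall s, cseries_to (fun k => c k * z ^+ k) s -> s != 0.

Definition symbol_H_infty_invertible (c : nat -> C) (r : R) : Prop :=
  exists M : R, forall z : C, cabs z < r ->
    exists s, [/\ cseries_to (fun k => c k * z ^+ k) s, s != 0,
                  cabs s <= M & cabs (s^-1) <= M].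

Definition psum (a : nat -> C) (x : nat -> R -> C) (N : nat) : R -> C :=
  fun t => \sum_(1 <= n < N) a n * x n t.

Definition expands_to (q : R) (a : nat -> C) (x : nat -> R -> C) (g : R -> C) : Prop :=
  ((fun N => intpow q (fsub g (psum a x N))) @ \oo --> 0%E).

Definition schauder_basis_Lq0 (q : R) (x : nat -> R -> C) : Prop :=
  (forall n, (1 <= n)%N -> inLq0 q (x n)) /\
  forall g, inLq0 q g ->
    exists a : nat -> C, expands_to q a x g /\
      forall b : nat -> C, expands_to q b x g -> forall n, (1 <= n)%N -> b n = a n.

(* a linear isomorphism T of L^q_0 onto itself (maps on representatives,
   everything modulo equality a.e.) with T x_n = y_n for all n >= 1 *)
Definition equivalent_bases (q : R) (x y : nat -> R -> C) : Prop :=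
  exists T : (R -> C) -> (R -> C),
    (forall g, inLq0 q g -> inLq0 q (T g)) /\
    (forall a g1 g2, inLq0 q g1 -> inLq0 q g2 ->
        Lq_eq q (T (fcomb a g1 g2)) (fcomb a (T g1) (T g2))) /\
    (exists K : R, forall g, inLq0 q g -> Lqnorm q (T g) <= K * Lqnorm q g) /\
    (exists K : R, forall g, inLq0 q g -> Lqnorm q g <= K * Lqnorm q (T g)) /\
    (forall y0, inLq0 q y0 -> exists g, inLq0 q g /\ Lq_eq q (T g) y0) /\
    (forall n, (1 <= n)%N -> Lq_eq q (T (x n)) (y n)).

End Defs.
Arguments haar {R}.
Arguments haar_sys {R}.

(* Main.v *)
(* Index the dyadic intervals of (0,1] by n >= 1, the halves of I_n being I_{2n}
   and I_{2n+1}.  For a chaos with coefficients c one has f_n = sum_i c_i h_{2^i n},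
   so a finite sum with f-coefficients a has Haar coefficients c * a, where
   (c * a)_m = sum_i c_i a_{m/2^i} over the i with 2^i | m; this convolution is
   inverted by d * _, d being the coefficients of the reciprocal of the symbol.
   Since the symbol has no zero in the disc of radius 2^{-1/p}, Cauchy estimates
   give c_k, d_k = O(2^{uk}) for some u < 1/q.

   Basis: with b the Haar coefficients of g, the partial sums to N of
   sum (d * b)_n f_n and sum b_n h_n differ only by a remainder carried by the
   pairwise disjoint intervals I_n, N <= n < 2N, and its L^q norm tends to 0
   together with the mean of |b_n|^q over these intervals.

   Non-equivalence: equivalence would make c * _ and d * _ bounded for the L^q
   norm of Haar sums.  Sums of independent copies of a short Haar chaos, which
   are asymptotically Gaussian, turn this into l^2 bounds and force both symbols
   to be bounded on the disc of radius 2^{-1/2}. *)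
Require Import Defs.
From HB Require Import structures.
From mathcomp Require Import all_boot all_order all_algebra.
From mathcomp Require Import all_classical all_reals all_analysis.
From mathcomp Require Import measurable_realfun complex ring lra zify.
Set Implicit Arguments. Unset Strict Implicit. Unset Printing Implicit Defensive.
Import Order.TTheory GRing.Theory Num.Theory.
Import numFieldNormedType.Exports Normc.
Local Open Scope classical_set_scope.
Local Open Scope ring_scope.

(** The gap between q and p is spent on two factors. With 1/p < u < v < 1/q put [eta] = 2^v and
    [kap] = 2^(u - v), so that c_k and d_k are O(([kap] [eta])^k). The power [eta]^k is paid for by
    lengths: along a spine n, 2n, 4n, ... the lengths decrease like 2^(-k), and [eta]^q < 2 makes
    the series of ([eta]^q / 2)^k converge. The power [kap]^k makes sums along a spine geometric,
    which takes the place of Hölder's inequality.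

    The natural order forces partial sums that stop inside a level. All means are therefore taken
    over windows N <= n < 2N, whose intervals partition (0,1] for every N; one step in N splits I_N
    into its halves.

    For the converse, an L^q bound must yield an l^2 bound. For sums of many independent copies all
    moments are controlled by the second one, so the exponent q disappears; testing on the
    reproducing kernels of the Hardy space of the disc of radius 2^(-1/2) then bounds the symbol at
    each point. *)

Section Modulus.
Variable R : realType.
Local Notation C := R[i].
Implicit Types z w : C.

Lemma cabsE z : cabs z = normc z. Proof. by case: z. Qed.

Lemma cabs_ge0 z : 0 <= cabs z. Proof. exact: sqrtr_ge0. Qed.

Lemma cabs0 : cabs (0 : C) = 0. Proof. by rewrite cabsE normc0. Qed.

Lemma cabs1 : cabs (1 : C) = 1. Proof. by rewrite cabsE normc1. Qed.

Lemma cabs_eq0 z : (cabs z == 0) = (z == 0).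
Proof.
apply/eqP/eqP => [|->]; last exact: cabs0.
by rewrite cabsE; exact: eq0_normc.
Qed.

Lemma cabsM z w : cabs (z * w) = cabs z * cabs w.
Proof. by rewrite !cabsE normcM. Qed.

Lemma cabsX z n : cabs (z ^+ n) = cabs z ^+ n.
Proof. by elim: n => [|n IH]; rewrite ?expr0 ?cabs1// !exprS cabsM IH. Qed.

Lemma cabsV z : cabs z^-1 = (cabs z)^-1.
Proof. by rewrite !cabsE normcV. Qed.

Lemma cabsN z : cabs (- z) = cabs z.
Proof. by rewrite !cabsE normcN. Qed.

Lemma cabsB z w : cabs (z - w) = cabs (w - z).
Proof. by rewrite -cabsN opprB. Qed.

Lemma ler_cabsD z w : cabs (z + w) <= cabs z + cabs w.
Proof. by rewrite !cabsE le_normcD. Qed.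

Lemma ler_cabsB z w : cabs (z - w) <= cabs z + cabs w.
Proof. by rewrite -(cabsN w) ler_cabsD. Qed.

Lemma cabs_sum (I : Type) (r : seq I) (P : pred I) (F : I -> C) :
  cabs (\sum_(i <- r | P i) F i) <= \sum_(i <- r | P i) cabs (F i).
Proof.
elim/big_rec2: _ => [|i y x _ H]; first by rewrite cabs0.
exact: le_trans (ler_cabsD _ _) (lerD _ _).
Qed.

Lemma cabs_real (x : R) : cabs x%:C%C = `|x|.
Proof. by rewrite /cabs /= expr0n addr0 sqrtr_sqr. Qed.

Lemma cabs_sqr z : cabs z ^+ 2 = complex.Re z ^+ 2 + complex.Im z ^+ 2.
Proof. by rewrite sqr_sqrtr// addr_ge0// sqr_ge0. Qed.

Lemma ler_Re_cabs z : `|complex.Re z| <= cabs z.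
Proof.
by rewrite -sqrtr_sqr ler_sqrt ?lerDl ?sqr_ge0// addr_ge0// sqr_ge0.
Qed.

Lemma ler_Im_cabs z : `|complex.Im z| <= cabs z.
Proof.
by rewrite -sqrtr_sqr ler_sqrt ?lerDr ?sqr_ge0// addr_ge0// sqr_ge0.
Qed.

Lemma cabs_le_ReIm z : cabs z <= `|complex.Re z| + `|complex.Im z|.
Proof.
rewrite -(@ler_pXn2r _ 2)// ?nnegrE ?cabs_ge0 ?addr_ge0// cabs_sqr.
rewrite sqrrD !real_normK ?num_real//.
by rewrite -addrA lerD2l lerDr mulrn_wge0// mulr_ge0.
Qed.

Lemma ReD z w : complex.Re (z + w) = complex.Re z + complex.Re w.
Proof. by case: z w => [? ?] [? ?]. Qed.

Lemma ImD z w : complex.Im (z + w) = complex.Im z + complex.Im w.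
Proof. by case: z w => [? ?] [? ?]. Qed.

Lemma ReN z : complex.Re (- z) = - complex.Re z.
Proof. by case: z. Qed.

Lemma ImN z : complex.Im (- z) = - complex.Im z.
Proof. by case: z. Qed.

Lemma Re_sum (I : Type) (r : seq I) (P : pred I) (F : I -> C) :
  complex.Re (\sum_(i <- r | P i) F i) = \sum_(i <- r | P i) complex.Re (F i).
Proof. by apply: (big_morph _ ReD). Qed.

Lemma Im_sum (I : Type) (r : seq I) (P : pred I) (F : I -> C) :
  complex.Im (\sum_(i <- r | P i) F i) = \sum_(i <- r | P i) complex.Im (F i).
Proof. by apply: (big_morph _ ImD). Qed.

End Modulus.

(** * Formal power series under the Cauchy product *)

Section Convolution.
Variable K : fieldType.
Implicit Types u v w : nat -> K.

Definition cprod u v n : K := \sum_(i < n.+1) u i * v (n - i)%N.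
Definition delta0 (n : nat) : K := (n == 0%N)%:R.

(** Only coefficients up to [n] enter, so truncation to polynomials loses nothing; commutativity and
    associativity are inherited from there. *)
Lemma cprodE u v n N : (n < N)%N ->
  cprod u v n = ((\poly_(i < N) u i) * (\poly_(i < N) v i))`_n.
Proof.
move=> nN; rewrite coefM; apply: eq_bigr => i _.
by rewrite !coef_poly (leq_trans (ltn_ord i) nN) (leq_ltn_trans (leq_subr i n) nN).
Qed.

Lemma cprodC u v n : cprod u v n = cprod v u n.
Proof. by rewrite !(@cprodE _ _ n n.+1)// mulrC. Qed.

Lemma cprodA u v w n : cprod u (cprod v w) n = cprod (cprod u v) w n.
Proof.
pose p x : {poly K} := \poly_(i < n.+1) x i.
(* Truncating an inner product at [n] changes no coefficient up to [n]. *)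
have trunc x y z k : (k <= n)%N -> (p (cprod x y) * z)`_k = (p x * p y * z)`_k.
  move=> kn; rewrite !coefM; apply: eq_bigr => i _; congr (_ * _).
  have ik : (i < n.+1)%N by apply: leq_trans (ltn_ord i) _; rewrite ltnS.
  by rewrite coef_poly ik (cprodE _ _ ik).
rewrite !(@cprodE _ _ n n.+1)// -/(p _) -/(p u) -/(p w) -/(p (cprod u v)).
by rewrite mulrC !trunc// [p v * _ * _]mulrC mulrA.
Qed.

Lemma cprod_delta0 u n : cprod delta0 u n = u n.
Proof.
rewrite /cprod big_ord_recl /= mul1r subn0 big1 ?addr0// => i _.
by rewrite /delta0 mul0r.
Qed.

Lemma eq_cprod u u' v v' n : (forall i, (i <= n)%N -> u i = u' i) ->
  (forall i, (i <= n)%N -> v i = v' i) -> cprod u v n = cprod u' v' n.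
Proof.
move=> eu ev; apply: eq_bigr => i _.
by rewrite eu ?ev ?leq_subr// -ltnS.
Qed.

Lemma cprod_inv u : u 0 != 0 -> {v | forall n, cprod u v n = delta0 n}.
Proof.
move=> u0.
pose step (s : seq K) : K :=
  (u 0)^-1 * (delta0 (size s) - \sum_(i < size s) u i.+1 * s`_(size s - i.+1)).
(* Each coefficient depends on all earlier ones, so the recursion carries the list of those already
   found. *)
pose s n := iter n (fun s => rcons s (step s)) [::].
have ss n : size (s n) = n by elim: n => // n IH; rewrite /s iterS size_rcons -/(s n) IH.
pose v n := (s n.+1)`_n.
have sv n k : (k < n)%N -> (s n)`_k = v k.
  elim: n => // n IH; rewrite ltnS leq_eqVlt => /orP[/eqP ->//|kn].
  by rewrite /s iterS -/(s n) nth_rcons ss kn IH.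
exists v => n; rewrite /cprod big_ord_recl /= subn0.
rewrite {1}/v /s iterS -/(s n) nth_rcons ss ltnn eqxx /step ss mulVKf//.
rewrite (_ : \sum_(i < n) _ = \sum_(i < n) u i.+1 * v (n - i.+1)%N).
  by rewrite subrK.
by apply: eq_bigr => i _; rewrite sv//; have := ltn_ord i; lia.
Qed.

Lemma cprod_inj u v w n : u 0 != 0 ->
  (forall k, (k <= n)%N -> cprod u v k = cprod u w k) ->
  forall k, (k <= n)%N -> v k = w k.
Proof.
move=> u0 H k kn.
have [t ut] := cprod_inv u0.
have E x : cprod t (cprod u x) k = x k.
  rewrite cprodA -[RHS]cprod_delta0; apply: eq_cprod => // i _.
  by rewrite cprodC ut.
rewrite -(E v) -(E w); apply: eq_cprod => // i ik.
by apply: H; apply: leq_trans kn.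
Qed.

Lemma sum_cprod u v n :
  \sum_(l < n) cprod u v l = \sum_(i < n) u i * \sum_(j < n - i) v j.
Proof.
elim: n => [|n IH]; first by rewrite !big_ord0.
rewrite big_ord_recr /= IH [RHS]big_ord_recr /= subSnn big_ord1.
rewrite {1}/cprod big_ord_recr /= subnn addrA -big_split /=; congr (_ + _).
apply: eq_bigr => i _; rewrite -mulrDr subSn ?[in RHS]big_ord_recr//.
exact: ltnW.
Qed.

End Convolution.

(** * Coefficients of the reciprocal of a symbol *)

Section Sequences.
Variable R : realType.
Local Notation C := R[i].
Implicit Types (u : nat -> R) (x y : nat -> C).

Definition vanishes u :=
  forall e, 0 < e -> exists N, forall n, (N <= n)%N -> `|u n| <= e.

Lemma vanishesBP u (l : R) : vanishes (fun n => u n - l) <-> u @ \oo --> l.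
Proof.
split=> [H|H e e0].
  apply/cvgrPdist_le => e e0; have [N HN] := H e e0.
  by exists N => // n /= Nn; rewrite distrC HN.
move/cvgrPdist_le : H => /(_ e e0)[N _ HN].
by exists N => n Nn; have := HN n Nn; rewrite distrC.
Qed.

Lemma eq_vanishes u v : u =1 v -> vanishes u -> vanishes v.
Proof. by move=> /funext ->. Qed.

Lemma vanishesP u : vanishes u <-> u @ \oo --> (0 : R).
Proof.
by rewrite -vanishesBP; split; apply: eq_vanishes => n; rewrite subr0.
Qed.

Lemma vanishesD u v : vanishes u -> vanishes v -> vanishes (fun n => u n + v n).
Proof.
by move=> /vanishesP hu /vanishesP hv; apply/vanishesP; rewrite -(addr0 0); apply: cvgD.
Qed.

Lemma vanishesZ k u : vanishes u -> vanishes (fun n => k * u n).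
Proof.
by move=> /vanishesP hu; apply/vanishesP; rewrite -(mulr0 k); apply: cvgMr.
Qed.

Lemma vanishes_le u v : (forall n, `|u n| <= v n) -> vanishes v -> vanishes u.
Proof.
move=> uv hv e e0; have [N HN] := hv e e0; exists N => n Nn.
by apply: le_trans (HN n Nn); apply: le_trans (uv n) _; exact: ler_norm.
Qed.

Lemma le0_eps (a : R) : (forall e : R, 0 < e -> a <= e) -> a <= 0.
Proof. by move=> H; apply/ler_addgt0Pr => e /H; rewrite add0r. Qed.

Lemma vanishes_norm u : vanishes u -> vanishes (fun n => `|u n|).
Proof.
by move=> h e /h[N HN]; exists N => n /HN; rewrite normr_id.
Qed.

Lemma vanishes_const (a : R) : vanishes (fun=> a) -> a = 0.
Proof.
move=> H; apply/eqP; apply: contraT => a0.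
have /H[N /(_ N (leqnn N))] : 0 < `|a| / 2 by rewrite divr_gt0// normr_gt0.
by have : 0 < `|a| by [rewrite normr_gt0]; lra.
Qed.

Lemma vanishes_geom (a : R) : 0 <= a -> a < 1 -> vanishes (fun n => a ^+ n).
Proof. by move=> a0 a1; apply/vanishesP; apply: cvg_expr; rewrite ger0_norm. Qed.

Lemma geom_sum_le (a : R) n : 0 <= a -> a < 1 -> \sum_(i < n) a ^+ i <= (1 - a)^-1.
Proof.
move=> a0 a1; have a1' : 0 < 1 - a by rewrite subr_gt0.
rewrite -(ler_pM2l a1') mulfV ?gt_eqF//.
have := subrX1 a n => H.
suff : 0 <= a ^+ n by move: H; set S := \sum_(_ < _) _; nra.
by rewrite exprn_ge0.
Qed.

Lemma bernoulli (a : R) n : 0 <= a -> 1 + n%:R * a <= (1 + a) ^+ n.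
Proof.
move=> a0; elim: n => [|n IH]; first by rewrite mul0r addr0.
rewrite exprS -natr1; have n0 : 0 <= n%:R :> R by [].
have : (1 + a) * (1 + n%:R * a) <= (1 + a) * (1 + a) ^+ n.
  by rewrite ler_wpM2l// addr_ge0.
apply: le_trans; nra.
Qed.

(** Bernoulli's inequality for (b / a)^n; the case a = 0 is separate because of this quotient. *)
Lemma linear_geom (a b : R) : 0 <= a -> a < b ->
  exists B, forall n, n%:R * a ^+ n <= B * b ^+ n.
Proof.
rewrite le_eqVlt => /predU1P[<-|a0] ab.
  exists 1 => -[|n]; first by rewrite mul0r mul1r.
  by rewrite expr0n mulr0 mul1r exprn_ge0// ltW.
have ba : 0 < b / a - 1 by rewrite subr_gt0 ltr_pdivlMr ?mul1r.
exists (b / a - 1)^-1 => n.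
have := bernoulli n (ltW ba); rewrite addrCA subrr addr0 expr_div_n => H.
rewrite ler_pdivlMl// mulrA -ler_pdivlMr ?exprn_gt0//.
by rewrite mulrC; lra.
Qed.

Lemma vanishes_linear_geom (a : R) : 0 <= a -> a < 1 ->
  vanishes (fun n => n%:R * a ^+ n).
Proof.
move=> a0 a1; have [B HB] := @linear_geom a ((1 + a) / 2) a0 ltac:(lra).
apply: (vanishes_le _ (vanishesZ B (@vanishes_geom ((1 + a) / 2) _ _))); try lra.
by move=> n; rewrite ger0_norm// mulr_ge0// exprn_ge0.
Qed.

Lemma bounded_partial_sums_tail u B : (forall n, 0 <= u n) ->
  (forall n, \sum_(i < n) u i <= B) ->
  forall e, 0 < e -> exists N, forall n, \sum_(N <= i < n) u i <= e.
Proof.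
move=> u0 uB e e0; pose S n := \sum_(i < n) u i.
have Sle m n : (m <= n)%N -> S n = S m + \sum_(m <= i < n) u i.
  by move=> mn; rewrite /S -!(big_mkord xpredT) (@big_cat_nat _ _ _ m).
have Sh : {homo S : n m / (n <= m)%N >-> n <= m}.
  by move=> m n mn; rewrite (Sle _ _ mn) lerDl sumr_ge0.
have Sc : cvgn S.
  by apply: nondecreasing_is_cvgn => //; exists B => _ [n _ <-]; exact: uB.
have /cvgrPdist_le/(_ e e0)[N _ HN] := Sc.
exists N => n; have [nN|Nn] := leqP n N; first by rewrite big_geq// ltW.
have := Sle _ _ (ltnW Nn); have := nondecreasing_cvgn_le Sh Sc n.
have := HN N (leqnn N); rewrite /= ler_norml => /andP[_]; lra.
Qed.

Definition ccvg x (s : C) := vanishes (fun n => cabs (x n - s)).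

Lemma cseries_toP x s : cseries_to x s <-> ccvg (fun n => \sum_(k < n) x k) s.
Proof.
split => [[/vanishesBP hr /vanishesBP hi]|h].
  apply: (vanishes_le _ (vanishesD (vanishes_norm hr) (vanishes_norm hi))) => n.
  rewrite ger0_norm ?cabs_ge0//; apply: le_trans (cabs_le_ReIm _) _.
  by rewrite ReD ImD ReN ImN.
split; apply/vanishesBP; apply: vanishes_le h => n.
- by rewrite -ReN -ReD ler_Re_cabs.
- by rewrite -ImN -ImD ler_Im_cabs.
Qed.

Lemma ccvg_unique x s t : ccvg x s -> ccvg x t -> s = t.
Proof.
move=> hs ht; apply/eqP; rewrite -subr_eq0 -cabs_eq0; apply/eqP.
apply: vanishes_const; apply: (vanishes_le _ (vanishesD hs ht)) => n.
rewrite ger0_norm ?cabs_ge0// (_ : s - t = (x n - t) - (x n - s)); last ring.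
by rewrite [leRHS]addrC ler_cabsB.
Qed.

Lemma ccvg_le x s (M : R) N : ccvg x s -> (forall n, (N <= n)%N -> cabs (x n) <= M) -> cabs s <= M.
Proof.
move=> hs hM; apply/ler_addgt0Pr => e e0; have [K HK] := hs e e0.
pose n := maxn N K; have := HK n (leq_maxr _ _); rewrite ger0_norm ?cabs_ge0// => H.
have := hM n (leq_maxl _ _); have := ler_cabsB (x n) (x n - s).
by rewrite opprB addrCA subrr addr0; lra.
Qed.

Lemma ccvgM x y s t : ccvg x s -> ccvg y t -> ccvg (fun n => x n * y n) (s * t).
Proof.
move=> hs ht e e0.
have [N0 H0] := hs 1 ltr01.
pose B := cabs s + cabs t + 1.
have B0 : 0 < B by rewrite /B ltr_wpDl// addr_ge0// cabs_ge0.
have eB : 0 < e / (2 * B) by rewrite divr_gt0// mulr_gt0.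
have [N1 H1] := hs _ eB; have [N2 H2] := ht _ eB.
exists (maxn N0 (maxn N1 N2)) => n; rewrite !geq_max => /and3P[n0 n1 n2].
have := H0 n n0; have := H1 n n1; have := H2 n n2.
rewrite !ger0_norm ?cabs_ge0// => h2 h1 h0.
rewrite (_ : x n * y n - s * t = x n * (y n - t) + (x n - s) * t); last ring.
apply: le_trans (ler_cabsD _ _) _; rewrite !cabsM.
have xn : cabs (x n) <= B.
  have := ler_cabsD (x n - s) s; rewrite subrK /B; have := cabs_ge0 t; lra.
have tB : cabs t <= B by rewrite /B; have := cabs_ge0 s; lra.
have -> : e = B * (e / (2 * B)) + (e / (2 * B)) * B.
  by field; rewrite gt_eqF.
by apply: lerD; apply: ler_pM => //; exact: cabs_ge0.
Qed.

Lemma ccvg_geom x (B a : R) : 0 <= a -> a < 1 -> (forall n, cabs (x n) <= B * a ^+ n) ->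
  exists s, ccvg (fun n => \sum_(k < n) x k) s.
Proof.
move=> a0 a1 xB.
have real_cvg (u : nat -> R) : (forall n, `|u n| <= B * a ^+ n) ->
    exists l : R, (fun n => \sum_(k < n) u k) @ \oo --> l.
  move=> uB.
  have : cvgn (series u).
    apply: normed_cvg; apply: (series_le_cvg _ _ uB) => //.
      by move=> n; apply: le_trans (uB n).
    have := @is_cvg_geometric_series R B a; rewrite ger0_norm//; exact.
  move=> h; exists (limn (series u)).
  rewrite (_ : (fun n => _) = series u)//.
  by apply/funext => n; rewrite seriesEord.
have [r hr] : exists l : R, (fun n => \sum_(k < n) complex.Re (x k)) @ \oo --> l.
  by apply: (real_cvg (fun k => complex.Re (x k))) => n; exact: le_trans (ler_Re_cabs _) (xB n).
have [i hi] : exists l : R, (fun n => \sum_(k < n) complex.Im (x k)) @ \oo --> l.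
  by apply: (real_cvg (fun k => complex.Im (x k))) => n; exact: le_trans (ler_Im_cabs _) (xB n).
exists (r +i* i)%C; apply/cseries_toP; split.
- rewrite (_ : (fun n => _) = (fun n => \sum_(k < n) complex.Re (x k)))//.
  by apply/funext => n; rewrite Re_sum.
- rewrite (_ : (fun n => _) = (fun n => \sum_(k < n) complex.Im (x k)))//.
  by apply/funext => n; rewrite Im_sum.
Qed.

(** The product of two partial sums exceeds that of the Cauchy product by the part of the square
    outside the triangle i + j < n. Its row i is at most B a^i times a tail of order a^(n - i), so
    the excess is O(n a^n). *)
Lemma ccvg_cprod x y (B a : R) s t : 0 <= a -> a < 1 ->
  (forall n, cabs (x n) <= B * a ^+ n) -> (forall n, cabs (y n) <= B * a ^+ n) ->
  ccvg (fun n => \sum_(k < n) x k) s -> ccvg (fun n => \sum_(k < n) y k) t ->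
  ccvg (fun n => \sum_(k < n) cprod x y k) (s * t).
Proof.
move=> a0 a1 xB yB hs ht.
have B0 : 0 <= B by have := le_trans (cabs_ge0 _) (xB 0); rewrite expr0 mulr1.
have := vanishesD (ccvgM hs ht)
  (vanishesZ (B * (B / (1 - a))) (vanishes_linear_geom a0 a1)).
apply: vanishes_le => n; rewrite ger0_norm ?cabs_ge0//.
set X := \sum_(k < n) x k; set Y := \sum_(k < n) y k.
rewrite sum_cprod.
rewrite (_ : _ - s * t = (X * Y - s * t) - (X * Y - \sum_(i < n) x i * \sum_(j < n - i) y j)); last ring.
apply: le_trans (ler_cabsB _ _) _; rewrite lerD2l.
rewrite mulr_suml -sumrB.
apply: le_trans (cabs_sum _ _ _) _.
rewrite mulrCA -[X in X%:R](card_ord n) mulr_natl -sumr_const.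
apply: ler_sum => i _; rewrite -mulrBr cabsM.
rewrite (_ : Y - _ = \sum_(n - i <= j < n) y j); last first.
  rewrite /Y -!(big_mkord xpredT) (@big_cat_nat _ _ _ (n - i)%N)//= ?leq_subr//.
  by rewrite addrAC subrr add0r.
have -> : B * (B / (1 - a)) * a ^+ n = (B * a ^+ i) * (B * (a ^+ (n - i) / (1 - a))).
  rewrite -{1}(subnKC (ltnW (ltn_ord i))) exprD; ring.
apply: ler_pM; rewrite ?cabs_ge0//.
apply: le_trans (cabs_sum _ _ _) _.
apply: (@le_trans _ _ (\sum_(n - i <= j < n) B * a ^+ j)); first exact: ler_sum.
rewrite -mulr_sumr ler_wpM2l//.
rewrite -{1}(add0n (n - i)%N) big_addn (_ : (n - (n - i) = i)%N); last by have := ltn_ord i; lia.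
rewrite (eq_bigr (fun j => a ^+ (n - i) * a ^+ j)); last by move=> j _; rewrite -exprD addnC.
rewrite -mulr_sumr ler_wpM2l ?exprn_ge0// big_mkord.
exact: geom_sum_le.
Qed.

End Sequences.

(** * Coefficients of the reciprocal of a polynomial *)

Section ReciprocalSeries.
Variable R : realType.
Local Notation C := R[i].

(* Induction on the degree: [p.[z] + p.[-z]] and [p.[z] - p.[-z]] isolate the even
   and the odd coefficients, which are those of polynomials in [z ^+ 2]. *)
Lemma poly_cauchy_estimate (p : {poly C}) (rho M : R) : 0 < rho ->
  (forall z, cabs z = rho -> cabs p.[z] <= M) -> forall n, cabs p`_n * rho ^+ n <= M.
Proof.
have [m] := ubnP (size p); elim: m p rho M => // m IH p rho M.
rewrite ltnS => sp r0 pM n.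
have [sp1|sp1] := leqP (size p) 1.
  have /pM : cabs (rho%:C%C : C) = rho by rewrite cabs_real gtr0_norm.
  rewrite (size1_polyC sp1) hornerC coefC; case: n => [|n] /= H.
    by rewrite mulr1.
  by rewrite cabs0 mul0r (le_trans (cabs_ge0 _) H).
have half z : cabs z = rho ^+ 2 -> cabs (even_poly p).[z] <= M /\
    cabs (odd_poly p).[z] <= M / rho.
  move=> zr; pose w := sqrtc z; have wz : w ^+ 2 = z by rewrite sqr_sqrtc.
  have wr : cabs w = rho.
    apply/eqP; rewrite -(@eqrXn2 _ 2)// ?cabs_ge0 ?(ltW r0)//.
    by rewrite -cabsX wz zr.
  have pw : p.[w] = (even_poly p).[z] + (odd_poly p).[z] * w.
    by rewrite -{1}(poly_even_odd p) !hornerE !horner_comp !hornerE wz.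
  have pNw : p.[- w] = (even_poly p).[z] - (odd_poly p).[z] * w.
    by rewrite -{1}(poly_even_odd p) !hornerE !horner_comp !hornerE sqrrN wz mulrN.
  have H1 := pM _ wr; have H2 : cabs p.[- w] <= M by rewrite pM// cabsN.
  have double x : cabs (x + x : C) = cabs x + cabs x.
    have -> : x + x = (2 : R)%:C%C * x by rewrite rmorph_nat; ring.
    by rewrite cabsM cabs_real ger0_norm//; ring.
  split.
    have := ler_cabsD p.[w] p.[- w].
    rewrite (_ : p.[w] + p.[- w] = (even_poly p).[z] + (even_poly p).[z]).
      by rewrite double; lra.
    by rewrite pw pNw; ring.
  rewrite ler_pdivlMr// -wr -cabsM.
  have := ler_cabsB p.[w] p.[- w].
  rewrite (_ : p.[w] - p.[- w] = (odd_poly p).[z] * w + (odd_poly p).[z] * w).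
    by rewrite double; lra.
  by rewrite pw pNw; ring.
have r20 : 0 < rho ^+ 2 by rewrite exprn_gt0.
rewrite -(odd_double_half n); case: (odd n) => /=.
  have so : (size (odd_poly p) < m)%N.
    by apply: leq_ltn_trans (size_odd_poly p) _; lia.
  have := IH _ _ _ so r20 (fun z zr => (half z zr).2) n./2.
  by rewrite coef_odd_poly -exprM mul2n ler_pdivlMr// add1n exprSr mulrA.
have se : (size (even_poly p) < m)%N.
  by apply: leq_ltn_trans (size_even_poly p) _; rewrite uphalf_half; lia.
have := IH _ _ _ se r20 (fun z zr => (half z zr).1) n./2.
by rewrite coef_even_poly add0n -exprM mul2n.
Qed.

(** Dividing a series with coefficients e by X - a gives e' with a e'_(n+1) = e'_n - e_(n+1).
    Weighted by rho^n and summed, this bounds (|a| - rho) times the sum for e' by the sum for e, and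
    |a| > rho. *)
Lemma recip_prod_summable (rs : seq C) (rho : R) : 0 < rho ->
  all (fun a => rho < cabs a) rs ->
  exists e : nat -> C, exists B : R,
    (forall n, cprod (fun i => (\prod_(a <- rs) ('X - a%:P))`_i) e n = delta0 _ n) /\
    forall N, \sum_(i < N) cabs (e i) * rho ^+ i <= B.
Proof.
move=> r0; elim: rs => [_|a rs IH /= /andP[ra /IH[e [B [He HB]]]]].
  exists (delta0 _), 1; split.
    move=> n; rewrite big_nil; rewrite -[RHS]cprod_delta0.
    by apply: eq_cprod => // i _; rewrite coef1.
  elim=> [|N _]; first by rewrite big_ord0.
  rewrite big_ord_recl big1 /=; last by move=> i _; rewrite cabs0 mul0r.
  by rewrite addr0 cabs1 mulr1.
pose l i : C := ('X - a%:P)`_i.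
have l0 : l 0 = - a by rewrite /l coefB coefX coefC /= sub0r.
have l1 : l 1 = 1 by rewrite /l coefB coefX coefC /= subr0.
have l2 i : l i.+2 = 0 by rewrite /l coefB coefX coefC /= subr0.
have a0 : a != 0 by rewrite -cabs_eq0 gt_eqF// (lt_trans r0).
have /cprod_inv[t lt] : l 0 != 0 by rewrite l0 oppr_eq0.
pose e' := cprod t e.
have le' n : cprod l e' n = e n.
  rewrite /e' cprodA -[RHS]cprod_delta0; exact: eq_cprod.
exists e', (B / (cabs a - rho)); split=> [n|N].
  rewrite big_cons -He.
  rewrite -[LHS](@eq_cprod _ (cprod (fun i => (\prod_(a <- rs) ('X - a%:P))`_i) l) _ e'); last 2 first.
  - by move=> i _; rewrite mulrC coefM.
  - by [].
  by rewrite -cprodA; apply: eq_cprod.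
have rec n : cabs a * cabs (e' n.+1) <= cabs (e n.+1) + cabs (e' n).
  have := le' n.+1; rewrite /cprod !big_ord_recl /= l0 l1 subn0 subn1 /= big1; last first.
    by move=> i _; rewrite l2 mul0r.
  rewrite addr0 mul1r mulNr => H; rewrite -cabsM.
  rewrite (_ : a * e' n.+1 = e' n - e n.+1); last by rewrite -H; ring.
  by rewrite [leRHS]addrC; exact: ler_cabsB.
have rec0 : cabs a * cabs (e' 0) = cabs (e 0).
  by have := le' 0; rewrite /cprod big_ord1 l0 -cabsM => <-; rewrite mulNr cabsN.
have ar0 : 0 < cabs a - rho by rewrite subr_gt0.
rewrite ler_pdivlMr// mulrBr.
pose S N := \sum_(i < N) cabs (e' i) * rho ^+ i.
rewrite -/(S N).
have SS n : S n <= S n.+1.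
  by rewrite /S big_ord_recr /= lerDl mulr_ge0 ?cabs_ge0 ?exprn_ge0// ltW.
suff H : S N * cabs a <= B + rho * S N by rewrite [S N * rho]mulrC; lra.
apply: (@le_trans _ _ (S N.+1 * cabs a)); first by rewrite ler_wpM2r ?cabs_ge0.
apply: (@le_trans _ _ (\sum_(i < N.+1) cabs (e i) * rho ^+ i + rho * S N)); last first.
  by rewrite lerD2r.
rewrite /S mulr_suml mulr_sumr !big_ord_recl /= -addrA; apply: lerD.
  by rewrite mulrAC ![_ * cabs a]mulrC rec0.
rewrite -big_split /=; apply: ler_sum => i _.
have := rec i; rewrite /bump /= add1n exprS => H.
have ri : 0 < rho ^+ i by rewrite exprn_gt0.
rewrite (_ : _ * cabs a = (rho * rho ^+ i) * (cabs a * cabs (e' i.+1))); last ring.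
rewrite (_ : _ + _ = (rho * rho ^+ i) * (cabs (e i.+1) + cabs (e' i))); last ring.
by rewrite ler_wpM2l// mulr_ge0// ltW.
Qed.

(* The truncation of [c] at [m] has no root in the closed disc, so its reciprocal
   converges absolutely there, and the coefficients of the reciprocal below [m] are those of [d]. *)
Lemma recip_poly_coef_bound (c d : nat -> C) (m : nat) (rho delta : R) :
  0 < rho -> 0 < delta ->
  (forall z, cabs z <= rho -> delta <= cabs (\sum_(i < m) c i * z ^+ i)) ->
  (forall n, cprod c d n = delta0 _ n) ->
  forall n, (n < m)%N -> cabs (d n) * rho ^+ n <= 2 / delta.
Proof.
move=> r0 del0 Pdel cd n nm.
pose P : {poly C} := \poly_(i < m) c i.
have PE z : P.[z] = \sum_(i < m) c i * z ^+ i by rewrite horner_poly.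
have [rs Prs] := closed_field_poly_normal P.
have P0 : P != 0.
  apply/negP => /eqP P0; have := Pdel 0; rewrite cabs0 -PE P0 horner0 cabs0.
  by move=> /(_ (ltW r0)); rewrite leNgt del0.
have lP0 : lead_coef P != 0 by rewrite lead_coef_eq0.
have out : all (fun a => rho < cabs a) rs.
  apply/allP => a ars; rewrite ltNge; apply/negP => /Pdel; rewrite -PE.
  rewrite Prs hornerZ (_ : (\prod_(z <- rs) _).[a] = 0) ?mulr0 ?cabs0.
    by rewrite leNgt del0.
  by apply/eqP; rewrite -/(root _ _) root_prod_XsubC.
have [e0 [B0 [He0 HB0]]] := recip_prod_summable r0 out.
pose e i := e0 i / lead_coef P.
have He k : cprod (fun i => P`_i) e k = delta0 _ k.
  rewrite -He0; apply: eq_bigr => i _.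
  by rewrite {1}Prs coefZ /e; field.
have HB N : \sum_(i < N) cabs (e i) * rho ^+ i <= B0 / cabs (lead_coef P).
  rewrite (eq_bigr (fun i : 'I_N => cabs (e0 i) * rho ^+ i / cabs (lead_coef P))).
    by rewrite -mulr_suml ler_wpM2r ?invr_ge0 ?cabs_ge0 ?HB0.
  by move=> i _; rewrite /e cabsM cabsV mulrAC.
have ed k : (k < m)%N -> e k = d k.
  move=> km; have c0 : P`_0 != 0.
    apply/negP => /eqP H; have := He 0; rewrite /cprod big_ord1 H mul0r.
    by move/esym/eqP; rewrite oner_eq0.
  apply: (@cprod_inj _ (fun i => P`_i) e d k) => // l lk.
  rewrite He -cd; apply: eq_cprod => // i il.
  by rewrite coef_poly (leq_ltn_trans _ km)// (leq_trans il).
(* Tails of the reciprocal below 1 / (A + 1) keep P D within 1 of its value 1 as a formal product;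
   hence |P D| <= 2 and |D| <= 2 / delta on the circle. *)
pose A := \sum_(i < m) cabs (c i) * rho ^+ i.
have A0 : 0 <= A by apply: sumr_ge0 => i _; rewrite mulr_ge0 ?cabs_ge0 ?exprn_ge0 ?(ltW r0).
have A1 : 0 < (A + 1)^-1 by rewrite invr_gt0 ltr_wpDl.
have e_ge0 i : 0 <= cabs (e i) * rho ^+ i by rewrite mulr_ge0 ?cabs_ge0 ?exprn_ge0 ?(ltW r0).
have [N HN] := bounded_partial_sums_tail e_ge0 HB A1.
(* For i < m the tail from M - i on lies beyond [N]. *)
pose M := (N + m)%N.
pose D : {poly C} := \poly_(i < M) e i.
have nM : (n < M)%N by rewrite /M; lia.
rewrite -ed// (_ : e n = D`_n); last by rewrite coef_poly nM.
apply: poly_cauchy_estimate => // z zr.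
pose x i := P`_i * z ^+ i; pose y i := e i * z ^+ i.
have PxE : P.[z] = \sum_(i < M) x i.
  by apply: horner_coef_wide; apply: leq_trans (size_poly _ _) _; rewrite leq_addl.
have DyE : D.[z] = \sum_(i < M) y i by rewrite horner_poly.
have xy k : cprod x y k = delta0 _ k.
  rewrite /delta0 (_ : cprod x y k = cprod (fun i => P`_i) e k * z ^+ k).
    by rewrite He /delta0; case: k => [|k]; rewrite ?mulr1 ?mul0r.
  rewrite /cprod mulr_suml; apply: eq_bigr => i _.
  by rewrite /x /y mulrACA -exprD subnKC// -ltnS.
have S1 : \sum_(i < M) x i * \sum_(j < M - i) y j = 1.
  rewrite -sum_cprod (eq_bigr (fun k : 'I_M => delta0 _ k)) => [|k _]; last exact: xy.
  by rewrite -(prednK (leq_ltn_trans (leq0n n) nM)) big_ord_recl /= big1 ?addr0.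
have close : cabs (P.[z] * D.[z] - 1) <= 1.
  rewrite -S1 PxE DyE mulr_suml -sumrB.
  apply: le_trans (cabs_sum _ _ _) _.
  apply: (@le_trans _ _ (\sum_(i < M) cabs (P`_i) * rho ^+ i * (A + 1)^-1)).
    apply: ler_sum => i _; rewrite -mulrBr cabsM {1}/x cabsM cabsX zr.
    have [mi|im] := leqP m i.
      by rewrite coef_poly ltnNge mi /= cabs0 !mul0r.
    rewrite ler_wpM2l ?mulr_ge0 ?cabs_ge0 ?exprn_ge0 ?(ltW r0)//.
    rewrite (_ : _ - _ = \sum_(M - i <= j < M) y j); last first.
      rewrite -!(big_mkord xpredT) (@big_cat_nat _ _ _ (M - i)%N)//= ?leq_subr//.
      by rewrite addrAC subrr add0r.
    apply: le_trans (HN M); apply: le_trans (cabs_sum _ _ _) _.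
    have NMi : (N <= M - i)%N by rewrite -{1}(addnK i N) leq_sub2r// leq_add2l ltnW.
    rewrite [leRHS](@big_cat_nat _ _ _ (M - i)%N) /= ?leq_subr//.
    rewrite ler_wpDl ?sumr_ge0//.
    by apply: ler_sum => j _; rewrite /y cabsM cabsX zr.
  rewrite -mulr_suml ler_pdivrMr ?ltr_wpDl// mul1r.
  apply: (@le_trans _ _ A); last by rewrite lerDl.
  rewrite /A (big_ord_widen M (fun i => cabs (c i) * rho ^+ i)) ?leq_addl//.
  rewrite [leRHS]big_mkcond /=; apply: ler_sum => i _; rewrite coef_poly.
  by case: ifP => //; rewrite cabs0 mul0r.
have PD2 : cabs P.[z] * cabs D.[z] <= 2.
  rewrite -cabsM; have := ler_cabsD (P.[z] * D.[z] - 1) 1.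
  by rewrite subrK cabs1; lra.
have := Pdel z; rewrite -PE zr lexx => /(_ isT) H.
rewrite ler_pdivlMr// mulrC; apply: le_trans PD2.
by rewrite ler_wpM2r ?cabs_ge0.
Qed.

End ReciprocalSeries.

(** * Zero-free symbols and the growth of both coefficient sequences *)

Section Symbol.
Variable R : realType.
Local Notation C := R[i].
Implicit Types (c d : nat -> C).

Lemma symbol_coef_bound c (r rho : R) : symbol_analytic_on c r -> 0 < rho -> rho < r ->
  exists B, forall n, cabs (c n) * rho ^+ n <= B.
Proof.
move=> an r0 rr; have zr : cabs (rho%:C%C : C) = rho by rewrite cabs_real gtr0_norm.
have [|s /cseries_toP hs] := an (rho%:C%C : C); first by rewrite zr.
have [N HN] := hs 1 ltr01.
(* From [N] on the partial sums at [rho] are within 1 of the limit, so the terms are at most 2; the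
   finite sum covers the earlier terms. *)
exists (2 + \sum_(i < N) cabs (c i) * rho ^+ i) => n.
have t0 i : 0 <= cabs (c i) * rho ^+ i by rewrite mulr_ge0 ?cabs_ge0 ?exprn_ge0 ?ltW.
have [Nn|nN] := leqP N n; last first.
  rewrite (bigD1 (Ordinal nN)) //= addrCA lerDl addr_ge0// sumr_ge0//.
apply: ler_wpDr; first by rewrite sumr_ge0.
have := HN n Nn; have := HN n.+1 (leqW Nn).
rewrite !ger0_norm ?cabs_ge0// big_ord_recr /=.
set S := \sum_(k < n) _ => h1 h2.
have := ler_cabsB (S + c n * rho%:C%C ^+ n - s) (S - s).
rewrite (_ : _ - _ = c n * rho%:C%C ^+ n); last ring.
by rewrite cabsM cabsX zr; lra.
Qed.

(** The Lipschitz constant n rho^(n - 1) of the n-th power on the disc, with both sides multiplied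
    by rho so that no predecessor occurs. *)
Lemma cabs_expB (z w : C) (rho : R) n : cabs z <= rho -> cabs w <= rho ->
  cabs (z ^+ n - w ^+ n) * rho <= n%:R * rho ^+ n * cabs (z - w).
Proof.
move=> zr wr; have r0 : 0 <= rho := le_trans (cabs_ge0 z) zr.
elim: n => [|n IH]; first by rewrite !expr0 subrr cabs0 !mul0r.
rewrite (_ : _ - _ = z * (z ^+ n - w ^+ n) + (z - w) * w ^+ n); last by rewrite !exprS; ring.
apply: le_trans (ler_wpM2r r0 (ler_cabsD _ _)) _.
rewrite mulrDl -natr1 exprS !cabsM cabsX.
have -> : (n%:R + 1) * (rho * rho ^+ n) * cabs (z - w) =
  rho * (n%:R * rho ^+ n * cabs (z - w)) + cabs (z - w) * rho ^+ n * rho by ring.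
apply: lerD.
  by rewrite -[leLHS]mulrA; apply: ler_pM; rewrite ?mulr_ge0 ?cabs_ge0.
rewrite ler_wpM2r// ler_wpM2l ?cabs_ge0//.
by rewrite lerXn2r ?nnegrE ?cabs_ge0.
Qed.

Lemma bounded_seq_cluster (z : nat -> C) (rho : R) : (forall n, cabs (z n) <= rho) ->
  exists w : C, forall (e : R) N, 0 < e -> exists n, (N <= n)%N /\ cabs (z n - w) <= e.
Proof.
move=> zr; pose u n := (complex.Re (z n), complex.Im (z n)) : R * R.
have cK : compact (`[- rho, rho] `*` `[- rho, rho] : set (R * R)).
  by apply: compact_setX; exact: segment_compact.
have uK : \forall n \near \oo, (`[- rho, rho] `*` `[- rho, rho])%classic (u n).
  near=> n; split => /=; rewrite in_itv /= -ler_norml; apply: le_trans (zr n).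
    exact: ler_Re_cabs.
  exact: ler_Im_cabs.
have [[a b] [_ cl]] := cK (u @ \oo) _ uK.
exists (a +i* b)%C => e N e0.
pose A : set (R * R) := [set x | exists2 n, (N <= n)%N & x = u n].
have FA : (u @ \oo) A by exists N => // n /= Nn; exists n.
have e2 : 0 < e / 2 by rewrite divr_gt0.
pose B : set (R * R) := ball (a, b) (e / 2).
have nB : nbhs (a, b) B by exact: nbhsx_ballx.
have [x [[n Nn ->] [Br Bi]]] := cl A B FA nB.
exists n; split => //; apply: le_trans (cabs_le_ReIm _) _.
rewrite ReD ImD ReN ImN /=.
have hr : `|a - complex.Re (z n)| < e / 2 by [].
have hi : `|b - complex.Im (z n)| < e / 2 by [].
rewrite distrC (distrC _ b); lra.
Unshelve. all: by end_near.
Qed.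

(** By compactness: otherwise arbitrarily long truncations take arbitrarily small values in the
    closed disc, and a cluster point of the places where they do so is a zero of the symbol. *)
Lemma symbol_truncation_lower_bound c (r rho : R) :
  symbol_analytic_on c r -> symbol_nonvanishing_on c r -> 0 < rho -> rho < r ->
  exists delta : R, 0 < delta /\ exists m0, forall m, (m0 <= m)%N ->
    forall z, cabs z <= rho -> delta <= cabs (\sum_(i < m) c i * z ^+ i).
Proof.
move=> an nv r0 rr; apply: contrapT => Hn.
(* The terms are bounded at this intermediate radius, hence decay geometrically at radius [rho]. *)
pose r1 := (rho + r) / 2; have r01 : rho < r1 by rewrite /r1; lra.
have [B HB] : exists B, forall n, cabs (c n) * r1 ^+ n <= B.
  by apply: symbol_coef_bound an _ _; rewrite /r1; lra.
have r10 : 0 < r1 by exact: lt_trans r01.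
have B0 : 0 <= B.
  by have := HB 0; rewrite expr0 mulr1; apply: le_trans; exact: cabs_ge0.
pose k := rho / r1; have k0 : 0 <= k by rewrite divr_ge0// ltW.
have k1 : k < 1 by rewrite ltr_pdivrMr// mul1r.
have ck n : cabs (c n) * rho ^+ n <= B * k ^+ n.
  rewrite /k expr_div_n mulrA ler_pdivlMr ?exprn_gt0// mulrAC.
  by rewrite ler_wpM2r ?exprn_ge0 ?(ltW r0).
(* One Lipschitz constant serves all truncations; it replaces uniform convergence. *)
have [L L0 HL] : exists2 L : R, 0 <= L & forall m z w, cabs z <= rho -> cabs w <= rho ->
    cabs (\sum_(i < m) c i * z ^+ i - \sum_(i < m) c i * w ^+ i) <= L * cabs (z - w).
  pose mu := (1 + k) / 2; have kmu : k < mu by rewrite /mu; lra.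
  have mu0 : 0 <= mu by rewrite /mu; lra.
  have mu1 : mu < 1 by rewrite /mu; lra.
  have [D HD] := linear_geom k0 kmu.
  have D0 : 0 <= D by have := HD 0; rewrite mul0r mulr1.
  exists (B * D / (1 - mu) / rho).
    by rewrite !mulr_ge0 ?invr_ge0 ?(ltW r0)//; lra.
  move=> m z w zr wr; rewrite mulrAC ler_pdivlMr// -sumrB.
  apply: le_trans (ler_wpM2r (ltW r0) (cabs_sum _ _ _)) _.
  rewrite mulr_suml.
  apply: (@le_trans _ _ (\sum_(i < m) B * D * cabs (z - w) * mu ^+ i)).
    apply: ler_sum => i _; rewrite -mulrBr cabsM -[leLHS]mulrA.
    apply: le_trans (ler_wpM2l (cabs_ge0 _) (cabs_expB i zr wr)) _.
    rewrite (_ : _ * (_ * _) = (cabs (c i) * rho ^+ i) * (i%:R * cabs (z - w))); last ring.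
    apply: (@le_trans _ _ (B * k ^+ i * (i%:R * cabs (z - w)))).
      by rewrite ler_wpM2r// mulr_ge0// cabs_ge0.
    rewrite (_ : _ * (_ * _) = B * cabs (z - w) * (i%:R * k ^+ i)); last ring.
    rewrite (_ : _ * mu ^+ i = B * cabs (z - w) * (D * mu ^+ i)); last ring.
    by rewrite ler_wpM2l// mulr_ge0// cabs_ge0.
  rewrite -mulr_sumr (_ : B * D / _ * _ = B * D * cabs (z - w) * (1 - mu)^-1); last ring.
  by rewrite ler_wpM2l ?geom_sum_le// !mulr_ge0// cabs_ge0.
have small n : exists mz : nat * C, [/\ (n <= mz.1)%N, cabs mz.2 <= rho &
    cabs (\sum_(i < mz.1) c i * mz.2 ^+ i) <= n.+1%:R^-1].
  apply: contrapT => Hs; apply: Hn; exists n.+1%:R^-1; split; first by rewrite invr_gt0.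
  exists n => m nm z zr; rewrite leNgt; apply/negP => H; apply: Hs.
  by exists (m, z); split => //; exact: ltW.
have [mz Hmz] := choice small.
have [w Hw] := @bounded_seq_cluster (fun n => (mz n).2) rho (fun n => let: And3 _ h _ := Hmz n in h).
have wr : cabs w <= rho.
  apply/ler_addgt0Pr => e e0; have [n [_ He]] := Hw e 0%N e0.
  have [_ h _] := Hmz n; have := ler_cabsB (mz n).2 ((mz n).2 - w).
  by rewrite subKr; lra.
have wr' : cabs w < r by exact: le_lt_trans rr.
have [s hs] := an w wr'.
have /negP := nv w wr' s hs; apply; rewrite -cabs_eq0; apply/eqP.
move/cseries_toP : hs => hs.
apply/eqP; rewrite eq_le cabs_ge0 andbT; apply: le0_eps => e e0.
have e3 : 0 < e / 3 by rewrite divr_gt0.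
have eL : 0 < e / 3 / (L + 1) by rewrite divr_gt0// ltr_wpDl.
have [N HN] := hs _ e3.
(* Three errors of e / 3: the truncation at w against s, the move from w to the chosen point, and
   the value there, at most 1 / (n + 1). *)
have [n [Nn Hnw]] := Hw _ (maxn N (Num.truncn (e / 3)^-1)) eL.
have [nm zr Pn] := Hmz n.
rewrite geq_max in Nn; case/andP : Nn => Nn Tn.
have := HN _ (leq_trans Nn nm); rewrite ger0_norm ?cabs_ge0//=.
have := HL (mz n).1 _ _ zr wr.
set Pw := \sum_(i < _) c i * w ^+ i; set Pz := \sum_(i < _) c i * _ ^+ i.
rewrite -/Pz in Pn.
have h1 : L * cabs ((mz n).2 - w) <= e / 3.
  apply: (@le_trans _ _ ((L + 1) * (e / 3 / (L + 1)))).
    by rewrite ler_pM ?cabs_ge0// lerDl.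
  by rewrite mulrC divfK// gt_eqF// ltr_wpDl.
have h2 : n.+1%:R^-1 <= e / 3 :> R.
  rewrite invf_ple ?posrE//; apply: ltW.
  apply: lt_le_trans (Num.Theory.truncnS_gt _) _; by rewrite ler_nat ltnS.
move=> h3 h4.
have := ler_cabsB Pz (Pz - Pw); rewrite subKr.
have := ler_cabsB Pw (Pw - s); rewrite subKr. move: (le_trans h3 h1) (le_trans Pn h2); lra.
Qed.

(** The bound 2 / delta is the same for all long truncations, so each coefficient may use a
    truncation of its own. *)
Lemma reciprocal_symbol_coef_bound c d (r rho : R) :
  symbol_analytic_on c r -> symbol_nonvanishing_on c r ->
  (forall n, cprod c d n = delta0 _ n) -> 0 < rho -> rho < r ->
  exists B, forall n, cabs (d n) * rho ^+ n <= B.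
Proof.
move=> an nv cd r0 rr.
have [delta [d0 [m0 H]]] := symbol_truncation_lower_bound an nv r0 rr.
exists (2 / delta) => n.
apply: (@recip_poly_coef_bound _ c d (maxn n.+1 m0)) => //; last by rewrite leq_max ltnSn.
by apply: H; rewrite leq_max leqnn orbT.
Qed.

End Symbol.

(** * Haar sums on the dyadic tree *)

Section DyadicTree.

Lemma lev1 : lev 1 = 0%N. Proof. by []. Qed.

Lemma lev_double n : (0 < n)%N -> lev n.*2 = (lev n).+1.
Proof. exact: trunc_log2_double. Qed.

Lemma lev_doubleS n : (0 < n)%N -> lev n.*2.+1 = (lev n).+1.
Proof.
move=> n0; rewrite /lev trunc_log2S; last by rewrite ltnS double_gt0.
by rewrite /= uphalf_double.
Qed.

Lemma lev_bounds n : (0 < n)%N -> (2 ^ lev n <= n < 2 ^ (lev n).+1)%N.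
Proof. by move=> n0; exact: trunc_log_bounds. Qed.

Lemma lev_eq n l : (2 ^ l <= n < 2 ^ l.+1)%N -> lev n = l.
Proof. by move=> H; apply: trunc_log_eq. Qed.

Lemma lev_exp l i : (i < 2 ^ l)%N -> lev (2 ^ l + i) = l.
Proof. by move=> il; apply: lev_eq; rewrite leq_addr expnS mul2n -addnn ltn_add2l. Qed.

Lemma logn2_double n : (0 < n)%N -> logn 2 n.*2 = (logn 2 n).+1.
Proof. by move=> n0; rewrite -mul2n lognM// (lognE 2 2). Qed.

Lemma logn2_doubleS n : logn 2 n.*2.+1 = 0%N.
Proof. by rewrite lognE /= dvdn2 /= odd_double. Qed.

Lemma node_ind (P : nat -> Prop) : P 1%N ->
  (forall n, (0 < n)%N -> P n -> P n.*2 /\ P n.*2.+1) -> forall n, (0 < n)%N -> P n.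
Proof.
move=> P1 Pn n; have [m] := ubnP n; elim: m n => // m IH [//|[//|n]] nm _.
have h : (0 < n.+2./2)%N by [].
have [|Pe Po] := Pn _ h; first by apply: IH => //; rewrite ltnS in nm; apply: leq_trans nm; rewrite /= ltnS; lia.
by rewrite -(odd_double_half n.+2); case: odd; rewrite ?add1n ?add0n.
Qed.

End DyadicTree.

Section TreeSums.
Variable V : zmodType.
Implicit Types (F : nat -> V).

Lemma sum_double F a b : \sum_(a.*2 <= n < b.*2) F n =
  \sum_(a <= n < b) (F n.*2 + F n.*2.+1).
Proof.
have [ab|ba] := leqP a b; last by rewrite !big_geq ?leq_double// ltnW.
rewrite -(subnKC ab); elim: (b - a)%N => [|k IH]; first by rewrite addn0 !big_geq.
have h : (a.*2 <= (a + k).*2)%N by rewrite leq_double leq_addr.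
rewrite addnS doubleS big_nat_recr ?(leqW h)//= big_nat_recr//= IH.
by rewrite [RHS]big_nat_recr ?leq_addr//= addrA.
Qed.

(** Moving the window by one replaces the node [N] by its two children; inductions over windows rest
    on this. *)
Lemma sum_window_succ F N : (0 < N)%N -> \sum_(N.+1 <= n < N.+1.*2) F n =
  \sum_(N <= n < N.*2) F n + (F N.*2 + F N.*2.+1 - F N).
Proof.
move=> N0; have h : (N < N.*2)%N by rewrite -addnn -[ltnLHS]addn0 ltn_add2l.
rewrite doubleS !big_nat_recr//=; last by rewrite (leq_trans h).
rewrite [in RHS]big_ltn//=.
by rewrite -!addrA; rewrite [RHS]addrC -!addrA addNr addr0.
Qed.

End TreeSums.

Section TreeValue.
Variable V : zmodType.
Implicit Types (x : nat -> V).

(* The value of [sum_m x m * h_m] on [nodeI n], the terms with [m >= n] omitted. *)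
Definition treeval x n : V :=
  \sum_(k < lev n) (if odd (n %/ 2 ^ k) then - x (n %/ 2 ^ k.+1)%N else x (n %/ 2 ^ k.+1)%N).

Lemma treeval1 x : treeval x 1 = 0. Proof. by rewrite /treeval big_ord0. Qed.

Lemma treeval_double x n : (0 < n)%N -> treeval x n.*2 = treeval x n + x n.
Proof.
move=> n0; rewrite /treeval lev_double// big_ord_recl /= expn0 divn1 odd_double expn1.
rewrite divn2 doubleK addrC; congr (_ + _); apply: eq_bigr => i _.
by rewrite /bump add1n -mul2n ![(2 ^ _.+1)%N]expnS !divnMA !mulKn.
Qed.

Lemma treeval_doubleS x n : (0 < n)%N -> treeval x n.*2.+1 = treeval x n - x n.
Proof.
move=> n0; rewrite /treeval lev_doubleS// big_ord_recl /= expn0 divn1 /= odd_double expn1.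
rewrite divn2 /= uphalf_double addrC; congr (_ + _); apply: eq_bigr => i _.
have E k : (n.*2.+1 %/ 2 ^ k.+1 = n %/ 2 ^ k)%N.
  by rewrite expnS divnMA divn2 /= uphalf_double.
by rewrite /bump add1n !E.
Qed.

Lemma eq_treeval x y n : (0 < n)%N -> (forall m, (0 < m < n)%N -> x m = y m) -> treeval x n = treeval y n.
Proof.
move: n; apply: node_ind => [|n n0 IH]; first by rewrite !treeval1.
split=> H; rewrite ?treeval_double ?treeval_doubleS// IH ?H// => *; rewrite ?H//; lia.
Qed.

End TreeValue.

Lemma treeval_morph (U V : zmodType) (f : U -> V) (x : nat -> U) n :
  {morph f : a b / a + b} -> {morph f : a / - a} -> f 0 = 0 -> (0 < n)%N ->
  f (treeval x n) = treeval (f \o x) n.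
Proof.
move=> fD fN f0; move: n; apply: node_ind => [|n n0 IH]; first by rewrite !treeval1.
by rewrite !treeval_double// !treeval_doubleS// !fD fN IH.
Qed.

(** * Means over windows and Parseval's identity *)

Section TreeMean.
Variable K : numFieldType.
Implicit Types (G : nat -> K).

(** The length of the dyadic interval of index [n]. *)
Definition wt n : K := (2 ^+ lev n)^-1.

Lemma wt_gt0 n : 0 < wt n. Proof. by rewrite invr_gt0 exprn_gt0. Qed.
Lemma wt_ge0 n : 0 <= wt n. Proof. exact/ltW/wt_gt0. Qed.
Lemma wt1 : wt 1 = 1. Proof. by rewrite /wt lev1 expr0 invr1. Qed.
Lemma wt_double n : (0 < n)%N -> wt n.*2 = wt n / 2.
Proof. by move=> n0; rewrite /wt lev_double// exprSr invfM. Qed.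
Lemma wt_doubleS n : (0 < n)%N -> wt n.*2.+1 = wt n / 2.
Proof. by move=> n0; rewrite /wt lev_doubleS// exprSr invfM. Qed.

(* As the intervals [nodeI n] with [N <= n < N.*2] partition (0,1], this is the
   integral of the function equal to [G n] on each of them. *)
Definition tmean N G : K := \sum_(N <= n < N.*2) wt n * G n.

Lemma tmean1 G : tmean 1 G = G 1%N.
Proof. by rewrite /tmean big_nat1 wt1 mul1r. Qed.

Lemma tmeanS N G : (0 < N)%N -> tmean N.+1 G =
  tmean N G + wt N * ((G N.*2 + G N.*2.+1) / 2 - G N).
Proof.
move=> N0; rewrite /tmean sum_window_succ// wt_double// wt_doubleS//.
by congr (_ + _); field.
Qed.

Lemma tmean_cst N (a : K) : (0 < N)%N -> tmean N (fun=> a) = a.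
Proof.
case: N => // N _; elim: N => [|N IH]; first exact: tmean1.
by rewrite tmeanS// IH; field.
Qed.

Lemma tmean_treeval N x : (0 < N)%N -> tmean N (treeval x) = 0.
Proof.
case: N => // N _; elim: N => [|N IH]; first by rewrite tmean1 treeval1.
by rewrite tmeanS// IH treeval_double// treeval_doubleS//; field.
Qed.

(** Parseval's identity in bilinear form: when node [N] is split, the cross terms of its two
    children cancel and only the term of index [N] is added. *)
Lemma tmean_treevalM N x y : (0 < N)%N -> tmean N (fun n => treeval x n * treeval y n) =
  \sum_(1 <= m < N) wt m * (x m * y m).
Proof.
case: N => // N _; elim: N => [|N IH]; first by rewrite tmean1 treeval1 mul0r big_geq.
rewrite tmeanS// IH [RHS]big_nat_recr//=; congr (_ + _ * _).
by rewrite !treeval_double// !treeval_doubleS//; field.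
Qed.

Lemma tmeanZ N (a : K) G : tmean N (fun n => a * G n) = a * tmean N G.
Proof. by rewrite /tmean mulr_sumr; apply: eq_bigr => i _; rewrite mulrCA. Qed.

Lemma tmeanD N G H : tmean N (fun n => G n + H n) = tmean N G + tmean N H.
Proof. by rewrite /tmean -big_split; apply: eq_bigr => i _; rewrite mulrDr. Qed.

Lemma ler_tmean N G H : (forall n, (N <= n < N.*2)%N -> G n <= H n) -> tmean N G <= tmean N H.
Proof.
move=> GH; rewrite /tmean big_nat [leRHS]big_nat; apply: ler_sum => n /GH.
exact/ler_wpM2l/wt_ge0.
Qed.

Lemma eq_tmean N G H : (forall n, (N <= n < N.*2)%N -> G n = H n) -> tmean N G = tmean N H.
Proof.
by move=> GH; rewrite /tmean big_nat [RHS]big_nat; apply: eq_bigr => n /GH ->.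
Qed.

Lemma tmean_level l G : tmean (2 ^ l) G = (2 ^+ l)^-1 * \sum_(2 ^ l <= n < (2 ^ l).*2) G n.
Proof.
rewrite /tmean mulr_sumr big_nat [RHS]big_nat; apply: eq_bigr => n H.
by rewrite /wt (@lev_eq n l)// expnS mul2n.
Qed.

End TreeMean.

(** * Cauchy products along the spines of the tree *)

Section TreeConvolution.
Variable K : fieldType.
Implicit Types (c d x : nat -> K).

(* The Haar coefficients of [sum_n x n * f_n] when [f] is the chaos of [c]. *)
Definition tconv c x m : K := \sum_(i < (logn 2 m).+1) c i * x (m %/ 2 ^ i)%N.

(** Read from its odd root upwards, the spine through [m] turns [tconv] into an ordinary Cauchy
    product. *)
Lemma tconvE c x m : tconv c x m =
  cprod c (fun l => x (m %/ 2 ^ (logn 2 m - l))%N) (logn 2 m).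
Proof.
by apply: eq_bigr => i _; rewrite subKn// -ltnS.
Qed.

Lemma logn2_div m i : (0 < m)%N -> (i <= logn 2 m)%N -> logn 2 (m %/ 2 ^ i) = (logn 2 m - i)%N.
Proof.
move=> m0 im; rewrite logn_div ?pfactorK//.
by rewrite pfactor_dvdn.
Qed.

Lemma tconvA c d x m : (0 < m)%N -> tconv c (tconv d x) m = tconv (cprod c d) x m.
Proof.
move=> m0; rewrite [RHS]tconvE -cprodA; apply: eq_bigr => i _; congr (_ * _).
have im : (i <= logn 2 m)%N by rewrite -ltnS.
rewrite /tconv /cprod logn2_div//; apply: eq_bigr => j _; congr (_ * x _).
rewrite -divnMA -expnD; congr (_ %/ 2 ^ _)%N.
by have := ltn_ord j; rewrite ltnS; lia.
Qed.

Lemma tconv_delta0 x m : tconv (delta0 K) x m = x m.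
Proof.
rewrite /tconv big_ord_recl /= mul1r divn1 big1 ?addr0// => i _.
by rewrite /delta0 mul0r.
Qed.

Lemma eq_tconv c c' x x' m : (0 < m)%N -> (forall i, c i = c' i) ->
  (forall n, (0 < n <= m)%N -> x n = x' n) -> tconv c x m = tconv c' x' m.
Proof.
move=> m0 cc xx; apply: eq_bigr => i _; rewrite cc xx//.
rewrite leq_div divn_gt0 ?expn_gt0// dvdn_leq// pfactor_dvdn//.
by rewrite -ltnS ltn_ord.
Qed.

Lemma tconvK c d x m : (forall n, cprod c d n = delta0 K n) -> (0 < m)%N ->
  tconv c (tconv d x) m = x m.
Proof.
move=> cd m0; rewrite tconvA// -[RHS]tconv_delta0.
by apply: eq_tconv.
Qed.

End TreeConvolution.

(** * Boundedness of the symbol *)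

Section Blocks.
Variable (R : realType) (L : nat).
Hypothesis L0 : (0 < L)%N.

(* Supported on the spines [2 ^ k * n] with [n] odd and [lev n = 1 %[mod L]], where the
   value is [a k]: the Haar sum is a sum of independent copies of one chaos, one
   for each band of [L] levels, and [tconv c] acts on a spine as [cprod c]. *)
Definition block (V : zmodType) (a : nat -> V) (m : nat) : V :=
  if (logn 2 m).+1 == (lev m %% L)%N then a (logn 2 m) else 0.

(** Whether the 2-adic valuation equals a number below [k] is decided by the last [k] binary
    digits. *)
Lemma logn2_block mu k i j : (0 < mu)%N -> (i < 2 ^ k)%N -> (j < k)%N ->
  (logn 2 (2 ^ k * mu + i) == j) = (logn 2 (2 ^ k + i) == j).
Proof.
move=> mu0; elim: k i j => // k IH i j ik jk.
have i2 : (i./2 < 2 ^ k)%N.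
  by move: ik; rewrite expnS; lia.
have E nu : (2 ^ k.+1 * nu + i = odd i + (2 ^ k * nu + i./2).*2)%N.
  by rewrite -{1}(odd_double_half i) doubleD -!muln2 expnS; lia.
rewrite -{2}(muln1 (2 ^ k.+1)%N) !E; case: (odd i).
  by rewrite !add1n !logn2_doubleS.
have pos nu : (0 < nu)%N -> (0 < 2 ^ k * nu + i./2)%N by move=> ?; rewrite addn_gt0 muln_gt0 expn_gt0 /=; lia.
rewrite !add0n !logn2_double ?pos//; case: j jk => // j jk.
by rewrite !eqSS IH// muln1.
Qed.

Lemma lev_block mu k i : (0 < mu)%N -> (i < 2 ^ k)%N -> lev (2 ^ k * mu + i) = (k + lev mu)%N.
Proof.
move=> mu0 ik; apply: lev_eq; have /andP[h1 h2] := lev_bounds mu0.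
rewrite expnD -(addnS k) expnD; apply/andP; split.
  by apply: leq_trans (leq_addr _ _); rewrite leq_mul2l h1 orbT.
apply: leq_trans (_ : 2 ^ k * mu.+1 <= _)%N; first by rewrite mulnS addnC ltn_add2r.
by rewrite leq_mul2l h2 orbT.
Qed.

(** The same pattern hangs below every node that starts a band: [block] tests the valuation against
    k - 1, which the last [k] digits decide. *)
Lemma block_periodic (V : zmodType) (a : nat -> V) mu k i : (0 < mu)%N -> (L %| lev mu)%N ->
  (k < L)%N -> (i < 2 ^ k)%N -> block a (2 ^ k * mu + i) = block a (2 ^ k + i).
Proof.
move=> mu0 Lmu kL ik; rewrite /block lev_block// lev_exp//.
rewrite -modnDmr (eqP Lmu) addn0 modn_small//.
case: k kL ik => [|k] kL ik //.
by rewrite !eqSS logn2_block//; case: eqP => //= E; congr a; apply/eqP; rewrite E logn2_block// E.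
Qed.

(** Independence of the bands: the increment below [mu] depends on the digits [i] only, not on
    [mu]. *)
Lemma treeval_block (V : zmodType) (a : nat -> V) mu k i : (0 < mu)%N -> (L %| lev mu)%N ->
  (k <= L)%N -> (i < 2 ^ k)%N ->
  treeval (block a) (2 ^ k * mu + i) = treeval (block a) mu + treeval (block a) (2 ^ k + i).
Proof.
move=> mu0 Lmu; elim: k i => [|k IH] i kL ik.
  by case: i ik => // _; rewrite expn0 mul1n addn0 treeval1 addr0.
have i2 : (i./2 < 2 ^ k)%N.
  by move: ik; rewrite expnS; lia.
have E nu : (2 ^ k.+1 * nu + i = odd i + (2 ^ k * nu + i./2).*2)%N.
  by rewrite -{1}(odd_double_half i) doubleD -!muln2 expnS; lia.
have pos nu : (0 < nu)%N -> (0 < 2 ^ k * nu + i./2)%N by move=> ?; rewrite addn_gt0 muln_gt0 expn_gt0 /=; lia.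
rewrite -{2}(muln1 (2 ^ k.+1)%N) !E.
case: (odd i); rewrite ?add1n ?add0n ?treeval_double ?treeval_doubleS ?pos//.
  by rewrite IH ?(ltnW kL)// !muln1 block_periodic// addrA.
by rewrite IH ?(ltnW kL)// !muln1 block_periodic// addrA.
Qed.

Lemma sum_level_split (V : zmodType) (F : nat -> V) l k :
  \sum_(2 ^ (k + l) <= n < (2 ^ (k + l)).*2) F n =
  \sum_(2 ^ l <= mu < (2 ^ l).*2) \sum_(0 <= i < 2 ^ k) F (2 ^ k * mu + i)%N.
Proof.
elim: k F => [|k IH] F.
  by apply: eq_bigr => mu _; rewrite expn0 big_nat1 mul1n addn0.
rewrite addSn (expnS 2 (k + l)) (mul2n (2 ^ (k + l))) sum_double IH; apply: eq_bigr => mu _.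
rewrite (expnS 2 k) (mul2n (2 ^ k)) [RHS](sum_double _ 0); apply: eq_bigr => i _.
by congr (F _ + F _); rewrite -!muln2; lia.
Qed.

(** The bands are independent and identically distributed, so their exponential moments multiply. *)
Lemma tmean_block_expR (a : nat -> R) M :
  tmean (2 ^ (L * M)) (fun n => expR (treeval (block a) n)) =
  (tmean (2 ^ L) (fun n => expR (treeval (block a) n))) ^+ M.
Proof.
elim: M => [|M IH]; first by rewrite muln0 expn0 tmean1 treeval1 expR0 expr0.
rewrite exprSr -IH mulnS !tmean_level sum_level_split exprD invfM mulrACA.
rewrite [_ * (2 ^+ L)^-1]mulrC; congr (_ * _).
rewrite mulr_suml big_nat [RHS]big_nat; apply: eq_bigr => mu muLM.
have lmu := lev_eq (n := mu) (l := L * M).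
have := sum_level_split (fun n => expR (treeval (block a) n)) 0 L.
rewrite addn0 expn0 big_nat1 => ->.
rewrite mulr_sumr big_nat [RHS]big_nat; apply: eq_bigr => i /andP[_ iL].
rewrite muln1 treeval_block ?expRD//.
- by case/andP : muLM => h _; apply: leq_trans h; rewrite expn_gt0.
- by rewrite lmu ?dvdn_mulr// expnS mul2n.
Qed.

Lemma sum_level_logn2 (V : zmodType) (b : V) l k : (k < l)%N ->
  \sum_(2 ^ l <= n < (2 ^ l).*2) (if logn 2 n == k then b else 0) = b *+ 2 ^ (l - k.+1).
Proof.
elim: k l => [|k IH] [//|l] kl; rewrite expnS mul2n sum_double big_nat.
  rewrite (eq_bigr (fun=> b)) => [|i /andP[h _]].
    by rewrite -big_nat sumr_const_nat -addnn addnK subn1.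
  rewrite logn2_double ?logn2_doubleS ?add0r//.
  by apply: leq_trans h; rewrite expn_gt0.
rewrite -(IH l)// big_nat; apply: eq_bigr => i /andP[h _].
rewrite logn2_double ?logn2_doubleS ?addr0//.
by apply: leq_trans h; rewrite expn_gt0.
Qed.

Lemma sum_tree_levels (V : zmodType) (F : nat -> V) l :
  \sum_(1 <= n < 2 ^ l) F n = \sum_(k < l) \sum_(2 ^ k <= n < (2 ^ k).*2) F n.
Proof.
elim: l => [|l IH]; first by rewrite big_ord0 big_geq.
rewrite big_ord_recr -IH /= -mul2n -expnS -big_cat_nat//= ?expn_gt0//.
by rewrite leq_exp2l.
Qed.

Lemma sum_ord_mul (V : zmodType) (F : nat -> V) M :
  (forall k, F (k + L)%N = F k) -> \sum_(k < L * M) F k = (\sum_(k < L) F k) *+ M.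
Proof.
move=> FL; elim: M => [|M IH]; first by rewrite muln0 big_ord0.
rewrite mulrSr -IH mulnS addnC -!(big_mkord xpredT) (@big_cat_nat _ _ _ (L * M)) ?leq_addr//=.
congr (_ + _); rewrite -{1}(add0n (L * M)%N) big_addn addKn big_nat [RHS]big_nat.
apply: eq_bigr => i _; elim: M {IH} => [|M IH]; first by rewrite muln0 addn0.
by rewrite mulnS (addnC L) addnA FL.
Qed.

(** A level l congruent to k + 1 modulo [L] has 2^(l - k - 1) nodes of valuation k, each of weight
    2^(-l): it contributes 2^(-k-1) U_k, whichever band it is in. Levels divisible by [L] contribute
    nothing. *)
Lemma wsum_block (K : numFieldType) (u U : nat -> K) M :
  (forall m, (0 < m)%N -> u m = block U m) ->
  \sum_(1 <= m < 2 ^ (L * M)) wt K m * u m =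
  (2^-1 * \sum_(k < L.-1) (2 ^+ k)^-1 * U k) *+ M.
Proof.
move=> uU; rewrite sum_tree_levels.
pose G l : K := if (l %% L)%N is k.+1 then (2 ^+ k.+1)^-1 * U k else 0.
rewrite (eq_bigr (fun l : 'I_(L * M) => G l)) => [|l _]; last first.
  rewrite big_nat (eq_bigr (fun m => (2 ^+ l)^-1 * (if (logn 2 m).+1 == (l %% L)%N then U (l %% L).-1 else 0))).
    rewrite -big_nat -mulr_sumr /G; case E : (l %% L)%N => [|k].
      by rewrite big1 ?mulr0.
    have kl : (k < l)%N by rewrite -E leq_mod.
    rewrite (sum_level_logn2 (U k) kl) -[U k *+ _]mulr_natr.
    rewrite natrX mulrCA [RHS]mulrC; congr (_ * _).
    by rewrite -{1}(subnK kl) exprD invfM mulrAC mulVf ?mul1r ?expf_neq0.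
  move=> m /andP[h1 h2]; have lm := lev_eq (n := m) (l := l).
  rewrite uU; last by apply: leq_trans h1; rewrite expn_gt0.
  rewrite /wt /block lm ?h1 ?expnS ?mul2n//.
  by case: eqP => // <-.
rewrite (sum_ord_mul (F := G)); last by move=> k; rewrite /G modnDr.
congr (_ *+ _); case: L L0 @G => // n _ G.
rewrite big_ord_recl /= {1}/G mod0n add0r mulr_sumr; apply: eq_bigr => i _.
rewrite /G /bump add1n modn_small ?ltnS// exprS invfM mulrA.
by [].
Qed.

End Blocks.

Section RealInequalities.
Variable R : realType.
Implicit Types (x y b q : R).

Lemma expR_quadratic y : `|y| <= 2^-1 -> expR y <= 1 + y + 2 * y ^+ 2.
Proof.
rewrite ler_norml => /andP[y1 y2].
have h : 0 < 1 - y by lra.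
have -> : expR y = (expR (- y))^-1 by rewrite expRN invrK.
apply: (@le_trans _ _ (1 - y)^-1).
  by rewrite lef_pV2 ?posrE ?expR_gt0// expR_ge1Dx.
(* Here (1 - y) (1 + y + 2 y^2) = 1 + y^2 (1 - 2 y). *)
rewrite -[leLHS]mul1r ler_pdivrMr//; nra.
Qed.

Lemma powR_le_expR q : 0 <= q -> exists2 B : R, 0 <= B & forall b, 0 <= b -> b `^ q <= 1 + B * expR b.
Proof.
(* For b > 1, with n > q: b^q <= b^n = n^n (b / n)^n <= n^n exp b. *)
move=> q0; pose n := (Num.truncn q).+1; exists (n%:R ^+ n) => [|b b0]; first by rewrite exprn_ge0.
have [b1|b1] := lerP b 1.
  apply: (@le_trans _ _ 1); last by rewrite lerDl mulr_ge0 ?expR_ge0 ?exprn_ge0.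
  by rewrite [leRHS](_ : 1 = 1 `^ q) ?ge0_ler_powR ?nnegrE ?powR1.
apply: (@le_trans _ _ (b ^+ n)).
  rewrite -powR_mulrn// ler_powR ?(ltW b1)//.
  by apply: ltW; exact: Num.Theory.truncnS_gt.
have n0 : 0 < n%:R :> R by [].
apply: ler_wpDl => //.
have -> : expR b = expR (b / n%:R) ^+ n.
  by rewrite -expRM_natl mulrC divfK// gt_eqF.
rewrite -exprMn lerXn2r// ?nnegrE ?mulr_ge0 ?expR_ge0//.
rewrite mulrC -ler_pdivrMr//; apply: le_trans (expR_ge1Dx _).
by rewrite lerDr.
Qed.

Lemma powR_le_sq b q : 0 <= b -> 0 <= q -> q <= 2 -> b `^ q <= 1 + b ^+ 2.
Proof.
move=> b0 q0 q2; have [b1|b1] := lerP b 1.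
  apply: (@le_trans _ _ 1); last by rewrite lerDl sqr_ge0.
  by rewrite [leRHS](_ : 1 = 1 `^ q) ?ge0_ler_powR ?nnegrE ?powR1.
apply: (@le_trans _ _ (b ^+ 2)); last by rewrite lerDr.
by rewrite -powR_mulrn// ler_powR// ltW.
Qed.

Lemma young_powR (a b q : R) : 1 < q -> 0 <= a -> 0 <= b -> a * b <= a `^ q + b `^ (q / (q - 1)).
Proof.
move=> q1 a0 b0; have q0 : 0 < q by lra.
have q10 : 0 < q - 1 by lra.
have q'0 : 0 < q / (q - 1) by rewrite divr_gt0.
apply: le_trans (@conjugate_powR _ a b q (q / (q - 1)) a0 b0 q0 q'0 _) _.
  by field; rewrite !gt_eqF.
apply: lerD; rewrite ler_pdivrMr// ler_peMr ?powR_ge0//; first exact: ltW.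
by rewrite ler_pdivlMr// mul1r; lra.
Qed.

End RealInequalities.

Section BlockBounds.
Variable R : realType.
Local Notation C := R[i].

Lemma lev_div m i : (0 < m)%N -> (i <= logn 2 m)%N -> lev (m %/ 2 ^ i) = (lev m - i)%N.
Proof.
move=> m0 im; have dm : (2 ^ i %| m)%N by rewrite pfactor_dvdn.
have m'0 : (0 < m %/ 2 ^ i)%N by rewrite divn_gt0 ?expn_gt0// dvdn_leq.
have -> : lev m = (i + lev (m %/ 2 ^ i))%N.
  by rewrite -(@lev_block (m %/ 2 ^ i) i 0) ?expn_gt0// addn0 mulnC divnK.
by rewrite addKn.
Qed.

(** Halving lowers level and valuation together, so every node of the spine below a node of the
    support is in the support too, and no value of [a] is lost. *)
Lemma block_tconv (K : fieldType) L (c a w : nat -> K) m : (0 < L)%N -> (0 < m)%N ->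
  block L w m * tconv c (block L a) m = block L (fun k => w k * cprod c a k) m.
Proof.
move=> L0 m0; rewrite {1 3}/block; case: eqP => [E|_]; last by rewrite mul0r.
congr (_ * _); apply: eq_bigr => i _; congr (_ * _).
have im : (i <= logn 2 m)%N by rewrite -ltnS.
have vL : ((logn 2 m).+1 < L)%N by rewrite E ltn_mod.
rewrite /block logn2_div// lev_div// (divn_eq (lev m) L) -E.
rewrite -addnBA; last by apply: leq_trans im _.
by rewrite subSn// modnMDl modn_small ?eqxx//; lia.
Qed.

Lemma cabs_wt n : cabs (wt C n) = wt R n.
Proof.
rewrite /wt cabsV cabsX; congr (_ ^+ _)^-1.
by rewrite -[2 in LHS](rmorph_nat (real_complex R)) cabs_real ger0_norm.
Qed.

Lemma cabs_tmean N (G : nat -> C) : cabs (tmean N G) <= tmean N (fun n => cabs (G n)).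
Proof.
apply: le_trans (cabs_sum _ _ _) _; apply: ler_sum => n _.
by rewrite cabsM cabs_wt.
Qed.

Lemma Re_treeval (x : nat -> C) n : (0 < n)%N ->
  complex.Re (treeval x n) = treeval (fun m => complex.Re (x m)) n.
Proof. by move=> n0; apply: (treeval_morph _ (@ReD R) (@ReN R)). Qed.

Lemma Im_treeval (x : nat -> C) n : (0 < n)%N ->
  complex.Im (treeval x n) = treeval (fun m => complex.Im (x m)) n.
Proof. by move=> n0; apply: (treeval_morph _ (@ImD R) (@ImN R)). Qed.

Lemma tmean_cabs_sq N (x : nat -> C) : (0 < N)%N ->
  tmean N (fun n => cabs (treeval x n) ^+ 2) = \sum_(1 <= m < N) wt R m * cabs (x m) ^+ 2.
Proof.
move=> N0.
rewrite (@eq_tmean _ _ _ (fun n => treeval (fun m => complex.Re (x m)) n * treeval (fun m => complex.Re (x m)) n +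
   treeval (fun m => complex.Im (x m)) n * treeval (fun m => complex.Im (x m)) n)).
  rewrite tmeanD !tmean_treevalM// -big_split; apply: eq_bigr => m _.
  by rewrite cabs_sqr !expr2 mulrDr.
move=> n /andP[Nn _]; have n0 : (0 < n)%N by apply: leq_trans Nn.
by rewrite cabs_sqr Re_treeval// Im_treeval// !expr2.
Qed.

(** On one band exp y <= 1 + y + 2 y^2: the linear term has mean zero and Parseval gives the
    quadratic one, its factor 2 cancelling the 2^-1 of [wsum_block]. Then 1 + x <= exp x, and
    independence raises to the power [M]. *)
Lemma tmean_expR_block_le L (a : nat -> R) M : (0 < L)%N ->
  (forall n, (2 ^ L <= n < (2 ^ L).*2)%N -> `|treeval (block L a) n| <= 2^-1) ->
  tmean (2 ^ (L * M)) (fun n => expR (treeval (block L a) n)) <=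
  expR (M%:R * \sum_(k < L.-1) (2 ^+ k)^-1 * a k ^+ 2).
Proof.
move=> L0 small; rewrite tmean_block_expR// expRM_natl.
have p0 : (0 < 2 ^ L)%N by rewrite expn_gt0.
apply: lerXn2r; rewrite ?nnegrE ?expR_ge0//.
  by apply: sumr_ge0 => n _; rewrite mulr_ge0 ?wt_ge0 ?expR_ge0.
apply: le_trans (expR_ge1Dx _).
apply: (@le_trans _ _ (tmean (2 ^ L) (fun n => 1 + treeval (block L a) n + 2 * (treeval (block L a) n * treeval (block L a) n)))).
  by apply: ler_tmean => n /small/expR_quadratic; rewrite expr2.
rewrite !tmeanD tmean_cst// tmean_treeval// addr0 lerD2l tmeanZ tmean_treevalM//.
have := @wsum_block L L0 R (fun m => block L a m * block L a m) (fun k => a k * a k) 1.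
rewrite muln1 mulr1n => ->.
  by rewrite mulVKf.
by move=> m _; rewrite /block; case: ifP => // _; rewrite mul0r.
Qed.

End BlockBounds.

(** * From L^q bounds on Haar sums to a bounded symbol *)

Section BoundedSymbol.
Variable R : realType.
Local Notation C := R[i].

Definition tconv_bounded (q : R) (c : nat -> C) := exists K : R,
  forall (x : nat -> C) N, (0 < N)%N ->
    tmean N (fun n => cabs (treeval (tconv c x) n) `^ q) <=
    K * tmean N (fun n => cabs (treeval x n) `^ q).

Variables (q : R) (c : nat -> C).
Hypotheses (q1 : 1 < q) (q2 : q <= 2) (Qc : tconv_bounded q c).

(** The squared L^2 norm of the chaos of [a] cut at [n], which is also the squared Hardy norm of its
    symbol on the disc of radius 2^(-1/2). *)
Definition wnorm2 n (a : nat -> C) : R := \sum_(k < n) (2 ^+ k)^-1 * cabs (a k) ^+ 2.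

Lemma cabs_le_expR (z : C) :
  expR (cabs z) <= expR (2 * complex.Re z) + expR (- (2 * complex.Re z)) +
    (expR (2 * complex.Im z) + expR (- (2 * complex.Im z))).
Proof.
have half (x : R) : expR (2 * `|x|) <= expR (2 * x) + expR (- (2 * x)).
  have [x0|x0] := ger0P x; first by rewrite lerDl expR_ge0.
  by rewrite mulrN lerDr expR_ge0.
apply: (@le_trans _ _ (expR (2 * `|complex.Re z|) + expR (2 * `|complex.Im z|))).
  have h := cabs_le_ReIm z.
  have [rs|rs] := lerP `|complex.Re z| `|complex.Im z|.
    by apply: ler_wpDl; rewrite ?expR_ge0// ler_expR; lra.
  by apply: ler_wpDr; rewrite ?expR_ge0// ler_expR; lra.
by apply: lerD; exact: half.
Qed.

(** The constants come from doubling: [cabs_le_expR] passes to the real sums 2 Re, -2 Re, 2 Im and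
    -2 Im, at most 1/2 in modulus on one band and with second moments at most 4 times those of
    [w]. *)
Lemma tmean_expR_cabs_block_le L (w : nat -> C) M : (0 < L)%N ->
  (forall n, (2 ^ L <= n < (2 ^ L).*2)%N -> cabs (treeval (block L w) n) <= 4^-1) ->
  M%:R * wnorm2 L.-1 w <= 1 ->
  tmean (2 ^ (L * M)) (fun n => expR (cabs (treeval (block L w) n))) <= 4 * expR 4.
Proof.
move=> L0 small Mw.
have half (f : C -> R) (s : R) : (forall z, `|f z| <= cabs z) -> `|s| = 2 ->
    (forall x n, (0 < n)%N -> f (treeval x n) = treeval (fun m => f (x m)) n) ->
    f 0 = 0 ->
    tmean (2 ^ (L * M)) (fun n => expR (s * f (treeval (block L w) n))) <= expR 4.
  move=> fle s2 fval f0.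
  have E n : (0 < n)%N -> s * f (treeval (block L w) n) = treeval (block L (fun k => s * f (w k))) n.
    move=> n0; rewrite fval// (treeval_morph (f := *%R s))//; first last.
    - by rewrite mulr0.
    - by move=> x; rewrite mulrN.
    - by move=> x y; rewrite mulrDr.
    apply: eq_treeval => // m _; rewrite /block /=.
    by case: ifP => // _; rewrite f0 mulr0.
  have pos l n : (2 ^ l <= n)%N -> (0 < n)%N by apply: leq_trans; rewrite expn_gt0.
  rewrite (@eq_tmean _ _ _ (fun n => expR (treeval (block L (fun k => s * f (w k))) n))); last first.
    by move=> n /andP[/pos n0 _]; rewrite E.
  apply: le_trans (tmean_expR_block_le _ L0 _) _.
    move=> n nL; have /andP[/pos n0 _] := nL; rewrite -E// normrM s2.
    by have := small n nL; have := fle (treeval (block L w) n); lra.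
  rewrite ler_expR; apply: (@le_trans _ _ (4 * (M%:R * wnorm2 L.-1 w))); last by lra.
  rewrite mulrCA ler_wpM2l// /wnorm2 mulr_sumr; apply: ler_sum => k _.
  rewrite [leRHS]mulrCA ler_wpM2l ?invr_ge0 ?exprn_ge0// exprMn -(real_normK (num_real s)) s2.
  rewrite (_ : (2 : R) ^+ 2 = 4); last by rewrite expr2; lra.
  by rewrite ler_wpM2l// -(real_normK (num_real (f _))) lerXn2r ?nnegrE ?cabs_ge0.
apply: le_trans (ler_tmean (fun n _ => cabs_le_expR _)) _.
rewrite !tmeanD.
have n2 : `|2 : R| = 2 by rewrite ger0_norm.
have nN2 : `|- 2 : R| = 2 by rewrite normrN ger0_norm.
have h1 := half _ 2 (@ler_Re_cabs R) n2 (@Re_treeval R) erefl.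
have h2 := half _ (- 2) (@ler_Re_cabs R) nN2 (@Re_treeval R) erefl.
have h3 := half _ 2 (@ler_Im_cabs R) n2 (@Im_treeval R) erefl.
have h4 := half _ (- 2) (@ler_Im_cabs R) nN2 (@Im_treeval R) erefl.
have N2 f : tmean (2 ^ (L * M)) (fun n => expR (- (2 * f n))) = tmean (2 ^ (L * M)) (fun n => expR (- 2 * f n)) :> R.
  by apply: eq_tmean => n _; rewrite mulNr.
rewrite (N2 (fun n => complex.Re (treeval (block L w) n))) (N2 (fun n => complex.Im (treeval (block L w) n))).
have -> : 4 * expR 4 = (expR 4 + expR 4) + (expR 4 + expR 4) :> R by ring.
by apply: lerD; apply: lerD.
Qed.

(* Scaled by [M^(-1/2)], [M] independent copies of a chaos keep bounded second
   moments, and bounded exponential moments once [M] is large; the pairing of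
   the two sums is estimated by Young's inequality, with bounds free of [n]. *)
Lemma weighted_pairing_bound : exists2 K : R, 0 <= K & forall n (a w : nat -> C),
  wnorm2 n a <= 1 -> wnorm2 n w <= 1 ->
  cabs (\sum_(k < n) (2 ^+ k)^-1 * (w k * cprod c a k)) <= K.
Proof.
have q0 : 0 < q := lt_trans ltr01 q1.
pose q' := q / (q - 1).
have q'0 : 0 <= q' by rewrite /q' divr_ge0 ?subr_ge0 ?(ltW q1)// (le_trans ler01 (ltW q1)).
have [B B0 HB] := powR_le_expR q'0.
have [K K0 HK] : exists2 K : R, 0 <= K & forall (x : nat -> C) N, (0 < N)%N ->
    tmean N (fun n => cabs (treeval (tconv c x) n) `^ q) <=
    K * tmean N (fun n => cabs (treeval x n) `^ q).
  have [K HK] := Qc; exists `|K| => // x N N0; apply: le_trans (HK x N N0) _.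
  rewrite ler_wpM2r ?ler_norm//; apply: sumr_ge0 => n _.
  by rewrite mulr_ge0 ?wt_ge0 ?powR_ge0.
exists (2 * (K * 2 + (1 + B * (4 * expR 4)))) => [|n a w a1 w1].
  by rewrite mulr_ge0// addr_ge0 ?mulr_ge0// addr_ge0// mulr_ge0// mulr_ge0// expR_ge0.
pose L := n.+1; have L0 : (0 < L)%N by [].
(* A crude bound for all values on one band; dividing by the root of M > (4 D)^2 brings them below
   1/4. *)
pose D : R := \sum_(2 ^ L <= i < (2 ^ L).*2) cabs (treeval (block L w) i).
have D0 : 0 <= D by apply: sumr_ge0 => i _; exact: cabs_ge0.
pose M := (Num.truncn ((4 * D) ^+ 2)).+1.
have M0 : 0 < M%:R :> R by [].
pose s : R := (Num.sqrt M%:R)^-1.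
have s0 : 0 < s by rewrite invr_gt0 sqrtr_gt0.
have s2M : M%:R * s ^+ 2 = 1 by rewrite exprVn sqr_sqrtr// mulfV// gt_eqF.
have sD : s * D <= 4^-1.
  have : 4 * D <= Num.sqrt M%:R.
    rewrite -(@ger0_norm _ (4 * D)) ?mulr_ge0// -sqrtr_sqr ler_sqrt//.
    by apply: ltW; exact: Num.Theory.truncnS_gt.
  by rewrite /s ler_pdivrMl ?sqrtr_gt0//; lra.
pose sc (v : nat -> C) k : C := s%:C%C * v k.
have cs : cabs (s%:C%C : C) = s by rewrite cabs_real gtr0_norm.
have wsc v : wnorm2 n v <= 1 -> M%:R * wnorm2 n (sc v) <= 1.
  move=> v1; rewrite (_ : wnorm2 n (sc v) = s ^+ 2 * wnorm2 n v).
    by rewrite mulrA s2M mul1r.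
  rewrite /wnorm2 mulr_sumr; apply: eq_bigr => k _.
  by rewrite /sc cabsM cs exprMn mulrCA.
have bsc v i : (0 < i)%N -> treeval (block L (sc v)) i = s%:C%C * treeval (block L v) i.
  move=> i0; rewrite (treeval_morph (f := *%R s%:C%C))//; first last.
  - by rewrite mulr0.
  - by move=> x; rewrite mulrN.
  - by move=> x y; rewrite mulrDr.
  apply: eq_treeval => // m _; rewrite /block /=.
  by case: ifP => // _; rewrite mulr0.
pose N := (2 ^ (L * M))%N; have N0 : (0 < N)%N by rewrite expn_gt0.
pose x := block L (sc a); pose f := block L (sc w).
have fle i : (2 ^ L <= i < (2 ^ L).*2)%N -> cabs (treeval f i) <= 4^-1.
  move=> iL; have i0 : (0 < i)%N by case/andP : iL => h _; apply: leq_trans h; rewrite expn_gt0.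
  rewrite bsc// cabsM cs; apply: le_trans sD; rewrite ler_wpM2l ?(ltW s0)//.
  rewrite /D (bigD1_seq i) ?mem_index_iota ?iota_uniq//=.
  by rewrite lerDl sumr_ge0// => j _; exact: cabs_ge0.
(* The factor [M] from the number of bands cancels the s^2 of the scaling. *)
have pairE : tmean N (fun i => treeval f i * treeval (tconv c x) i) =
    2^-1 * \sum_(k < n) (2 ^+ k)^-1 * (w k * cprod c a k).
  rewrite tmean_treevalM//.
  have := @wsum_block L L0 C (fun m => f m * tconv c x m) (fun k => sc w k * cprod c (sc a) k) M.
  rewrite -/N => ->; last by move=> m m0; exact: block_tconv.
  rewrite -mulr_natl mulrCA; congr (_ * _); rewrite mulr_sumr; apply: eq_bigr => k _.
  have -> : cprod c (sc a) k = s%:C%C * cprod c a k.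
    by rewrite /cprod mulr_sumr; apply: eq_bigr => i _; rewrite /sc mulrCA.
  have -> : M%:R * ((2 ^+ k)^-1 * (sc w k * (s%:C%C * cprod c a k))) =
    (M%:R * s%:C%C ^+ 2) * ((2 ^+ k)^-1 * (w k * cprod c a k)) :> C by rewrite /sc; ring.
  rewrite (_ : M%:R * s%:C%C ^+ 2 = 1 :> C) ?mul1r//.
  by rewrite -(rmorph_nat (real_complex R)) -rmorphXn -rmorphM /= s2M.
(* As q <= 2, the second moment suffices here. *)
have xq : tmean N (fun i => cabs (treeval x i) `^ q) <= 2.
  apply: (@le_trans _ _ (tmean N (fun i => 1 + cabs (treeval x i) ^+ 2))).
    by apply: ler_tmean => i _; apply: powR_le_sq; rewrite ?cabs_ge0// ltW.
  rewrite tmeanD tmean_cst// -[leRHS]/(1 + 1) lerD2l tmean_cabs_sq//.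
  have := @wsum_block L L0 R (fun m => cabs (x m) ^+ 2) (fun k => cabs (sc a k) ^+ 2) M.
  rewrite -/N => ->.
    rewrite -mulr_natl mulrCA; have := wsc a a1.
    have : 0 <= M%:R * wnorm2 n (sc a).
      by rewrite mulr_ge0// sumr_ge0// => k _; rewrite mulr_ge0 ?sqr_ge0// invr_ge0 exprn_ge0.
    by rewrite /wnorm2 /=; lra.
  by move=> m _; rewrite /x /block; case: ifP => // _; rewrite cabs0 expr0n.
(* The conjugate exponent is at least 2, so this factor needs the exponential moment. *)
have fq : tmean N (fun i => cabs (treeval f i) `^ q') <= 1 + B * (4 * expR 4).
  apply: (@le_trans _ _ (tmean N (fun i => 1 + B * expR (cabs (treeval f i))))).
    by apply: ler_tmean => i _; apply: HB; exact: cabs_ge0.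
  rewrite tmeanD tmean_cst// lerD2l tmeanZ ler_wpM2l//.
  by apply: tmean_expR_cabs_block_le => //; exact: wsc.
have : cabs (tmean N (fun i => treeval f i * treeval (tconv c x) i)) <= K * 2 + (1 + B * (4 * expR 4)).
  apply: le_trans (cabs_tmean _ _) _.
  apply: (@le_trans _ _ (tmean N (fun i => cabs (treeval (tconv c x) i) `^ q + cabs (treeval f i) `^ q'))).
    apply: ler_tmean => i _; rewrite cabsM mulrC.
    by apply: young_powR; rewrite ?cabs_ge0.
  rewrite tmeanD; apply: lerD => //; apply: le_trans (HK _ _ N0) _.
  by rewrite ler_wpM2l.
rewrite pairE cabsM (_ : cabs 2^-1 = 2^-1).
  by rewrite -ler_pdivlMl ?invr_gt0// invrK.
by rewrite cabsV -[2 in LHS](rmorph_nat (real_complex R)) cabs_real ger0_norm.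
Qed.

(** By homogeneity. Positive upper bounds [A] and [W] avoid dividing by a norm that vanishes. *)
Lemma pairing_bound : exists2 K : R, 0 <= K & forall n (a w : nat -> C) (A W : R),
  0 < A -> 0 < W -> wnorm2 n a <= A ^+ 2 -> wnorm2 n w <= W ^+ 2 ->
  cabs (\sum_(k < n) (2 ^+ k)^-1 * (w k * cprod c a k)) <= K * (A * W).
Proof.
have [K K0 HK] := weighted_pairing_bound; exists K => // n a w A W A0 W0 aA wW.
have scal (v : nat -> C) (V : R) : 0 < V -> wnorm2 n v <= V ^+ 2 ->
    wnorm2 n (fun k => V^-1%:C%C * v k) <= 1.
  move=> V0 vV; rewrite (_ : wnorm2 n _ = V ^- 2 * wnorm2 n v).
    by rewrite ler_pdivrMl ?exprn_gt0// mulr1.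
  rewrite /wnorm2 mulr_sumr; apply: eq_bigr => k _.
  by rewrite cabsM cabs_real exprMn real_normK ?num_real// exprVn mulrCA.
have := HK n _ _ (scal a A A0 aA) (scal w W W0 wW).
rewrite (_ : \sum_(k < n) _ = (A^-1 * W^-1)%:C%C *
  \sum_(k < n) (2 ^+ k)^-1 * (w k * cprod c a k)).
  rewrite cabsM cabs_real ger0_norm ?mulr_ge0 ?invr_ge0 ?(ltW A0) ?(ltW W0)//.
  by rewrite -invfM ler_pdivrMl ?mulr_gt0// mulrC.
rewrite mulr_sumr; apply: eq_bigr => k _.
have -> : cprod c (fun k => A^-1%:C%C * a k) k = A^-1%:C%C * cprod c a k.
  by rewrite /cprod mulr_sumr; apply: eq_bigr => i _; rewrite mulrCA.
by rewrite rmorphM /=; ring.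
Qed.

(** Pairing unit vectors at 0 and k isolates 2^(-k) c_k, while the second has norm 2^(-k/2). *)
Lemma bounded_symbol_coef : exists2 K : R, 0 <= K & forall k, cabs (c k) <= K * Num.sqrt 2 ^+ k.
Proof.
have [K K0 HK] := pairing_bound; exists K => // k.
have s0 : 0 < Num.sqrt 2 :> R by rewrite sqrtr_gt0.
pose a (i : nat) : C := (i == 0%N)%:R; pose w i : C := (i == k)%:R.
have cb (b : bool) : cabs (b%:R : C) = b%:R by case: b; rewrite ?cabs1 ?cabs0.
have a1 : wnorm2 k.+1 a <= 1 ^+ 2.
  rewrite /wnorm2 big_ord_recl big1 => [|i _]; last by rewrite /a cb expr0n mulr0.
  by rewrite /a cb expr0 invr1 !expr1n mulr1 addr0.
have w1 : wnorm2 k.+1 w <= ((Num.sqrt 2)^-1 ^+ k) ^+ 2.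
  rewrite /wnorm2 big_ord_recr big1 => [|i _] /=; last first.
    by rewrite /w cb (ltn_eqF (ltn_ord i)) expr0n mulr0.
  rewrite /w cb eqxx expr1n mulr1 add0r -exprM mulnC exprM exprVn sqr_sqrtr//.
  by rewrite -exprVn.
have W0 : 0 < (Num.sqrt 2)^-1 ^+ k :> R by rewrite exprn_gt0 ?invr_gt0.
have := HK k.+1 a w _ _ ltr01 W0 a1 w1.
rewrite big_ord_recr big1 => [|i _] /=; last first.
  by rewrite /w (ltn_eqF (ltn_ord i)) mul0r mulr0.
rewrite /w eqxx mul1r add0r mul1r.
have -> : cprod c a k = c k by rewrite cprodC; exact: cprod_delta0.
rewrite cabsM -/(wt C 0).
have -> : cabs ((2 ^+ k)^-1 : C) = (2 ^+ k)^-1.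
  by rewrite cabsV cabsX -[2 in LHS](rmorph_nat (real_complex R)) cabs_real ger0_norm.
rewrite exprVn => h.
have e2 : 2 ^+ k = Num.sqrt 2 ^+ k * Num.sqrt 2 ^+ k :> R.
  by rewrite -exprMn -expr2 sqr_sqrtr.
move: h; rewrite ler_pdivrMl ?exprn_gt0// e2 => h; apply: le_trans h _.
by rewrite mulrCA -mulrA mulfV ?mulr1// gt_eqF// exprn_gt0.
Qed.

(** Test on the kernels a_k = 2^k conj(z)^k and w_k = 2^k z^k, cut at n. With t = 2 |z|^2 both
    squared norms are the n-th partial sum of the series of t^k, and the pairing is that of the
    Cauchy product of the series of c_k z^k and t^k. In the limit the geometric series cancels and
    |s| <= K remains, with K free of z. *)
Lemma bounded_symbol : exists M : R, forall z : C, cabs z < 2 `^ (- 2^-1) ->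
  exists2 s, ccvg (fun n => \sum_(k < n) c k * z ^+ k) s & cabs s <= M.
Proof.
have [K K0 HK] := pairing_bound; have [B B0 HB] := bounded_symbol_coef.
exists K => z zr.
have s0 : 0 < Num.sqrt 2 :> R by rewrite sqrtr_gt0.
have z1 : Num.sqrt 2 * cabs z < 1.
  rewrite mulrC -ltr_pdivlMr// mul1r; move: zr.
  by rewrite powRN powR12_sqrt.
have zs0 : 0 <= Num.sqrt 2 * cabs z by rewrite mulr_ge0 ?cabs_ge0 ?ltW.
pose t := (Num.sqrt 2 * cabs z) ^+ 2.
have tE : t = 2 * cabs z ^+ 2 by rewrite /t exprMn sqr_sqrtr.
have t0 : 0 <= t by rewrite exprn_ge0.
have t1 : t < 1 by rewrite expr_lt1.
have tle : t <= Num.sqrt 2 * cabs z by rewrite /t expr2 ler_piMr// ltW.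
pose x k := c k * z ^+ k; pose y k : C := (t ^+ k)%:C%C.
(* Large enough for one geometric bound to serve both [x] and [y]. *)
pose b := B + 1.
have xb k : cabs (x k) <= b * (Num.sqrt 2 * cabs z) ^+ k.
  rewrite /x cabsM cabsX exprMn mulrA ler_wpM2r ?exprn_ge0 ?cabs_ge0//.
  by apply: le_trans (HB k) _; rewrite ler_wpM2r ?exprn_ge0 ?lerDl ?(ltW s0).
have yb k : cabs (y k) <= b * (Num.sqrt 2 * cabs z) ^+ k.
  rewrite /y cabs_real ger0_norm ?exprn_ge0//.
  apply: (@le_trans _ _ ((Num.sqrt 2 * cabs z) ^+ k)); first by rewrite lerXn2r ?nnegrE.
  by rewrite ler_peMl ?exprn_ge0// /b lerDr.
have [s hs] := ccvg_geom zs0 z1 xb.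
exists s; first exact: hs.
have [r hr] := ccvg_geom zs0 z1 yb.
have hxy := ccvg_cprod zs0 z1 xb yb hs hr.
pose sig n : R := \sum_(k < n) t ^+ k.
have sigE n : \sum_(k < n) y k = (sig n)%:C%C by rewrite rmorph_sum.
have sig_le n : sig n <= cabs r.
  rewrite leNgt; apply/negP => h.
  pose e := sig n - cabs r; have e0 : 0 < e / 2 by rewrite divr_gt0 ?subr_gt0.
  have [N HN] := hr _ e0.
  have := HN (maxn n N) (leq_maxr _ _); rewrite ger0_norm ?cabs_ge0// sigE.
  have mono : sig n <= sig (maxn n N).
    rewrite /sig -!(big_mkord xpredT) [leRHS](@big_cat_nat _ _ _ n) ?leq_maxl//=.
    by rewrite lerDl sumr_ge0// => k _; exact: exprn_ge0.
  have sg0 : 0 <= sig (maxn n N) by apply: sumr_ge0 => k _; exact: exprn_ge0.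
  have := ler_cabsB ((sig (maxn n N))%:C%C - r) (- r).
  rewrite opprK subrK cabs_real ger0_norm// cabsN => h1 h2.
  by move: e0 h2 h1; rewrite /e; lra.
have r1 : 0 < cabs r by apply: lt_le_trans (sig_le 1%N); rewrite /sig big_ord1 expr0.
have : cabs (s * r) <= K * cabs r.
  apply: (ccvg_le (N := 1) hxy) => n n1.
  have sn0 : 0 < sig n.
    case: n n1 => // n _; rewrite /sig big_ord_recl ltr_pwDl ?expr0 ?sumr_ge0// => k _.
    exact: exprn_ge0.
  apply: (@le_trans _ _ (K * sig n)); last by rewrite ler_wpM2l.
  have cJ : cabs (conjc z) = cabs z by rewrite /cabs; case: z {zr z1 zs0 t tE t0 t1 tle x y xb yb s hs r hr hxy sig sigE sig_le r1 sn0} => ? ? /=; rewrite sqrrN.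
  pose w k : C := 2 ^+ k * z ^+ k; pose a k : C := 2 ^+ k * conjc z ^+ k.
  have c2 k : cabs (2 ^+ k : C) = 2 ^+ k.
    by rewrite cabsX -[2 in LHS](rmorph_nat (real_complex R)) cabs_real ger0_norm.
  have nE (v : nat -> C) : (forall k, cabs (v k) = 2 ^+ k * cabs z ^+ k) ->
      wnorm2 n v <= Num.sqrt (sig n) ^+ 2.
    move=> vE; rewrite sqr_sqrtr ?(ltW sn0)// /wnorm2; apply: ler_sum => k _.
    rewrite vE tE [leRHS]exprMn exprAC.
    by rewrite [leLHS](_ : _ = 2 ^+ k * (cabs z ^+ k) ^+ 2)//; field.
  have sq0 : 0 < Num.sqrt (sig n) by rewrite sqrtr_gt0.
  have := HK n a w _ _ sq0 sq0 (nE a _) (nE w _).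
  rewrite -expr2 sqr_sqrtr ?(ltW sn0)//.
  rewrite (_ : \sum_(k < n) _ = \sum_(k < n) cprod x y k).
    by apply => k; rewrite ?/a ?/w cabsM c2 cabsX ?cJ.
  apply: eq_bigr => k _; rewrite /w mulrA mulKf ?expf_neq0//.
  rewrite /cprod mulr_sumr; apply: eq_bigr => i _; rewrite /x /y /a.
  have ik : (i <= k)%N by rewrite -ltnS.
  rewrite -{1}(subnKC ik) exprD tE rmorphXn rmorphM /= rmorph_nat.
  have -> : ((cabs z ^+ 2)%:C = z * conjc z)%C.
    by rewrite -sqr_normc normc_def -rmorphXn.
  by rewrite !exprMn; ring.
by rewrite cabsM ler_pM2r.
Qed.

End BoundedSymbol.

(** * Integration over dyadic intervals *)

Section Nodes.
Variable R : realType.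
Implicit Types (t : R) (n m : nat).

(** The affine map taking the dyadic interval of index [n] onto (0,1]. *)
Definition tau n t : R := 2 ^+ lev n * t - (pos n)%:R.

Definition nodeI n : set R := [set t | 0 < tau n t <= 1].

Lemma nodeIE n : nodeI n = `](pos n)%:R / 2 ^+ lev n, (pos n).+1%:R / 2 ^+ lev n]%classic.
Proof.
apply/seteqP; split => t; rewrite /nodeI /tau /= in_itv /= subr_gt0 lerBlDr;
  by rewrite ltr_pdivrMr ?exprn_gt0// ler_pdivlMr ?exprn_gt0// nat1r mulrC.
Qed.

Lemma pos_double n : (0 < n)%N -> pos n.*2 = (pos n).*2.
Proof. by move=> n0; rewrite /pos lev_double// expnS mul2n doubleB. Qed.

Lemma pos_doubleS n : (0 < n)%N -> pos n.*2.+1 = (pos n).*2.+1.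
Proof.
move=> n0; rewrite /pos lev_doubleS// expnS mul2n doubleB subSn// leq_double.
by have /andP[] := lev_bounds n0.
Qed.

Lemma tau_double n t : (0 < n)%N -> tau n.*2 t = 2 * tau n t.
Proof.
by move=> n0; rewrite /tau lev_double// pos_double// exprS -addnn natrD; ring.
Qed.

Lemma tau_doubleS n t : (0 < n)%N -> tau n.*2.+1 t = 2 * tau n t - 1.
Proof.
by move=> n0; rewrite /tau lev_doubleS// pos_doubleS// exprS -[_.*2.+1%:R]natr1 -addnn natrD; ring.
Qed.

Lemma tau1 t : tau 1 t = t.
Proof. by rewrite /tau /pos lev1 expr0 mul1r subr0. Qed.

Lemma tau_exp k n t : (0 < n)%N -> tau (2 ^ k * n) t = 2 ^+ k * tau n t.
Proof.
move=> n0; elim: k => [|k IH]; first by rewrite mul1n mul1r.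
by rewrite expnS -mulnA mul2n tau_double ?muln_gt0 ?expn_gt0// IH exprS mulrA.
Qed.

Lemma nodeI1 : nodeI 1 = @I01 R.
Proof.
by apply/seteqP; split => t; rewrite /nodeI /I01 /= tau1 in_itv /=.
Qed.

Lemma nodeI_double n t : (0 < n)%N -> nodeI n.*2 t <-> 0 < tau n t <= 2^-1.
Proof. by move=> n0; rewrite /nodeI /= tau_double//; split; lra. Qed.

Lemma nodeI_doubleS n t : (0 < n)%N -> nodeI n.*2.+1 t <-> 2^-1 < tau n t <= 1.
Proof. by move=> n0; rewrite /nodeI /= tau_doubleS//; split; lra. Qed.

Lemma nodeI_split n : (0 < n)%N -> nodeI n = nodeI n.*2 `|` nodeI n.*2.+1.
Proof.
move=> n0; apply/seteqP; split => t.
  rewrite /nodeI /= => h.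
  have [h1|h1] := lerP (tau n t) 2^-1; [left|right]; rewrite ?tau_double ?tau_doubleS//; lra.
by case=> [/(nodeI_double _ n0)|/(nodeI_doubleS _ n0)]; rewrite /nodeI /=; lra.
Qed.

Lemma nodeI_disj n : (0 < n)%N -> [disjoint nodeI n.*2 & nodeI n.*2.+1].
Proof.
move=> n0; apply/disj_setPS => t [/(nodeI_double _ n0) h1 /(nodeI_doubleS _ n0) h2]; lra.
Qed.

Lemma nodeI_lev_inj m n t : (0 < m)%N -> (0 < n)%N -> nodeI m t -> nodeI n t -> lev m = lev n -> m = n.
Proof.
move=> m0 n0; rewrite /nodeI /tau /= => hm hn E.
have /andP[bm _] := lev_bounds m0; have /andP[bn _] := lev_bounds n0.
rewrite -(subnKC bm) -(subnKC bn) -/(pos m) -/(pos n) E; congr (_ + _)%N.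
rewrite E in hm.
have h1 : (pos m < (pos n).+1)%N by rewrite -(ltr_nat R) -natr1; lra.
have h2 : (pos n < (pos m).+1)%N by rewrite -(ltr_nat R) -natr1; lra.
lia.
Qed.

Lemma nodeI_sub n : (1 < n)%N -> nodeI n `<=` nodeI n./2.
Proof.
move=> n1 t; have h : (0 < n./2)%N by lia.
rewrite (nodeI_split h) -{1}(odd_double_half n).
by case: odd => /=; rewrite ?add0n ?add1n; [right|left].
Qed.

Lemma nodeI_sub_I01 n : (0 < n)%N -> nodeI n `<=` @I01 R.
Proof.
move: n; apply: node_ind => [|n n0 IH]; first by rewrite nodeI1.
by split=> t ht; apply: IH; rewrite nodeI_split//; [left|right].
Qed.

(** Either [m] has the level of [N], or it lies one level below; then its parent has the level of
    [N] and differs from [N], because m < 2N. *)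
Lemma nodeI_window N m t : (0 < N)%N -> (N < m < N.*2)%N -> nodeI m t -> ~ nodeI N t.
Proof.
move=> N0 /andP[Nm mN] hm hN; have m0 : (0 < m)%N by apply: leq_trans Nm.
have := nodeI_lev_inj N0 m0 hN hm.
have /andP[b1 b2] := lev_bounds N0; have /andP[b3 b4] := lev_bounds m0.
have [E|E|E] := ltngtP (lev N) (lev m); last by move=> /(_ E); lia.
  move=> _.
  have m1 : (1 < m)%N by lia.
  have m20 : (0 < m./2)%N by lia.
  have lm : lev m = (lev m./2).+1 by exact: trunc_log2S.
  have lmN : (lev m <= (lev N).+1)%N.
    rewrite -ltnS -(ltn_exp2l _ _ (isT : 1 < 2)%N); apply: leq_ltn_trans b3 _.
    by apply: ltn_trans mN _; rewrite expnS mul2n ltn_double.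
  have := nodeI_lev_inj N0 m20 hN (nodeI_sub m1 hm).
  by move=> H; have : N = m./2 by [apply: H; lia]; lia.
move=> _; have : (2 ^ (lev m).+1 <= 2 ^ lev N)%N by rewrite leq_exp2l.
lia.
Qed.

Lemma nodeI_exists N t : (0 < N)%N -> @I01 R t -> exists2 n, (N <= n < N.*2)%N & nodeI n t.
Proof.
rewrite -nodeI1; case: N => // N _ t1; elim: N => [|N [n nN nt]]; first by exists 1%N.
have [nN'|nN'] := eqVneq n N.+1.
  move: nt; rewrite nN' nodeI_split// => -[] nt.
    by exists N.+1.*2 => //; rewrite doubleS; lia.
  by exists N.+1.*2.+1 => //; rewrite doubleS; lia.
exists n => //; rewrite doubleS; lia.
Qed.

End Nodes.

(** * Pointwise values of partial sums *)

Section Chaos.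
Variable R : realType.
Local Notation C := R[i].
Implicit Types (t : R) (n m : nat) (c a : nat -> C).

Lemma haar_out t : ~~ (0 < t <= 1) -> haar t = 0 :> C.
Proof.
move=> /negP h; rewrite /haar !ifF//; apply/negP => h'; apply: h; lra.
Qed.

Lemma haarl t : 0 < t <= 2^-1 -> haar t = 1 :> C.
Proof. by rewrite /haar => ->. Qed.

Lemma haarr t : 2^-1 < t <= 1 -> haar t = -1 :> C.
Proof.
by move=> h; rewrite /haar h ifF//; apply/negP => h'; move: h; lra.
Qed.

Lemma cabs_haar_le t : cabs (haar t : C) <= 1.
Proof.
rewrite /haar; case: ifP => _; first by rewrite cabs1.
by case: ifP => _; rewrite ?cabsN ?cabs1 ?cabs0.
Qed.

Lemma dilE (g : R -> C) n t : (forall s, ~~ (0 < s <= 1) -> g s = 0) ->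
  dil g n t = g (tau n t).
Proof.
move=> g0; rewrite /dil -/(tau n t).
rewrite (_ : _ && _ = (0 < tau n t <= 1)); first by case: ifPn => // /g0.
rewrite /tau subr_gt0 lerBlDr ltr_pdivrMr ?exprn_gt0// ler_pdivlMr ?exprn_gt0//.
by rewrite nat1r mulrC.
Qed.

(** The k-th term vanishes once 2^k t > 1, so at each point the chaos is a finite sum and needs no
    limit. *)
Definition chaosf c t : C :=
  \sum_(k < (Num.truncn t^-1).+1) c k * haar (2 ^+ k * t).

Lemma exp2_large t k : 0 < t -> ((Num.truncn t^-1).+1 <= k)%N -> 1 < 2 ^+ k * t.
Proof.
move=> t0 tk; rewrite -ltr_pdivrMr// div1r.
apply: lt_le_trans (Num.Theory.truncnS_gt _) _.
by rewrite -natrX ler_nat; apply: leq_trans tk _; apply: ltnW; rewrite ltn_expl.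
Qed.

Lemma haar_exp2_out t k : ((Num.truncn t^-1).+1 <= k)%N -> haar (2 ^+ k * t) = 0 :> C.
Proof.
move=> tk; apply: haar_out; have [t0|t0] := lerP t 0.
  by rewrite ltNge mulr_ge0_le0 ?exprn_ge0.
by rewrite [_ <= 1]leNgt exp2_large// andbF.
Qed.

Lemma chaosfE c t N : ((Num.truncn t^-1).+1 <= N)%N ->
  \sum_(k < N) c k * haar (2 ^+ k * t) = chaosf c t.
Proof.
move=> tN; rewrite /chaosf -!(big_mkord xpredT (fun k => c k * haar (2 ^+ k * t))).
rewrite (@big_cat_nat _ _ _ (Num.truncn t^-1).+1)//= [X in _ + X]big_nat [X in _ + X]big1 ?addr0// => k /andP[tk _].
by rewrite haar_exp2_out// mulr0.
Qed.

Lemma haar_chaosE c (f : R -> C) : haar_chaos c f -> f = chaosf c.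
Proof.
move=> cf; apply/funext => t; have [N HN] := cf t.
pose M := maxn N (Num.truncn t^-1).+1.
rewrite (HN M) ?leq_maxl// -(chaosfE c (N := M)) ?leq_maxr//.
apply: eq_bigr => k _; rewrite /haar_sys dilE; last exact: haar_out.
by rewrite -[(2 ^ k)%N]muln1 tau_exp// tau1.
Qed.

Lemma chaosf_out c t : ~~ (0 < t <= 1) -> chaosf c t = 0.
Proof.
move=> t01; rewrite /chaosf big1// => k _; rewrite haar_out ?mulr0//.
apply: contraNN t01 => /andP[h1 h2].
have t0 : 0 < t by move: h1; rewrite pmulr_rgt0// exprn_gt0.
rewrite t0 /=; apply: le_trans h2; rewrite ler_peMl ?(ltW t0)// exprn_ege1//.
by rewrite ler1n.
Qed.

Lemma chaosf_rec c t : chaosf c t = c 0%N * haar t + chaosf (fun k => c k.+1) (2 * t).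
Proof.
pose N := maxn (Num.truncn t^-1).+1 (Num.truncn (2 * t)^-1).+1.
rewrite -(chaosfE c (N := N.+1)); last by rewrite leqW// leq_maxl.
rewrite -(chaosfE _ (N := N) (t := 2 * t)); last by rewrite leq_maxr.
rewrite big_ord_recl /= expr0 mul1r; congr (_ + _); apply: eq_bigr => k _.
by rewrite /bump add1n exprSr mulrA.
Qed.

Lemma chaosf_delta0 t : chaosf (delta0 C) t = haar t.
Proof.
rewrite /chaosf big_ord_recl /= mul1r expr0 mul1r big1 ?addr0// => k _.
by rewrite /delta0 mul0r.
Qed.

Lemma chaosf0 t : chaosf (fun=> 0) t = 0.
Proof. by rewrite /chaosf big1// => k _; rewrite mul0r. Qed.

Lemma haar_sysE : @haar_sys R = dil (chaosf (delta0 C)).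
Proof.
by apply/funext => n; apply/funext => t; rewrite /haar_sys; congr (dil _ n t);
   apply/funext => s; rewrite chaosf_delta0.
Qed.

Lemma psumS (a : nat -> C) (x : nat -> R -> C) N t : (0 < N)%N ->
  psum a x N.+1 t = psum a x N t + a N * x N t.
Proof. by move=> N0; rewrite /psum big_nat_recr. Qed.

(** On the right half of its interval f_m is constant; on the left half it is c_0 plus the chaos of
    the shifted coefficients. So on [nodeI n] the only unfinished chaoses belong to the ancestors
    from which [n] is reached by left steps alone, the n / 2^i with i <= [logn 2 n]; their tails
    form the second sum. *)
Lemma psum_node c a N n t : (0 < N)%N -> (N <= n < N.*2)%N -> nodeI n t ->
  psum a (dil (chaosf c)) N t = treeval (tconv c a) n +
    \sum_(1 <= i < (logn 2 n).+1) a (n %/ 2 ^ i)%N * chaosf (fun k => c (i + k)%N) (tau n t).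
Proof.
move=> N0; case: N N0 => // N _; elim: N n => [|N IH] n nN nt.
  have -> : n = 1%N by lia.
  by rewrite treeval1 logn1 /psum !big_geq// addr0.
rewrite psumS//.
have dE m s : dil (chaosf c) m s = chaosf c (tau m s) by apply: dilE; exact: chaosf_out.
have [nN'|nN'] := ltnP n N.+1.*2.
  have Nn : (N.+1 < n < N.+1.*2)%N by rewrite nN' andbT; case/andP : nN.
  rewrite (IH n)//; last by move: Nn; lia.
  by rewrite dE chaosf_out ?mulr0 ?addr0//; apply/negP; exact: nodeI_window Nn nt.
(* The new function enters as the tail i = 0; one term is then split off every tail, and the terms
   split off add up to the Haar coefficient of index [N.+1]. *)
have step : nodeI N.+1 t -> psum a (dil (chaosf c)) N.+1 t + a N.+1 * dil (chaosf c) N.+1 t =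
    treeval (tconv c a) N.+1 + tconv c a N.+1 * haar (tau N.+1 t) +
    \sum_(0 <= i < (logn 2 N.+1).+1) a (N.+1 %/ 2 ^ i)%N * chaosf (fun k => c (i.+1 + k)%N) (2 * tau N.+1 t).
  move=> Nt; rewrite (IH N.+1)//; last by rewrite -addnn; lia.
  rewrite dE -!addrA; congr (_ + _).
  have -> : a N.+1 * chaosf c (tau N.+1 t) = a (N.+1 %/ 2 ^ 0)%N * chaosf (fun k => c (0 + k)%N) (tau N.+1 t).
    by rewrite divn1.
  rewrite addrC -(@big_ltn _ _ _ 0)// /tconv mulr_suml -(big_mkord xpredT (fun i => c i * a (N.+1 %/ 2 ^ i)%N * haar (tau N.+1 t))).
  rewrite -big_split /=; apply: eq_bigr => i _.
  rewrite chaosf_rec mulrDr addn0; congr (_ + _); first by rewrite mulrCA mulrA.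
  congr (_ * chaosf _ _); apply/funext => k; congr c; lia.
have [E|E] : n = N.+1.*2 \/ n = N.+1.*2.+1 by rewrite doubleS in nN nN' *; lia.
  move: nt; rewrite E => nt; have /nodeI_double h := nt.
  have {}h := h isT; rewrite step; last by rewrite nodeI_split//; left.
  rewrite haarl// mulr1 treeval_double// logn2_double// tau_double//; congr (_ + _).
  rewrite big_add1 /=; apply: eq_bigr => i _; congr (a _ * _).
  by rewrite expnS divnMA divn2 doubleK.
move: nt; rewrite E => nt; have /nodeI_doubleS h := nt.
have {}h := h isT; rewrite step; last by rewrite nodeI_split//; right.
rewrite haarr// mulrN1 treeval_doubleS// logn2_doubleS [X in _ = _ + X]big_geq//; congr (_ + _).
by rewrite big1// => i _; rewrite chaosf_out ?mulr0//; lra.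
Qed.

Lemma psum_haar_node a N n t : (0 < N)%N -> (N <= n < N.*2)%N -> nodeI n t ->
  psum a haar_sys N t = treeval a n.
Proof.
move=> N0 nN nt; rewrite haar_sysE (psum_node _ _ N0 nN nt).
rewrite [X in _ + X]big_nat [X in _ + X]big1 ?addr0 => [|i /andP[i0 _]].
  have n0 : (0 < n)%N by case/andP : nN => h _; exact: leq_trans h.
  by apply: eq_treeval => // m /andP[m0 _]; rewrite tconv_delta0.
rewrite (_ : (fun k => _) = fun=> 0) ?chaosf0 ?mulr0//.
by apply/funext => k; rewrite /delta0; case: i i0.
Qed.

End Chaos.

Section NodeIntegrals.
Variable R : realType.
Local Notation C := R[i].
Local Notation mu := (@lebesgue_measure R).
Local Notation I := (@I01 R).
Implicit Types (g : R -> C) (n m N : nat).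

Lemma measurable_I01 : measurable I. Proof. exact: measurable_itv. Qed.

Lemma measurable_nodeI n : measurable (@nodeI R n).
Proof. by rewrite nodeIE; exact: measurable_itv. Qed.

Lemma mu_nodeI n : mu (nodeI n) = (wt R n)%:E.
Proof.
rewrite nodeIE lebesgue_measure_itv /= lte_fin ltr_pM2r ?invr_gt0 ?exprn_gt0//.
rewrite ltr_nat ltnSn -EFinB -mulrBl -natr1 addrC addKr mul1r.
by [].
Qed.

Lemma ge0_int_node_split n (F : R -> \bar R) : (0 < n)%N -> measurable_fun I F ->
  (forall t, I t -> 0 <= F t)%E ->
  (\int[mu]_(t in nodeI n) F t =
   \int[mu]_(t in nodeI n.*2) F t + \int[mu]_(t in nodeI n.*2.+1) F t)%E.
Proof.
move=> n0 mF F0; rewrite (nodeI_split R n0) ge0_integral_setU//.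
- exact: measurable_nodeI.
- exact: measurable_nodeI.
- rewrite -nodeI_split//; apply: measurable_funS mF; first exact: measurable_I01.
  exact: nodeI_sub_I01.
- by move=> t; rewrite -nodeI_split// => /(nodeI_sub_I01 n0)/F0.
- exact: nodeI_disj.
Qed.

Lemma ge0_int_window N (F : R -> \bar R) : (0 < N)%N -> measurable_fun I F ->
  (forall t, I t -> 0 <= F t)%E ->
  (\int[mu]_(t in I) F t = \sum_(N <= n < N.*2) \int[mu]_(t in nodeI n) F t)%E.
Proof.
move=> N0 mF F0; case: N N0 => // N _; elim: N => [|N IH].
  by rewrite big_nat1 nodeI1.
rewrite IH [LHS]big_ltn; last by rewrite -addnn; lia.
have h : (N.+2 <= N.+1.*2)%N by rewrite -addnn; lia.
rewrite ge0_int_node_split// [in RHS]doubleS.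
rewrite [RHS]big_nat_recr ?(leqW h)//= [in RHS]big_nat_recr//=.
by rewrite [LHS]addeC addeA.
Qed.

Lemma cmeasurable_cabs g : cmeasurable g -> measurable_fun I (fun t => cabs (g t)).
Proof.
move=> [mr mi]; rewrite /cabs.
apply: (@measurableT_comp _ _ _ _ _ _ (@Num.sqrt R)).
  by apply: continuous_measurable_fun; exact: sqrt_continuous.
by apply: measurable_funD; apply: measurable_funX.
Qed.

Lemma cmeasurable_pow g (q : R) : cmeasurable g -> measurable_fun I (fun t => (cabs (g t) `^ q)%:E).
Proof.
move=> mg; apply/measurable_EFinP.
apply: (@measurableT_comp _ _ _ _ _ _ ((@powR R) ^~ q)); first exact: measurable_powR.
exact: cmeasurable_cabs.
Qed.

Lemma cmeasurable_comb (a : C) g1 g2 : cmeasurable g1 -> cmeasurable g2 ->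
  cmeasurable (fun t => a * g1 t + g2 t).
Proof.
move=> [r1 i1] [r2 i2]; split.
  rewrite (_ : (fun t => _) = (fun t => (complex.Re a * complex.Re (g1 t) - complex.Im a * complex.Im (g1 t)) + complex.Re (g2 t))).
    by apply: measurable_funD => //; apply: measurable_funB; apply: measurable_funM.
  by apply/funext => t; rewrite ReD; case: a (g1 t) => [? ?] [? ?].
rewrite (_ : (fun t => _) = (fun t => (complex.Re a * complex.Im (g1 t) + complex.Im a * complex.Re (g1 t)) + complex.Im (g2 t))).
  by apply: measurable_funD => //; apply: measurable_funD; apply: measurable_funM.
by apply/funext => t; rewrite ImD; case: a (g1 t) => [? ?] [? ?].
Qed.

Lemma cmeasurable_cst (a : C) : cmeasurable (fun=> a).
Proof. by split; exact: measurable_cst. Qed.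

Lemma cmeasurable_add g1 g2 : cmeasurable g1 -> cmeasurable g2 ->
  cmeasurable (fun t => g1 t + g2 t).
Proof.
move=> h1 h2; have := cmeasurable_comb 1 h1 h2.
by rewrite (_ : (fun t => _) = (fun t => g1 t + g2 t))//; apply/funext => t; rewrite mul1r.
Qed.

Lemma cmeasurable_scale (a : C) g : cmeasurable g -> cmeasurable (fun t => a * g t).
Proof.
move=> h; have := cmeasurable_comb a h (cmeasurable_cst 0).
by rewrite (_ : (fun t => _) = (fun t => a * g t))//; apply/funext => t; rewrite addr0.
Qed.

Lemma cmeasurable_fsub g1 g2 : cmeasurable g1 -> cmeasurable g2 -> cmeasurable (fsub g1 g2).
Proof.
move=> h1 h2; have := cmeasurable_comb (-1) h2 h1.
by rewrite (_ : (fun t => _) = fsub g1 g2)//; apply/funext => t; rewrite mulN1r addrC.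
Qed.

Lemma cmeasurable_sum (J : Type) (r : seq J) (G : J -> R -> C) :
  (forall j, cmeasurable (G j)) -> cmeasurable (fun t => \sum_(j <- r) G j t).
Proof.
move=> mG; elim: r => [|j r IH].
  rewrite (_ : (fun t => _) = fun=> 0); first exact: cmeasurable_cst.
  by apply/funext => t; rewrite big_nil.
rewrite (_ : (fun t => _) = (fun t => G j t + \sum_(j <- r) G j t)).
  exact: cmeasurable_add.
by apply/funext => t; rewrite big_cons.
Qed.

Lemma cmeasurable_lim (G : nat -> R -> C) g : (forall k, cmeasurable (G k)) ->
  (forall t, I t -> exists K, forall k, (K <= k)%N -> G k t = g t) -> cmeasurable g.
Proof.
move=> mG Gg; split.
  apply: (@measurable_fun_cvg _ _ _ _ (fun k t => complex.Re (G k t))).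
    by move=> k; case: (mG k).
  move=> t /Gg[K HK]; apply: cvg_near_cst.
  by exists K => // k /= Kk; rewrite HK.
apply: (@measurable_fun_cvg _ _ _ _ (fun k t => complex.Im (G k t))).
  by move=> k; case: (mG k).
move=> t /Gg[K HK]; apply: cvg_near_cst.
by exists K => // k /= Kk; rewrite HK.
Qed.

Lemma haar_tauE n t : (0 < n)%N ->
  haar (tau n t) = (\1_(nodeI n.*2) t - \1_(nodeI n.*2.+1) t)%:C%C :> C.
Proof.
move=> n0; rewrite !indicE.
have [h1|h1] := boolP (0 < tau n t <= 2^-1).
  rewrite haarl// mem_set; last exact/(nodeI_double t n0).
  rewrite memNset ?subr0//.
  by move/(nodeI_doubleS t n0); lra.
rewrite memNset; last by move/(nodeI_double t n0); apply/negP.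
have [h2|h2] := boolP (2^-1 < tau n t <= 1).
  rewrite haarr// mem_set; last exact/(nodeI_doubleS t n0).
  by rewrite sub0r rmorphN.
rewrite memNset; last by move/(nodeI_doubleS t n0); apply/negP.
rewrite haar_out ?subrr//; apply/negP => h3; move/negP : h1; move/negP : h2; lra.
Qed.

Lemma cmeasurable_haar n : (0 < n)%N -> cmeasurable (fun t => haar (tau n t) : C).
Proof.
move=> n0; split.
  rewrite (_ : (fun t => _) = (fun t => \1_(nodeI n.*2) t - \1_(nodeI n.*2.+1) t)).
    by apply: measurable_funB; apply: measurable_indic; exact: measurable_nodeI.
  by apply/funext => t; rewrite haar_tauE.
rewrite (_ : (fun t => _) = (fun t => 0)); first exact: measurable_cst.
by apply/funext => t; rewrite haar_tauE.
Qed.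

Lemma cmeasurable_chaosf (c : nat -> C) n : (0 < n)%N -> cmeasurable (fun t => chaosf c (tau n t)).
Proof.
move=> n0; apply: (@cmeasurable_lim (fun N t => \sum_(k < N) c k * haar (tau (2 ^ k * n) t))).
  move=> N; apply: cmeasurable_sum => k; apply: cmeasurable_scale.
  by apply: cmeasurable_haar; rewrite muln_gt0 expn_gt0.
move=> t _; exists (Num.truncn (tau n t)^-1).+1 => N HN.
by rewrite -(chaosfE c HN); apply: eq_bigr => k _; rewrite tau_exp.
Qed.

Lemma dil_chaosfE (c : nat -> C) n : dil (chaosf c) n = (fun t => chaosf c (tau n t)).
Proof. by apply/funext => t; apply: dilE; exact: chaosf_out. Qed.

Lemma cmeasurable_psum (a : nat -> C) (c : nat -> C) N : cmeasurable (psum a (dil (chaosf c)) N).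
Proof.
rewrite /psum.
(* [cmeasurable_sum] wants every index measurable, so the summand at 0, outside the range, is
   replaced by 0. *)
apply: (@cmeasurable_lim (fun _ t => \sum_(n <- index_iota 1 N) (if n is k.+1 then a n * dil (chaosf c) n t else 0))).
  move=> _; apply: cmeasurable_sum => -[|n]; first exact: cmeasurable_cst.
  by apply: cmeasurable_scale; rewrite dil_chaosfE; exact: cmeasurable_chaosf.
move=> t _; exists 0%N => _ _; rewrite big_nat [RHS]big_nat; apply: eq_bigr => n.
by case: n.
Qed.

End NodeIntegrals.

Section PowerIntegrals.
Variable R : realType.
Local Notation C := R[i].
Local Notation mu := (@lebesgue_measure R).
Local Notation I := (@I01 R).
Implicit Types (g : R -> C) (n m N : nat).

Definition ipow (q : R) n g : \bar R := (\int[mu]_(t in nodeI n) (cabs (g t) `^ q)%:E)%E.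

Variable q : R.
Hypothesis q0 : 0 < q.

Lemma intpow_ge0 g : (0 <= intpow q g)%E.
Proof. by apply: integral_ge0 => t _; rewrite lee_fin powR_ge0. Qed.

Lemma ipow_ge0 n g : (0 <= ipow q n g)%E.
Proof. by apply: integral_ge0 => t _; rewrite lee_fin powR_ge0. Qed.

Lemma intpow_window N g : (0 < N)%N -> cmeasurable g ->
  intpow q g = (\sum_(N <= n < N.*2) ipow q n g)%E.
Proof.
move=> N0 mg; apply: ge0_int_window => //; first exact: cmeasurable_pow.
by move=> t _; rewrite lee_fin powR_ge0.
Qed.

(** Compare both terms with their maximum. This crude bound stands in for Minkowski's inequality. *)
Lemma powRD_le (x y : R) : 0 <= x -> 0 <= y -> (x + y) `^ q <= 2 `^ q * (x `^ q + y `^ q).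
Proof.
move=> x0 y0; pose z := Num.max x y.
have z0 : 0 <= z by rewrite le_max x0.
have xz : x <= z by rewrite le_max lexx.
have yz : y <= z by rewrite le_max lexx orbT.
apply: (@le_trans _ _ ((2 * z) `^ q)).
  by apply: ge0_ler_powR; rewrite ?nnegrE ?addr_ge0 ?mulr_ge0 ?(ltW q0)//; lra.
rewrite powRM// ler_wpM2l ?powR_ge0// /z.
by have [_|_] := lerP x y; rewrite ?lerDr ?lerDl powR_ge0.
Qed.

Lemma intpow_le (k : R) g1 g2 : cmeasurable g1 -> cmeasurable g2 -> 0 <= k ->
  (forall t, I t -> cabs (g1 t) `^ q <= k * cabs (g2 t) `^ q) ->
  (intpow q g1 <= k%:E * intpow q g2)%E.
Proof.
move=> m1 m2 k0 H; rewrite /intpow -ge0_integralZl_EFin//.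
- apply: ge0_le_integral.
  + exact: measurable_I01.
  + by move=> t _; rewrite lee_fin powR_ge0.
  + exact: cmeasurable_pow.
  + by apply: measurable_funeM; exact: cmeasurable_pow.
  + by move=> t It; rewrite lee_fin H.
- exact: measurable_I01.
- by move=> t _; rewrite lee_fin powR_ge0.
- exact: cmeasurable_pow.
Qed.

Lemma intpow_add_le g g1 g2 : cmeasurable g -> cmeasurable g1 -> cmeasurable g2 ->
  (forall t, I t -> cabs (g t) <= cabs (g1 t) + cabs (g2 t)) ->
  (intpow q g <= (2 `^ q)%:E * (intpow q g1 + intpow q g2))%E.
Proof.
move=> mg m1 m2 H; rewrite /intpow -ge0_integralD//; last 5 first.
- exact: measurable_I01.
- by move=> t _; rewrite lee_fin powR_ge0.
- exact: cmeasurable_pow.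
- by move=> t _; rewrite lee_fin powR_ge0.
- exact: cmeasurable_pow.
rewrite -ge0_integralZl_EFin ?powR_ge0//; last 3 first.
- exact: measurable_I01.
- by move=> t _; rewrite adde_ge0// lee_fin powR_ge0.
- by apply: emeasurable_funD; exact: cmeasurable_pow.
apply: ge0_le_integral.
- exact: measurable_I01.
- by move=> t _; rewrite lee_fin powR_ge0.
- exact: cmeasurable_pow.
- by apply: measurable_funeM; apply: emeasurable_funD; exact: cmeasurable_pow.
move=> t It; rewrite -EFinD -EFinM lee_fin.
apply: le_trans (powRD_le (cabs_ge0 _) (cabs_ge0 _)).
by apply: ge0_ler_powR; rewrite ?nnegrE ?addr_ge0 ?cabs_ge0 ?(ltW q0)// H.
Qed.

Lemma intpow_node_cst N g (G : nat -> C) : (0 < N)%N -> cmeasurable g ->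
  (forall n t, (N <= n < N.*2)%N -> nodeI n t -> g t = G n) ->
  intpow q g = (tmean N (fun n => cabs (G n) `^ q))%:E.
Proof.
move=> N0 mg gG; rewrite (intpow_window N0)// /tmean -sumEFin big_nat [RHS]big_nat.
apply: eq_bigr => n nN; rewrite /ipow.
rewrite (eq_integral (fun=> (cabs (G n) `^ q)%:E)) => [|t]; last first.
  by rewrite inE => nt; rewrite (gG n).
rewrite integral_cst; last exact: measurable_nodeI.
by rewrite [X in (_ * X)%E]mu_nodeI -EFinM mulrC.
Qed.

End PowerIntegrals.

(** * Averages over dyadic intervals *)

Section Averages.
Variable R : realType.
Local Notation C := R[i].
Local Notation mu := (@lebesgue_measure R).
Local Notation I := (@I01 R).
Implicit Types (g : R -> C) (n m N : nat) (u v : R -> R).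

Definition ravg n u : R := 2 ^+ lev n * \int[mu]_(t in nodeI n) u t.

Definition avg n g : C :=
  (ravg n (fun t => complex.Re (g t)) +i* ravg n (fun t => complex.Im (g t)))%C.

Definition cintegrable g :=
  mu.-integrable I (EFin \o (fun t => complex.Re (g t))) /\
  mu.-integrable I (EFin \o (fun t => complex.Im (g t))).

Lemma integrable_node n u : (0 < n)%N -> mu.-integrable I (EFin \o u) ->
  mu.-integrable (nodeI n) (EFin \o u).
Proof.
move=> n0; apply: integrableS; [exact: measurable_I01|exact: measurable_nodeI|exact: nodeI_sub_I01].
Qed.

Lemma ravg_split n u : (0 < n)%N -> mu.-integrable I (EFin \o u) ->
  ravg n u = (ravg n.*2 u + ravg n.*2.+1 u) / 2.
Proof.
move=> n0 iu; rewrite /ravg (nodeI_split R n0) Rintegral_setU; last 4 first.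
- exact: measurable_nodeI.
- exact: measurable_nodeI.
- by rewrite -nodeI_split//; exact: integrable_node.
- exact: nodeI_disj.
by rewrite lev_double// lev_doubleS// exprS; field.
Qed.

Lemma eq_ravg n u v : (forall t, nodeI n t -> u t = v t) -> ravg n u = ravg n v.
Proof. by move=> uv; congr (_ * _); apply: eq_Rintegral => t; rewrite inE => /uv. Qed.

Lemma eq_avg n g1 g2 : (forall t, nodeI n t -> g1 t = g2 t) -> avg n g1 = avg n g2.
Proof. by move=> gg; congr (_ +i* _)%C; apply: eq_ravg => t /gg ->. Qed.

Lemma ravg_cst n (a : R) : ravg n (fun=> a) = a.
Proof.
rewrite /ravg Rintegral_cst; last exact: measurable_nodeI.
rewrite [X in fine X]mu_nodeI /= /wt mulrCA mulfV ?mulr1//.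
Qed.

Lemma avg_cst n (a : C) : avg n (fun=> a) = a.
Proof. by rewrite /avg !ravg_cst; case: a. Qed.

Lemma integrable_scaleR D (a : R) u : measurable D -> mu.-integrable D (EFin \o u) ->
  mu.-integrable D (EFin \o (fun t => a * u t)).
Proof.
move=> mD iu; rewrite (_ : EFin \o _ = (fun t => a%:E * (EFin \o u) t)%E).
  exact: integrableZl.
by apply/funext => t /=; rewrite EFinM.
Qed.

Lemma integrable_addR D u v : measurable D -> mu.-integrable D (EFin \o u) ->
  mu.-integrable D (EFin \o v) -> mu.-integrable D (EFin \o (fun t => u t + v t)).
Proof.
move=> mD iu iv; rewrite (_ : EFin \o _ = (EFin \o u) \+ (EFin \o v))%E.
  exact: integrableD.
by apply/funext => t /=; rewrite EFinD.
Qed.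

Lemma ravg_comb n (a b : R) u v : (0 < n)%N ->
  mu.-integrable I (EFin \o u) -> mu.-integrable I (EFin \o v) ->
  ravg n (fun t => a * u t + b * v t) = a * ravg n u + b * ravg n v.
Proof.
move=> n0 /(integrable_node n0) iu /(integrable_node n0) iv.
rewrite /ravg RintegralD; last 3 first.
- exact: measurable_nodeI.
- apply: integrable_scaleR => //; exact: measurable_nodeI.
- apply: integrable_scaleR => //; exact: measurable_nodeI.
rewrite !RintegralZl//; try exact: measurable_nodeI.
by ring.
Qed.

Lemma integrable_comb (a b : R) u v :
  mu.-integrable I (EFin \o u) -> mu.-integrable I (EFin \o v) ->
  mu.-integrable I (EFin \o (fun t => a * u t + b * v t)).
Proof.
by move=> iu iv; have mI := @measurable_I01 R; apply: integrable_addR => //; exact: integrable_scaleR.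
Qed.

Lemma eq_integrable_fun u v : u =1 v -> mu.-integrable I (EFin \o u) -> mu.-integrable I (EFin \o v).
Proof. by move=> /funext ->. Qed.

Lemma cintegrable_comb (a : C) g1 g2 : cintegrable g1 -> cintegrable g2 ->
  cintegrable (fun t => a * g1 t + g2 t).
Proof.
move=> [r1 i1] [r2 i2]; split.
  apply: eq_integrable_fun (integrable_comb 1 1 (integrable_comb (complex.Re a) (- complex.Im a) r1 i1) r2) => t.
  by rewrite !mul1r ReD; congr (_ + _); case: a (g1 t) => [? ?] [? ?] /=; rewrite mulNr.
apply: eq_integrable_fun (integrable_comb 1 1 (integrable_comb (complex.Re a) (complex.Im a) i1 r1) i2) => t.
by rewrite !mul1r ImD; congr (_ + _); case: a (g1 t) => [? ?] [? ?] /=.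
Qed.

Lemma avg_comb n (a : C) g1 g2 : (0 < n)%N -> cintegrable g1 -> cintegrable g2 ->
  avg n (fun t => a * g1 t + g2 t) = a * avg n g1 + avg n g2.
Proof.
move=> n0 [r1 i1] [r2 i2].
have ra : ravg n (fun t => complex.Re (a * g1 t + g2 t)) =
    (complex.Re a * ravg n (fun t => complex.Re (g1 t)) - complex.Im a * ravg n (fun t => complex.Im (g1 t)))
      + ravg n (fun t => complex.Re (g2 t)).
  have ri := integrable_comb (complex.Re a) (- complex.Im a) r1 i1.
  rewrite -mulNr -(ravg_comb _ _ n0 r1 i1) -[X in X + _]mul1r -[X in _ + X]mul1r -(ravg_comb _ _ n0 ri r2).
  by apply: eq_ravg => t _; rewrite !mul1r ReD; congr (_ + _); case: a (g1 t) {ri} => [? ?] [? ?] /=; rewrite mulNr.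
have ia : ravg n (fun t => complex.Im (a * g1 t + g2 t)) =
    (complex.Re a * ravg n (fun t => complex.Im (g1 t)) + complex.Im a * ravg n (fun t => complex.Re (g1 t)))
      + ravg n (fun t => complex.Im (g2 t)).
  have ri := integrable_comb (complex.Re a) (complex.Im a) i1 r1.
  rewrite -(ravg_comb _ _ n0 i1 r1) -[X in X + _]mul1r -[X in _ + X]mul1r -(ravg_comb _ _ n0 ri i2).
  by apply: eq_ravg => t _; rewrite !mul1r ImD; congr (_ + _); case: (a) (g1 t) => [? ?] [? ?] /=.
have -> : avg n (fun t => a * g1 t + g2 t) = Complex (complex.Re a * ravg n (fun t => complex.Re (g1 t)) -
    complex.Im a * ravg n (fun t => complex.Im (g1 t)) + ravg n (fun t => complex.Re (g2 t)))
  (complex.Re a * ravg n (fun t => complex.Im (g1 t)) +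
    complex.Im a * ravg n (fun t => complex.Re (g1 t)) + ravg n (fun t => complex.Im (g2 t))).
  by congr (_ +i* _)%C.
by rewrite /avg; case: (a) => ar ai.
Qed.

Lemma cintegrable_cst (a : C) : cintegrable (fun=> a).
Proof.
have mI : (mu I < +oo)%E by rewrite -nodeI1 [X in (X < _)%E]mu_nodeI ltry.
have h (k : R) : mu.-integrable I (EFin \o (fun=> k)).
  apply/integrableP; split; first exact: measurable_cst.
  rewrite (eq_integral (fun=> `|k|%:E))// integral_cst; last exact: measurable_I01.
  by rewrite -nodeI1 [X in (_ * X)%E]mu_nodeI -EFinM ltry.
by split; exact: h.
Qed.

Lemma cintegrable_sum (J : eqType) (r : seq J) (a : J -> C) (G : J -> R -> C) :
  (forall j, j \in r -> cintegrable (G j)) -> cintegrable (fun t => \sum_(j <- r) a j * G j t).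
Proof.
elim: r => [|j r IH] iG.
  rewrite (_ : (fun t => _) = fun=> 0); first exact: cintegrable_cst.
  by apply/funext => t; rewrite big_nil.
rewrite (_ : (fun t => _) = (fun t => a j * G j t + \sum_(j <- r) a j * G j t)).
  by apply: cintegrable_comb; [apply: iG; rewrite mem_head|apply: IH => k kr; apply: iG; rewrite inE kr orbT].
by apply/funext => t; rewrite big_cons.
Qed.

Lemma avg_sum n (J : eqType) (r : seq J) (a : J -> C) (G : J -> R -> C) : (0 < n)%N ->
  (forall j, j \in r -> cintegrable (G j)) ->
  avg n (fun t => \sum_(j <- r) a j * G j t) = \sum_(j <- r) a j * avg n (G j).
Proof.
move=> n0; elim: r => [|j r IH] iG.
  rewrite big_nil -[RHS](avg_cst n 0); apply: eq_avg => t _.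
  by rewrite big_nil.
rewrite big_cons -IH; last by move=> k kr; apply: iG; rewrite inE kr orbT.
rewrite -avg_comb//; last 2 first.
- by apply: iG; rewrite mem_head.
- by apply: cintegrable_sum => k kr; apply: iG; rewrite inE kr orbT.
by apply: eq_avg => t _; rewrite big_cons.
Qed.

Lemma avg_split n g : (0 < n)%N -> cintegrable g -> avg n g = (avg n.*2 g + avg n.*2.+1 g) / 2.
Proof.
move=> n0 [r i]; rewrite /avg (ravg_split n0 r) (ravg_split n0 i).
have -> : (2 : C)^-1 = (2^-1)%:C%C by rewrite fmorphV rmorph_nat.
by apply/eqP; rewrite eq_complex /= !mulr0 subr0 add0r; apply/andP; split; apply/eqP; ring.
Qed.

Variable q : R.
Hypothesis q1 : 1 < q.

Let q0 : 0 < q. Proof. exact: lt_trans ltr01 q1. Qed.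

(** For x > l one has x = x^q x^(1-q) <= x^q l^(1-q). Being linear in x^q, the bound can be
    integrated and [l] chosen afterwards; this takes the place of Jensen's inequality. *)
Lemma le_young (x l : R) : 0 <= x -> 0 < l -> x <= l + l `^ (1 - q) * x `^ q.
Proof.
move=> x0 l0; have [xl|lx] := lerP x l.
  by apply: ler_wpDr => //; rewrite mulr_ge0 ?powR_ge0.
apply: ler_wpDl; first exact: ltW.
have x1 : 0 < x by apply: lt_trans lx.
have -> : l `^ (1 - q) = (l `^ (q - 1))^-1 by rewrite -powRN opprB.
rewrite mulrC ler_pdivlMr ?powR_gt0//.
have -> : x `^ q = x * x `^ (q - 1).
  rewrite -{2}(powRr1 x0) -powRD; first by rewrite addrC subrK.
  by rewrite (gt_eqF x1) implybT.
rewrite ler_wpM2l// ge0_ler_powR ?nnegrE ?(ltW l0)//; last exact: ltW.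
by rewrite subr_ge0 ltW.
Qed.

Lemma integrable_pow g : inLq q g -> mu.-integrable I (EFin \o (fun t => cabs (g t) `^ q)).
Proof.
move=> [mg fg]; apply/integrableP; split; first exact: (cmeasurable_pow q mg).
rewrite [X in (X < _)%E](_ : _ = intpow q g)//; apply: eq_integral => t _ /=.
by rewrite ger0_norm// powR_ge0.
Qed.

Lemma integrable_cabs g : inLq q g -> mu.-integrable I (EFin \o (fun t => cabs (g t))).
Proof.
move=> ig; have [mg fg] := ig.
have h := integrable_comb 1 1 (cintegrable_cst 1).1 (integrable_pow ig).
apply: le_integrable h; [exact: measurable_I01| |].
  by apply/measurable_EFinP; exact: cmeasurable_cabs.
move=> t _ /=; rewrite lee_fin !mul1r ger0_norm ?cabs_ge0// ger0_norm; last first.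
  by rewrite addr_ge0// powR_ge0.
by have := le_young (cabs_ge0 (g t)) ltr01; rewrite powR1 mul1r.
Qed.

Lemma inLq_cintegrable g : inLq q g -> cintegrable g.
Proof.
move=> ig; have h := integrable_cabs ig; have [[mr mi] _] := ig; split.
  apply: le_integrable h; [exact: measurable_I01|exact/measurable_EFinP|].
  by move=> t _ /=; rewrite lee_fin [leRHS]ger0_norm ?cabs_ge0 ?ler_Re_cabs.
apply: le_integrable h; [exact: measurable_I01|exact/measurable_EFinP|].
by move=> t _ /=; rewrite lee_fin [leRHS]ger0_norm ?cabs_ge0 ?ler_Im_cabs.
Qed.

Lemma avg_pow_le n g : (0 < n)%N -> inLq q g ->
  ((wt R n * cabs (avg n g) `^ q)%:E <= (4 `^ q)%:E * ipow q n g)%E.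
Proof.
move=> n0 ig; have mD := @measurable_nodeI R n.
have iG := integrable_node n0 (integrable_cabs ig).
have iP := integrable_node n0 (integrable_pow ig).
have [/(integrable_node n0) iR /(integrable_node n0) iI] := inLq_cintegrable ig.
pose J := \int[mu]_(t in nodeI n) cabs (g t).
pose P := \int[mu]_(t in nodeI n) (cabs (g t) `^ q).
have PE : ipow q n g = P%:E by rewrite /P /Rintegral fineK//; exact: integrable_fin_num iP.
rewrite PE -EFinM lee_fin.
have two0 : 0 < 2 ^+ lev n :> R by rewrite exprn_gt0.
pose A := cabs (avg n g).
have AJ : A <= 2 ^+ lev n * (2 * J).
  apply: le_trans (cabs_le_ReIm _) _; rewrite /avg /= /ravg !normrM (ger0_norm (ltW two0)).
  rewrite -mulrDr ler_wpM2l ?(ltW two0)// (_ : 2 * J = J + J); last ring.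
  apply: lerD.
    have h : `|\int[mu]_(t in nodeI n) complex.Re (g t)| <= \int[mu]_(t in nodeI n) `|complex.Re (g t)|.
      by apply: le_normr_Rintegral.
    apply: le_trans h _; apply: le_Rintegral => //.
      exact: (integrable_norm iR).
    by move=> t _; exact: ler_Re_cabs.
  have h : `|\int[mu]_(t in nodeI n) complex.Im (g t)| <= \int[mu]_(t in nodeI n) `|complex.Im (g t)|.
    by apply: le_normr_Rintegral.
  apply: le_trans h _; apply: le_Rintegral => //.
    exact: (integrable_norm iI).
  by move=> t _; exact: ler_Im_cabs.
have P0 : 0 <= P by apply: Rintegral_ge0 => t _; exact: powR_ge0.
rewrite -/A; have [A0|A0] := lerP A 0.
  have -> : A = 0 by apply/eqP; rewrite eq_le A0 cabs_ge0.
  by rewrite powR0 ?mulr0 ?mulr_ge0 ?powR_ge0// gt_eqF.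
(* Integrating [le_young] gives A <= 2 l + 2 (2^lev P) / l^(q-1), with one factor 2 for the real and
   imaginary parts; for A = 4 l this becomes l^q <= 2^lev P, whence the constant 4^q. *)
pose l := A / 4; have l0 : 0 < l by rewrite divr_gt0.
have JP : J <= l * wt R n + l `^ (1 - q) * P.
  have icst : mu.-integrable (nodeI n) (EFin \o (fun=> l)).
    exact: (integrable_node n0 (cintegrable_cst l%:C%C).1).
  have iZ : mu.-integrable (nodeI n) (EFin \o (fun t => l `^ (1 - q) * cabs (g t) `^ q)).
    exact: integrable_scaleR.
  have -> : l * wt R n + l `^ (1 - q) * P = \int[mu]_(t in nodeI n) (l + l `^ (1 - q) * cabs (g t) `^ q).
    rewrite RintegralD// RintegralZl// Rintegral_cst// [X in fine X]mu_nodeI//.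
  apply: le_Rintegral => //; first exact: integrable_addR.
  by move=> t _; apply: le_young; rewrite ?cabs_ge0.
have lP : l `^ q <= 2 ^+ lev n * P.
  have lE : l `^ q = l * l `^ (q - 1).
    rewrite -{2}(powRr1 (ltW l0)) -powRD; first by rewrite addrC subrK.
    by rewrite (gt_eqF l0) implybT.
  have lN : l `^ (1 - q) = (l `^ (q - 1))^-1 by rewrite -powRN opprB.
  have p0 : 0 < l `^ (q - 1) by rewrite powR_gt0.
  rewrite lE -ler_pdivlMr//.
  have : A <= 2 * l + 2 * (2 ^+ lev n * P / l `^ (q - 1)).
    apply: le_trans AJ _.
    have -> : 2 * l = 2 * (2 ^+ lev n * (l * wt R n)) by rewrite /wt; field; rewrite gt_eqF.
    rewrite -mulrDr mulrCA ler_wpM2l// -mulrA -mulrDr ler_wpM2l ?(ltW two0)//.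
    by rewrite -lN [P * _]mulrC.
  by rewrite /l; lra.
have -> : A = 4 * l by rewrite /l; field.
rewrite powRM ?(ltW l0)// mulrCA ler_wpM2l ?powR_ge0// /wt ler_pdivrMl//.
Qed.

Lemma tmean_avg_pow_le N g : (0 < N)%N -> inLq q g ->
  ((tmean N (fun n => cabs (avg n g) `^ q))%:E <= (4 `^ q)%:E * intpow q g)%E.
Proof.
move=> N0 ig; rewrite (intpow_window _ N0 ig.1)//.
rewrite ge0_sume_distrr; last by move=> n _; exact: ipow_ge0.
rewrite /tmean -sumEFin big_nat [leRHS]big_nat; apply: lee_sum => n /andP[h _].
by apply: avg_pow_le => //; exact: leq_trans h.
Qed.

(** The average over a node is the mean of those over its halves, so half their difference is the
    Haar coefficient. *)
Lemma avg_treeval n g : (0 < n)%N -> cintegrable g ->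
  avg n g = avg 1 g + treeval (fun m => (avg m.*2 g - avg m.*2.+1 g) / 2) n.
Proof.
move=> n0 ig; move: n n0; apply: node_ind => [|n n0 IH]; first by rewrite treeval1 addr0.
rewrite treeval_double// treeval_doubleS// !addrA -!IH (avg_split n0 ig).
by split; field.
Qed.

End Averages.

(** * L^q bounds for a chaos with coefficients of geometric growth *)

Section ChaosBounds.
Variable R : realType.
Local Notation C := R[i].
Local Notation mu := (@lebesgue_measure R).
Local Notation I := (@I01 R).
Variables (q kap eta : R).
Hypotheses (q1 : 1 < q) (kap0 : 0 <= kap) (kap1 : kap < 1) (eta0 : 0 < eta) (eta2 : eta `^ q < 2).

Let q0 : 0 < q. Proof. exact: lt_trans ltr01 q1. Qed.
Let th := eta `^ q.
Let th0 : 0 <= th. Proof. exact: powR_ge0. Qed.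
Let kap1' : 0 < 1 - kap. Proof. by rewrite subr_gt0. Qed.
Let th2' : 0 < 1 - th / 2. Proof. by rewrite subr_gt0 ltr_pdivrMr ?mul1r. Qed.

Definition cgrowth (B : R) (c : nat -> C) := forall k, cabs (c k) <= B * (kap * eta) ^+ k.

Lemma cgrowth_ge0 B c : cgrowth B c -> 0 <= B.
Proof. by move=> /(_ 0%N); rewrite expr0 mulr1; apply: le_trans; exact: cabs_ge0. Qed.

Lemma cgrowth_shift B c i : cgrowth B c -> cgrowth (B * (kap * eta) ^+ i) (fun k => c (i + k)%N).
Proof. by move=> Bc k; rewrite -mulrA -exprD. Qed.

Lemma powR_expn (x : R) k : 0 <= x -> (x ^+ k) `^ q = (x `^ q) ^+ k.
Proof. by move=> x0; rewrite -powR_mulrn// powRAC powR_mulrn ?powR_ge0. Qed.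

Lemma powR_q_inv (x : R) : 0 <= x -> (x `^ q^-1) `^ q = x.
Proof. by move=> x0; rewrite -powRrM mulVf ?powRr1// gt_eqF. Qed.

Lemma le_powR_inv (x y : R) : 0 <= x -> 0 <= y -> x `^ q <= y -> x <= y `^ q^-1.
Proof.
move=> x0 y0 xy; have := ge0_ler_powR (ltW _ : 0 <= q^-1) _ _ xy.
by rewrite -powRrM mulfV ?powRr1 ?gt_eqF ?nnegrE ?powR_ge0// => -> //; rewrite invr_gt0.
Qed.

(** Each y_k is at most the l^q norm of y, which leaves a geometric series in [kap]. *)
Lemma geom_pow_sum (y : nat -> R) n : (forall k, 0 <= y k) ->
  (\sum_(k < n) kap ^+ k * y k) `^ q <= (1 - kap)^-1 `^ q * \sum_(k < n) y k `^ q.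
Proof.
move=> y0; set S := \sum_(k < n) y k `^ q.
have S0 : 0 <= S by apply: sumr_ge0 => k _; exact: powR_ge0.
have yS (k : 'I_n) : y k <= S `^ q^-1.
  apply: le_powR_inv => //; rewrite /S (bigD1 k)//= lerDl.
  by apply: sumr_ge0 => j _; exact: powR_ge0.
rewrite -[X in _ * X](powR_q_inv S0) -powRM ?invr_ge0 ?powR_ge0 ?(ltW kap1')//.
apply: ge0_ler_powR; rewrite ?nnegrE ?(ltW q0)//.
- by apply: sumr_ge0 => k _; rewrite mulr_ge0 ?exprn_ge0.
- by rewrite mulr_ge0 ?invr_ge0 ?powR_ge0 ?(ltW kap1').
apply: (@le_trans _ _ (\sum_(k < n) kap ^+ k * S `^ q^-1)).
  by apply: ler_sum => k _; rewrite ler_wpM2l ?exprn_ge0.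
by rewrite -mulr_suml ler_wpM2r ?powR_ge0// geom_sum_le.
Qed.

(** Up to a constant it dominates |chaosf c (tau n t)|^q. The nested intervals of the nodes 2^k n
    have length [wt n] 2^(-k), so its integral is a geometric series of ratio th / 2 < 1. *)
Definition majorant n (t : R) : \bar R :=
  (\sum_(0 <= k <oo) (th ^+ k * \1_(nodeI (2 ^ k * n)) t)%:E)%E.

Definition chaos_major n K (t : R) : R :=
  \sum_(k < K) kap ^+ k * (eta ^+ k * \1_(nodeI (2 ^ k * n)) t).

Lemma majorant_ge0 n t : (0 <= majorant n t)%E.
Proof. by apply: nneseries_ge0 => k _ _; rewrite lee_fin mulr_ge0 ?exprn_ge0. Qed.

Lemma measurable_majorant n (D : set R) : measurable D -> measurable_fun D (majorant n).
Proof.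
move=> mD; apply: ge0_emeasurable_sum => [k t _|k _].
  by rewrite lee_fin mulr_ge0 ?exprn_ge0.
apply/measurable_EFinP; apply: measurable_funM; first exact: measurable_cst.
by apply: measurable_indic; exact: measurable_nodeI.
Qed.

Lemma int_majorant n D : (0 < n)%N -> measurable D ->
  (\int[mu]_(t in D) majorant n t <= (wt R n / (1 - th / 2))%:E)%E.
Proof.
move=> n0 mD; rewrite integral_nneseries//; last 2 first.
- move=> k; apply/measurable_EFinP; apply: measurable_funM; first exact: measurable_cst.
  by apply: measurable_indic; exact: measurable_nodeI.
- by move=> k t _; rewrite lee_fin mulr_ge0 ?exprn_ge0.
have term k : (\int[mu]_(t in D) (th ^+ k * \1_(nodeI (2 ^ k * n)) t)%:E <= (wt R n * (th / 2) ^+ k)%:E)%E.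
  have -> : (\int[mu]_(t in D) (th ^+ k * \1_(nodeI (2 ^ k * n)) t)%:E =
      \int[mu]_(t in D) ((th ^+ k)%:E * (\1_(nodeI (2 ^ k * n)) t)%:E))%E.
    by apply: eq_integral => t _; rewrite EFinM.
  rewrite ge0_integralZl_EFin ?exprn_ge0//; last first.
    by apply/measurable_EFinP; apply: measurable_indic; exact: measurable_nodeI.
  rewrite integral_indic//; last exact: measurable_nodeI.
  apply: (@le_trans _ _ ((th ^+ k)%:E * (wt R (2 ^ k * n))%:E)%E).
    apply: lee_wpmul2l; first by rewrite lee_fin exprn_ge0.
    rewrite -mu_nodeI; apply: le_measure; rewrite ?inE.
    - by apply: measurableI => //; exact: measurable_nodeI.
    - exact: measurable_nodeI.
    - by move=> t [].
  rewrite -EFinM lee_fin /wt.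
  have -> : lev (2 ^ k * n) = (k + lev n)%N by rewrite -(lev_block (i := 0)) ?addn0 ?expn_gt0.
  by rewrite exprD invfM expr_div_n le_eqVlt; apply/orP; left; apply/eqP; ring.
apply: lime_le; first by apply: is_cvg_nneseries => k _ _; apply: integral_ge0 => t _; rewrite lee_fin mulr_ge0 ?exprn_ge0.
apply: nearW => K; apply: (@le_trans _ _ (\sum_(0 <= k < K) (wt R n * (th / 2) ^+ k)%:E)%E).
  by apply: lee_sum => k _; exact: term.
rewrite sumEFin lee_fin big_mkord -mulr_sumr ler_wpM2l ?wt_ge0//.
by apply: geom_sum_le; [rewrite divr_ge0|rewrite ltr_pdivrMr ?mul1r].
Qed.

Lemma chaos_major_ge0 n K t : 0 <= chaos_major n K t.
Proof. by apply: sumr_ge0 => k _; rewrite !mulr_ge0 ?exprn_ge0// ltW. Qed.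

Lemma chaos_major_pow n K t :
  ((chaos_major n K t `^ q)%:E <= ((1 - kap)^-1 `^ q)%:E * majorant n t)%E.
Proof.
have h : chaos_major n K t `^ q <= (1 - kap)^-1 `^ q * \sum_(k < K) th ^+ k * \1_(nodeI (2 ^ k * n)) t.
  have y0 k : 0 <= eta ^+ k * \1_(nodeI (2 ^ k * n)) t by rewrite mulr_ge0 ?exprn_ge0// ltW.
  apply: le_trans (geom_pow_sum K y0) _.
  rewrite ler_wpM2l ?powR_ge0//; apply: ler_sum => k _.
  rewrite indicE; case: (_ \in _); last by rewrite !mulr0 powR0// gt_eqF.
  by rewrite !mulr1 powR_expn ?(ltW eta0).
apply: (@le_trans _ _ ((1 - kap)^-1 `^ q * \sum_(k < K) th ^+ k * \1_(nodeI (2 ^ k * n)) t)%:E).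
  by rewrite lee_fin.
rewrite EFinM; apply: lee_wpmul2l; first by rewrite lee_fin powR_ge0.
rewrite -sumEFin -(big_mkord xpredT (fun k => (th ^+ k * \1_(nodeI (2 ^ k * n)) t)%:E)).
by apply: nneseries_lim_ge => k _ _; rewrite lee_fin mulr_ge0 ?exprn_ge0.
Qed.

Lemma cabs_haar_tau n t : (0 < n)%N -> cabs (haar (tau n t) : C) <= \1_(nodeI n) t.
Proof.
move=> n0; rewrite indicE; have [h|h] := boolP (t \in nodeI n); first exact: cabs_haar_le.
rewrite haar_out ?cabs0//; apply/negP => h'; move/negP : h; apply.
by rewrite inE.
Qed.

Lemma cabs_chaosf_le B c n t K : cgrowth B c -> (0 < n)%N ->
  ((Num.truncn (tau n t)^-1).+1 <= K)%N -> cabs (chaosf c (tau n t)) <= B * chaos_major n K t.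
Proof.
move=> Bc n0 nK; rewrite -(chaosfE c nK) mulr_sumr.
apply: le_trans (cabs_sum _ _ _) _; apply: ler_sum => k _.
rewrite cabsM -tau_exp//.
have -> : B * (kap ^+ k * (eta ^+ k * \1_(nodeI (2 ^ k * n)) t)) =
  (B * (kap * eta) ^+ k) * \1_(nodeI (2 ^ k * n)) t by rewrite exprMn; ring.
by apply: ler_pM; rewrite ?cabs_ge0// cabs_haar_tau// muln_gt0 expn_gt0.
Qed.

Lemma cabs_chaosf_pow_le B c n t : cgrowth B c -> (0 < n)%N ->
  ((cabs (chaosf c (tau n t)) `^ q)%:E <= ((B / (1 - kap)) `^ q)%:E * majorant n t)%E.
Proof.
move=> Bc n0; have B0 := cgrowth_ge0 Bc.
have h := cabs_chaosf_le Bc n0 (leqnn _).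
apply: (@le_trans _ _ ((B `^ q)%:E * (chaos_major n (Num.truncn (tau n t)^-1).+1 t `^ q)%:E)%E).
  rewrite -EFinM lee_fin -powRM ?chaos_major_ge0//.
  by apply: ge0_ler_powR; rewrite ?nnegrE ?cabs_ge0 ?mulr_ge0 ?chaos_major_ge0 ?(ltW q0).
rewrite powRM ?invr_ge0 ?(ltW kap1')// EFinM -muleA; apply: lee_wpmul2l.
  by rewrite lee_fin powR_ge0.
exact: chaos_major_pow.
Qed.

Lemma int_chaosf_pow_le B c n D : cgrowth B c -> (0 < n)%N -> measurable D -> D `<=` I ->
  (\int[mu]_(t in D) (cabs (chaosf c (tau n t)) `^ q)%:E <=
   ((B / (1 - kap)) `^ q * (wt R n / (1 - th / 2)))%:E)%E.
Proof.
move=> Bc n0 mD DI.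
have h : (\int[mu]_(t in D) (cabs (chaosf c (tau n t)) `^ q)%:E <=
    \int[mu]_(t in D) (((B / (1 - kap)) `^ q)%:E * majorant n t))%E.
  apply: ge0_le_integral => //.
  - by move=> t _; rewrite lee_fin powR_ge0.
  - apply: measurable_funS (cmeasurable_pow q (cmeasurable_chaosf c n0)) => //.
    exact: measurable_I01.
  - by apply: measurable_funeM; exact: measurable_majorant.
  - by move=> t _; exact: cabs_chaosf_pow_le.
apply: (le_trans h).
rewrite ge0_integralZl_EFin ?powR_ge0//; last 2 first.
- by move=> t _; exact: majorant_ge0.
- exact: measurable_majorant.
by rewrite EFinM; apply: lee_wpmul2l; [rewrite lee_fin powR_ge0|exact: int_majorant].
Qed.

Lemma inLq_chaosf B c n : cgrowth B c -> (0 < n)%N -> inLq q (fun t => chaosf c (tau n t)).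
Proof.
move=> Bc n0; split; first exact: cmeasurable_chaosf.
apply: le_lt_trans (int_chaosf_pow_le Bc n0 (@measurable_I01 R) _) _ => //.
exact: ltry.
Qed.

(** The integral of the q-th power is bounded proportionally to [wt n], so the average is bounded
    free of [n]. Linearity in [B] controls shifted coefficients in [avg_chaosf0]. *)
Lemma avg_chaosf_bound : exists2 L : R, 0 <= L & forall B c n, cgrowth B c -> (0 < n)%N ->
  cabs (avg n (fun t => chaosf c (tau n t))) <= L * B.
Proof.
pose M := (1 - th / 2)^-1 `^ q^-1.
exists (4 * (1 - kap)^-1 * M); first by rewrite !mulr_ge0 ?powR_ge0 ?invr_ge0 ?(ltW kap1').
move=> B c n Bc n0; have B0 := cgrowth_ge0 Bc.
have := avg_pow_le q1 n0 (inLq_chaosf Bc n0).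
have ip := int_chaosf_pow_le Bc n0 (measurable_nodeI n) (nodeI_sub_I01 n0).
move=> /le_trans/(_ (lee_wpmul2l _ ip)); rewrite lee_fin powR_ge0 => /(_ isT).
rewrite -EFinM lee_fin => h.
have {}h : cabs (avg n (fun t => chaosf c (tau n t))) `^ q <= (4 * (1 - kap)^-1 * M * B) `^ q.
  rewrite -(ler_pM2l (wt_gt0 R n)); apply: le_trans h _.
  have -> : (4 * (1 - kap)^-1 * M * B) `^ q = 4 `^ q * ((B / (1 - kap)) `^ q * (1 - th / 2)^-1).
    have BM : 0 <= B / (1 - kap) by rewrite divr_ge0 ?(ltW kap1').
    have M0 : 0 <= M by exact: powR_ge0.
    rewrite (_ : _ * B = 4 * (B / (1 - kap) * M)); last ring.
    rewrite powRM ?(mulr_ge0 BM M0)// (powRM _ BM M0); congr (_ * (_ * _)).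
    by rewrite powR_q_inv// invr_ge0 ltW.
  by rewrite le_eqVlt; apply/orP; left; apply/eqP; ring.
have := le_powR_inv (cabs_ge0 _) (powR_ge0 _ _) h.
by rewrite -powRrM mulfV ?gt_eqF// powRr1// !mulr_ge0 ?powR_ge0 ?invr_ge0 ?(ltW kap1').
Qed.

Lemma avg_haar n : (0 < n)%N -> avg n (fun t => haar (tau n t)) = 0 :> C.
Proof.
move=> n0.
have ig : cintegrable (fun t => haar (tau n t) : C).
  have Bd : cgrowth 1 (delta0 C).
    move=> k; rewrite mul1r /delta0; case: k => [|k]; first by rewrite cabs1 expr0.
    by rewrite cabs0 exprn_ge0// mulr_ge0// ltW.
  have := inLq_cintegrable q1 (inLq_chaosf Bd n0).
  by rewrite (_ : (fun t => _) = (fun t => haar (tau n t)))//; apply/funext => t; rewrite chaosf_delta0.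
rewrite avg_split// (eq_avg (g2 := fun=> 1)) => [|t /(nodeI_double _ n0)]; last exact: haarl.
rewrite (eq_avg (n := n.*2.+1) (g2 := fun=> -1)) => [|t /(nodeI_doubleS _ n0)]; last exact: haarr.
by rewrite !avg_cst subrr mul0r.
Qed.

(** Without interchanging sum and integral: removing the first term halves the interval and shifts
    the coefficients. After k rounds the average is 2^(-k) times one of order (kap eta)^k, which
    tends to 0 since eta < 2. *)
Lemma avg_chaosf0 B c n : cgrowth B c -> (0 < n)%N -> avg n (fun t => chaosf c (tau n t)) = 0.
Proof.
move=> Bc n0; have [L L0 HL] := avg_chaosf_bound.
have step B' c' m : cgrowth B' c' -> (0 < m)%N ->
    avg m (fun t => chaosf c' (tau m t)) = 2^-1 * avg m.*2 (fun t => chaosf (fun k => c' k.+1) (tau m.*2 t)).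
  move=> Bc' m0; have Bs := cgrowth_shift 1 Bc'.
  have Bd : cgrowth 1 (delta0 C).
    move=> k; rewrite mul1r /delta0; case: k => [|k]; first by rewrite cabs1 expr0.
    by rewrite cabs0 exprn_ge0// mulr_ge0// ltW.
  have m20 : (0 < m.*2)%N by rewrite double_gt0.
  have i1 := inLq_cintegrable q1 (inLq_chaosf Bd m0).
  have i2 := inLq_cintegrable q1 (inLq_chaosf Bs m20).
  rewrite (eq_avg (g2 := fun t => c' 0%N * chaosf (delta0 C) (tau m t) + chaosf (fun k => c' (1 + k)%N) (tau m.*2 t))); last first.
    by move=> t _; rewrite chaosf_rec chaosf_delta0 tau_double.
  rewrite avg_comb// (eq_avg (g1 := fun t => chaosf _ _) (g2 := fun t => haar (tau m t))); last first.
    by move=> t _; rewrite chaosf_delta0.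
  rewrite avg_haar// mulr0 add0r avg_split// (eq_avg (n := m.*2.+1) (g2 := fun=> 0)); last first.
    move=> t /(nodeI_doubleS _ m0) ht; rewrite chaosf_out// tau_double//; lra.
  by rewrite avg_cst addr0 mulrC.
have iter k : avg n (fun t => chaosf c (tau n t)) =
    2^-1 ^+ k * avg (2 ^ k * n) (fun t => chaosf (fun i => c (k + i)%N) (tau (2 ^ k * n) t)).
  elim: k => [|k IH]; first by rewrite mul1r mul1n.
  rewrite IH (step _ _ _ (cgrowth_shift k Bc)) ?muln_gt0 ?expn_gt0// mulrA -exprSr.
  rewrite -mul2n mulnA -expnS; congr (_ * avg _ _); apply/funext => t.
  by congr chaosf; apply/funext => i; rewrite addnS.
apply/eqP; rewrite -cabs_eq0; apply/eqP/vanishes_const.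
have eta_lt2 : eta < 2.
  rewrite ltNge; apply/negP => h; move: eta2; rewrite ltNge => /negP; apply.
  apply: (@le_trans _ _ (2 `^ q)); last by apply: ge0_ler_powR; rewrite ?nnegrE ?(ltW q0)// ltW.
  by rewrite -[leLHS](powRr1 (ler0n R 2)) ler_powR ?(ltW q1)// ler1n.
have g0 : 0 <= kap * eta / 2 by rewrite !mulr_ge0 ?(ltW eta0).
have g1 : kap * eta / 2 < 1.
  rewrite ltr_pdivrMr// mul1r; apply: le_lt_trans eta_lt2.
  by rewrite ler_piMl ?(ltW eta0)// ltW.
apply: (vanishes_le _ (vanishesZ (L * B) (vanishes_geom g0 g1))) => k.
rewrite ger0_norm ?cabs_ge0// (iter k) cabsM cabsX.
have -> : cabs (2^-1 : C) = 2^-1.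
  by rewrite cabsV -[2 in LHS](rmorph_nat (real_complex R)) cabs_real ger0_norm.
have := HL _ _ _ (cgrowth_shift k Bc) (_ : 0 < 2 ^ k * n)%N.
rewrite muln_gt0 expn_gt0 => /(_ n0) h.
rewrite expr_div_n -exprVn mulrA [leRHS]mulrC ler_wpM2l ?exprn_ge0 ?invr_ge0//.
by rewrite -mulrA.
Qed.

End ChaosBounds.

(** * Haar coefficients of partial sums *)

Section Coefficients.
Variable R : realType.
Local Notation C := R[i].
Variables (q kap eta : R).
Hypotheses (q1 : 1 < q) (kap0 : 0 <= kap) (kap1 : kap < 1) (eta0 : 0 < eta) (eta2 : eta `^ q < 2).

Let q0 : 0 < q. Proof. exact: lt_trans ltr01 q1. Qed.

Definition coef m (g : R -> C) : C := (avg m.*2 g - avg m.*2.+1 g) / 2.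

Lemma inLq_comb (a : C) g1 g2 : inLq q g1 -> inLq q g2 -> inLq q (fun t => a * g1 t + g2 t).
Proof.
move=> [m1 f1] [m2 f2]; have m3 := cmeasurable_comb a m1 m2; split; first exact: m3.
have ma := cmeasurable_scale a m1.
apply: le_lt_trans (intpow_add_le q0 m3 ma m2 _) _ => [t _|]; first exact: ler_cabsD.
have fa : (intpow q (fun t => a * g1 t)%R < +oo)%E.
  apply: le_lt_trans (intpow_le (k := cabs a `^ q) ma m1 _ _) _; first exact: powR_ge0.
    by move=> t _; rewrite cabsM powRM ?cabs_ge0.
  by apply: lte_mul_pinfty; [rewrite lee_fin powR_ge0|by []|exact: f1].
apply: lte_mul_pinfty; [by rewrite lee_fin powR_ge0|by []|].
by apply: lte_add_pinfty; [exact: fa|exact: f2].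
Qed.

Lemma inLq_cst (a : C) : inLq q (fun=> a).
Proof.
split; first exact: cmeasurable_cst.
rewrite (@intpow_node_cst _ q 1 _ (fun=> a))//; first exact: ltry.
Qed.

Lemma inLq_fsub g1 g2 : inLq q g1 -> inLq q g2 -> inLq q (fsub g1 g2).
Proof.
move=> h1 h2; have := inLq_comb (-1) h2 h1.
by rewrite (_ : (fun t => _) = fsub g1 g2)//; apply/funext => t; rewrite mulN1r addrC.
Qed.

Lemma inLq_sum (J : eqType) (r : seq J) (a : J -> C) (G : J -> R -> C) :
  (forall j, j \in r -> inLq q (G j)) -> inLq q (fun t => \sum_(j <- r) a j * G j t).
Proof.
elim: r => [|j r IH] iG.
  rewrite (_ : (fun t => _) = fun=> 0); first exact: inLq_cst.
  by apply/funext => t; rewrite big_nil.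
rewrite (_ : (fun t => _) = (fun t => a j * G j t + \sum_(j <- r) a j * G j t)).
  by apply: inLq_comb; [apply: iG; rewrite mem_head|apply: IH => k kr; apply: iG; rewrite inE kr orbT].
by apply/funext => t; rewrite big_cons.
Qed.

Lemma inLq_psum B (a : nat -> C) c N : cgrowth kap eta B c -> inLq q (psum a (dil (chaosf c)) N).
Proof.
move=> Bc; apply: inLq_sum => n; rewrite mem_index_iota => /andP[n0 _].
by rewrite dil_chaosfE; exact: inLq_chaosf Bc n0.
Qed.

Lemma cgrowth_delta0 : cgrowth kap eta 1 (delta0 C).
Proof.
move=> k; rewrite mul1r /delta0; case: k => [|k]; first by rewrite cabs1 expr0.
by rewrite cabs0 exprn_ge0// mulr_ge0// ltW.
Qed.

(** From the window towards the root: both sides at a node are the mean of their values at the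
    children. *)
Lemma avg_ascend N (g : R -> C) (x : nat -> C) : (0 < N)%N -> cintegrable g ->
  (forall n, (N <= n < N.*2)%N -> avg n g = treeval x n) ->
  forall n, (0 < n < N.*2)%N -> avg n g = treeval x n.
Proof.
move=> N0 ig H n; have [k] := ubnP (N.*2 - n)%N; elim: k n => // k IH n nk /andP[n0 nN].
have [Nn|nN'] := leqP N n; first by apply: H; rewrite Nn.
rewrite avg_split// !IH ?double_gt0// ?treeval_double ?treeval_doubleS//; try lia.
by field.
Qed.

(** The unfinished tails of [psum_node] have mean zero over each node of the window. *)
Lemma avg_psum B (a : nat -> C) c N n : cgrowth kap eta B c -> (0 < N)%N -> (0 < n < N.*2)%N ->
  avg n (psum a (dil (chaosf c)) N) = treeval (tconv c a) n.
Proof.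
move=> Bc N0; apply: avg_ascend => //.
  exact: (inLq_cintegrable q1 (inLq_psum a N Bc)).
move=> m mN; have m0 : (0 < m)%N by case/andP : mN => h _; exact: leq_trans h.
rewrite (eq_avg (g2 := fun t => 1 * treeval (tconv c a) m +
   \sum_(i <- index_iota 1 (logn 2 m).+1) a (m %/ 2 ^ i)%N * chaosf (fun k => c (i + k)%N) (tau m t))); last first.
  by move=> t mt; rewrite (psum_node _ _ N0 mN mt) mul1r.
have ic i : cintegrable (fun t => chaosf (fun k => c (i + k)%N) (tau m t)).
  exact: (inLq_cintegrable q1 (inLq_chaosf q1 kap0 kap1 eta0 eta2 (cgrowth_shift i Bc) m0)).
rewrite avg_comb//; last 2 first.
- exact: cintegrable_cst.
- by apply: cintegrable_sum => i _; exact: ic.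
rewrite avg_cst mul1r avg_sum// big1 ?addr0// => i _.
by rewrite (avg_chaosf0 q1 kap0 kap1 eta0 eta2 (cgrowth_shift i Bc) m0) mulr0.
Qed.

Lemma coef_psum B (a : nat -> C) c N n : cgrowth kap eta B c -> (0 < n < N)%N ->
  coef n (psum a (dil (chaosf c)) N) = tconv c a n.
Proof.
move=> Bc /andP[n0 nN]; have N0 : (0 < N)%N by apply: leq_trans nN.
rewrite /coef !(avg_psum _ Bc)// ?treeval_double ?treeval_doubleS//; first by field.
  by rewrite -doubleS ?leq_double ?doubleS; lia.
by rewrite double_gt0 n0 ltn_double.
Qed.

Lemma coef_fsub n g1 g2 : (0 < n)%N -> inLq q g1 -> inLq q g2 ->
  coef n (fsub g1 g2) = coef n g1 - coef n g2.
Proof.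
move=> n0 /(inLq_cintegrable q1) i1 /(inLq_cintegrable q1) i2.
have E m : (0 < m)%N -> avg m (fsub g1 g2) = avg m g1 - avg m g2.
  move=> m0; rewrite (eq_avg (g2 := fun t => -1 * g2 t + g1 t)); last first.
    by move=> t _; rewrite mulN1r addrC.
  by rewrite avg_comb// mulN1r addrC.
by rewrite /coef !E ?double_gt0//; field.
Qed.

Lemma inLq_fin_num g : inLq q g -> intpow q g \is a fin_num.
Proof. by case=> _ fg; rewrite ge0_fin_numE// intpow_ge0. Qed.

Lemma cabs_avg_pow_le m g : (0 < m)%N -> inLq q g ->
  cabs (avg m g) `^ q <= 4 `^ q * 2 ^+ lev m * fine (intpow q g).
Proof.
move=> m0 ig; have h := avg_pow_le q1 m0 ig.
have ile : (ipow q m g <= intpow q g)%E.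
  apply: ge0_subset_integral.
  - exact: measurable_nodeI.
  - exact: measurable_I01.
  - exact: cmeasurable_pow ig.1.
  - by move=> t _; rewrite lee_fin powR_ge0.
  - exact: nodeI_sub_I01.
have h' : ((4 `^ q)%:E * ipow q m g <= (4 `^ q)%:E * intpow q g)%E.
  by apply: lee_wpmul2l; [rewrite lee_fin powR_ge0|exact: ile].
have := le_trans h h'; rewrite -{1}(fineK (inLq_fin_num ig)) -EFinM lee_fin /wt => {h h'} h.
by rewrite -mulrA mulrCA -ler_pdivrMl ?exprn_gt0.
Qed.

(** Continuity of each coefficient functional, from which uniqueness of expansions follows. *)
Lemma coef_pow_le n g : (0 < n)%N -> inLq q g -> cabs (coef n g) `^ q <=
  2 `^ q * (2 * (4 `^ q * 2 ^+ (lev n).+1)) * fine (intpow q g).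
Proof.
move=> n0 ig.
have m1 : (0 < n.*2)%N by rewrite double_gt0.
have h1 := cabs_avg_pow_le m1 ig; have h2 := @cabs_avg_pow_le n.*2.+1 g isT ig.
rewrite (lev_double n0) in h1; rewrite (lev_doubleS n0) in h2.
apply: (@le_trans _ _ ((cabs (avg n.*2 g) + cabs (avg n.*2.+1 g)) `^ q)).
  apply: ge0_ler_powR; rewrite ?nnegrE ?addr_ge0 ?cabs_ge0 ?(ltW q0)//.
  rewrite /coef cabsM; apply: (@le_trans _ _ (cabs (avg n.*2 g - avg n.*2.+1 g))).
    rewrite ler_piMr ?cabs_ge0// cabsV -[2 in leLHS](rmorph_nat (real_complex R)) cabs_real ger0_norm.
      by rewrite invf_le1 ?ltr0n ?ler1n.
    by rewrite ler0n.
  exact: ler_cabsB.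
apply: le_trans (powRD_le q0 (cabs_ge0 _) (cabs_ge0 _)) _.
rewrite -[leRHS]mulrA; apply: ler_wpM2l; first exact: powR_ge0.
have -> : 2 * (4 `^ q * 2 ^+ (lev n).+1) * fine (intpow q g) =
  4 `^ q * 2 ^+ (lev n).+1 * fine (intpow q g) + 4 `^ q * 2 ^+ (lev n).+1 * fine (intpow q g) by ring.
exact: lerD h1 h2.
Qed.

End Coefficients.

(** * Convergence of the expansions *)

Lemma uphalf_window N : (1 < N)%N ->
  [/\ 0 < uphalf N, uphalf N <= N, N <= (uphalf N).*2, (uphalf N).*2 = odd N + N & N < N.*2]%N.
Proof. by move=> N1; split; lia. Qed.

Section Remainder.
Variable R : realType.
Local Notation C := R[i].
Local Notation mu := (@lebesgue_measure R).
Variables (q kap eta : R).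
Hypotheses (q1 : 1 < q) (kap0 : 0 <= kap) (kap1 : kap < 1) (eta0 : 0 < eta) (eta2 : eta `^ q < 2).

Let q0 : 0 < q. Proof. exact: lt_trans ltr01 q1. Qed.
Let th := eta `^ q.
Let th0 : 0 <= th. Proof. exact: powR_ge0. Qed.
Let kap1' : 0 < 1 - kap. Proof. by rewrite subr_gt0. Qed.
Let th2' : 0 < 1 - th / 2. Proof. by rewrite subr_gt0 ltr_pdivrMr ?mul1r. Qed.

(** Collects the coefficients along the spine through [n]; up to a constant, [wt n] times it bounds
    the integral of the q-th power of the remainder over [nodeI n]. *)
Definition potential (b : nat -> C) n : R :=
  \sum_(s < (logn 2 n).+1) th ^+ s * cabs (b (n %/ 2 ^ s)%N) `^ q.

Lemma potential_ge0 b n : 0 <= potential b n.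
Proof. by apply: sumr_ge0 => s _; rewrite mulr_ge0 ?exprn_ge0 ?powR_ge0. Qed.

Lemma potential_bound b n s : (s <= logn 2 n)%N ->
  eta ^+ s * cabs (b (n %/ 2 ^ s)%N) <= potential b n `^ q^-1.
Proof.
move=> sn; apply: (le_powR_inv q1).
- by rewrite mulr_ge0 ?cabs_ge0 ?exprn_ge0// ltW.
- exact: potential_ge0.
rewrite powRM ?cabs_ge0 ?exprn_ge0 ?(ltW eta0)// (powR_expn _ _ (ltW eta0)).
rewrite /potential (bigD1 (Ordinal (sn : s < (logn 2 n).+1)%N))//= lerDl.
by apply: sumr_ge0 => j _; rewrite mulr_ge0 ?exprn_ge0 ?powR_ge0.
Qed.

(** As c * (d * b) = b, the tree values cancel and only the tails of [psum_node] remain. The tail of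
    index i carries (kap eta)^i: its [eta]^i is absorbed by the coefficient through [potential], and
    its [kap]^i sums. *)
Lemma remainder_node B (c d b : nat -> C) N n t :
  cgrowth kap eta B c -> cgrowth kap eta B d -> (forall k, cprod c d k = delta0 C k) ->
  (0 < N)%N -> (N <= n < N.*2)%N -> nodeI n t ->
  ((cabs (psum (tconv d b) (dil (chaosf c)) N t - psum b haar_sys N t) `^ q)%:E <=
   ((B ^+ 2 / (1 - kap) ^+ 2) `^ q * (1 - kap)^-1 `^ q * potential b n)%:E * majorant q eta n t)%E.
Proof.
move=> Bc Bd cd N0 nN nt; have B0 := cgrowth_ge0 Bc.
have n0 : (0 < n)%N by case/andP : nN => h _; exact: leq_trans h.
set a := tconv d b.
rewrite (psum_node _ _ N0 nN nt) (psum_haar_node _ N0 nN nt).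
have -> : treeval (tconv c a) n = treeval b n.
  by apply: eq_treeval => // m /andP[m0 _]; exact: tconvK.
rewrite addrAC subrr add0r.
pose K := (Num.truncn (tau n t)^-1).+1.
pose Y := chaos_major kap eta n K t; pose S := potential b n `^ q^-1.
have Y0 : 0 <= Y by exact: chaos_major_ge0.
have S0 : 0 <= S by exact: powR_ge0.
have aS i : (i <= logn 2 n)%N -> eta ^+ i * cabs (a (n %/ 2 ^ i)%N) <= B * S / (1 - kap).
  move=> iv; apply: (@le_trans _ _ (\sum_(j < (logn 2 (n %/ 2 ^ i)).+1) kap ^+ j * (B * S))).
    apply: (@le_trans _ _ (eta ^+ i * \sum_(j < (logn 2 (n %/ 2 ^ i)).+1) B * (kap * eta) ^+ j * cabs (b (n %/ 2 ^ i %/ 2 ^ j)%N))).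
      rewrite ler_wpM2l ?exprn_ge0 ?(ltW eta0)//; apply: le_trans (cabs_sum _ _ _) _.
      by apply: ler_sum => j _; rewrite cabsM ler_wpM2r ?cabs_ge0.
    rewrite mulr_sumr; apply: ler_sum => j _.
    have ij : (i + j <= logn 2 n)%N.
      apply: (@leq_trans (i + logn 2 (n %/ 2 ^ i))); first by rewrite leq_add2l -ltnS.
      by rewrite (logn2_div n0 iv) subnKC.
    rewrite -divnMA -expnD exprMn.
    have -> : eta ^+ i * (B * (kap ^+ j * eta ^+ j) * cabs (b (n %/ 2 ^ (i + j))%N)) =
      kap ^+ j * (B * (eta ^+ (i + j) * cabs (b (n %/ 2 ^ (i + j))%N))) by rewrite exprD; ring.
    by rewrite !ler_wpM2l ?exprn_ge0// potential_bound.
  rewrite -mulr_suml mulrC ler_wpM2l ?mulr_ge0//.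
  exact: geom_sum_le.
have main : cabs (\sum_(1 <= i < (logn 2 n).+1) a (n %/ 2 ^ i)%N * chaosf (fun k => c (i + k)%N) (tau n t)) <=
    B ^+ 2 / (1 - kap) ^+ 2 * (S * Y).
  apply: le_trans (cabs_sum _ _ _) _.
  apply: (@le_trans _ _ (\sum_(1 <= i < (logn 2 n).+1) kap ^+ i * (B ^+ 2 / (1 - kap) * (S * Y)))).
    rewrite big_nat [leRHS]big_nat; apply: ler_sum => i /andP[_ iv].
    rewrite cabsM.
    have h1 := cabs_chaosf_le (cgrowth_shift i Bc) n0 (leqnn K).
    apply: le_trans (ler_wpM2l (cabs_ge0 _) h1) _.
    rewrite -/Y exprMn.
    have -> : cabs (a (n %/ 2 ^ i)%N) * (B * (kap ^+ i * eta ^+ i) * Y) =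
      kap ^+ i * (B * Y * (eta ^+ i * cabs (a (n %/ 2 ^ i)%N))) by ring.
    rewrite ler_wpM2l ?exprn_ge0//.
    have -> : B ^+ 2 / (1 - kap) * (S * Y) = B * Y * (B * S / (1 - kap)) by ring.
    by rewrite ler_wpM2l ?mulr_ge0// aS.
  rewrite -mulr_suml.
  have -> : B ^+ 2 / (1 - kap) ^+ 2 * (S * Y) = (1 - kap)^-1 * (B ^+ 2 / (1 - kap) * (S * Y)).
    by field; rewrite gt_eqF.
  rewrite ler_wpM2r ?mulr_ge0 ?exprn_ge0 ?invr_ge0 ?(ltW kap1')//.
  apply: le_trans (geom_sum_le (logn 2 n).+1 kap0 kap1).
  by rewrite -(big_mkord xpredT (fun i => kap ^+ i)) [leRHS]big_ltn// lerDr exprn_ge0.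
have P0 := potential_ge0 b n.
have BB : 0 <= B ^+ 2 / (1 - kap) ^+ 2 by rewrite divr_ge0 ?exprn_ge0 ?(ltW kap1').
apply: (@le_trans _ _ (((B ^+ 2 / (1 - kap) ^+ 2) `^ q * potential b n)%:E * (Y `^ q)%:E)%E).
  rewrite -EFinM lee_fin -[potential b n](powR_q_inv q1)// -/S -mulrA -(powRM _ S0 Y0) -powRM ?(mulr_ge0 S0 Y0)//.
  by apply: ge0_ler_powR; rewrite ?nnegrE ?cabs_ge0 ?(mulr_ge0 BB (mulr_ge0 S0 Y0)) ?(ltW q0).
have -> : ((B ^+ 2 / (1 - kap) ^+ 2) `^ q * (1 - kap)^-1 `^ q * potential b n)%:E =
  (((B ^+ 2 / (1 - kap) ^+ 2) `^ q * potential b n)%:E * ((1 - kap)^-1 `^ q)%:E)%E.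
  by rewrite -EFinM; congr EFin; ring.
rewrite -muleA; apply: lee_wpmul2l; first by rewrite lee_fin mulr_ge0 ?powR_ge0.
exact: chaos_major_pow.
Qed.

Lemma remainder_bound B (c d : nat -> C) :
  cgrowth kap eta B c -> cgrowth kap eta B d -> (forall k, cprod c d k = delta0 C k) ->
  exists2 D : R, 0 <= D & forall b N, (0 < N)%N ->
    (intpow q (fsub (psum (tconv d b) (dil (chaosf c)) N) (psum b haar_sys N)) <=
     (D * tmean N (potential b))%:E)%E.
Proof.
move=> Bc Bd cd; pose E := (B ^+ 2 / (1 - kap) ^+ 2) `^ q * (1 - kap)^-1 `^ q.
have E0 : 0 <= E by rewrite mulr_ge0 ?powR_ge0.
exists (E * (1 - th / 2)^-1) => [|b N N0]; first by rewrite mulr_ge0 ?invr_ge0 ?(ltW th2').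
have mf : cmeasurable (fsub (psum (tconv d b) (dil (chaosf c)) N) (psum b haar_sys N)).
  by apply: cmeasurable_fsub; rewrite ?haar_sysE; exact: cmeasurable_psum.
rewrite (intpow_window q N0 mf) /tmean mulr_sumr -sumEFin big_nat [leRHS]big_nat.
apply: lee_sum => n nN; have n0 : (0 < n)%N by case/andP : nN => h _; exact: leq_trans h.
have P0 := potential_ge0 b n.
have h : (ipow q n (fsub (psum (tconv d b) (dil (chaosf c)) N) (psum b haar_sys N)) <=
    \int[mu]_(t in nodeI n) ((E * potential b n)%:E * majorant q eta n t))%E.
  apply: ge0_le_integral.
  - exact: measurable_nodeI.
  - by move=> t _; rewrite lee_fin powR_ge0.
  - apply: measurable_funS (cmeasurable_pow q mf); first exact: measurable_I01.
    exact: nodeI_sub_I01.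
  - by apply: measurable_funeM; apply: measurable_majorant; exact: measurable_nodeI.
  - by move=> t nt; exact: (remainder_node _ Bc Bd cd N0 nN nt).
apply: le_trans h _; rewrite ge0_integralZl_EFin; last 4 first.
- exact: measurable_nodeI.
- by move=> t _; exact: majorant_ge0.
- by apply: measurable_majorant; exact: measurable_nodeI.
- by rewrite mulr_ge0.
have -> : (E / (1 - th / 2) * (wt R n * potential b n))%:E =
  ((E * potential b n)%:E * (wt R n / (1 - th / 2))%:E)%E by rewrite -EFinM; congr EFin; ring.
apply: lee_wpmul2l; first by rewrite lee_fin mulr_ge0.
by apply: int_majorant => //; exact: measurable_nodeI.
Qed.

Lemma potential_double b n : (0 < n)%N ->
  potential b n.*2 = cabs (b n.*2) `^ q + th * potential b n.
Proof.
move=> n0; rewrite /potential logn2_double// big_ord_recl /= mul1r divn1; congr (_ + _).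
rewrite mulr_sumr; apply: eq_bigr => i _.
by rewrite /bump add1n exprS -mulrA expnS divnMA divn2 doubleK.
Qed.

Lemma potential_doubleS b n : potential b n.*2.+1 = cabs (b n.*2.+1) `^ q.
Proof. by rewrite /potential logn2_doubleS big_ord1 mul1r divn1. Qed.

(** An odd node carries only its own term; an even one adds [th] times the potential of its parent,
    whose weight is twice as large. The parents lie in the window of [uphalf N]. *)
Lemma tmean_potential_rec b N : (1 < N)%N ->
  tmean N (potential b) <= tmean N (fun n => cabs (b n) `^ q) + th / 2 * tmean (uphalf N) (potential b).
Proof.
move=> N1; have [M0 MN NM EM NN] := uphalf_window N1; pose F n : R := if odd n then 0 else wt R n * (th * potential b n./2).
have E n : (0 < n)%N -> wt R n * potential b n = wt R n * cabs (b n) `^ q + F n.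
  move=> n0; rewrite /F; case: ifP => on.
    have En : n = n./2.*2.+1 by rewrite -{1}(odd_double_half n) on add1n.
    by rewrite addr0; congr (_ * _); rewrite En potential_doubleS.
  have En : n = n./2.*2 by rewrite -{1}(odd_double_half n) on add0n.
  have h : (0 < n./2)%N by rewrite -double_gt0 -En.
  by rewrite -mulrDr; congr (_ * _); rewrite {1 2}En potential_double.
have -> : tmean N (potential b) = tmean N (fun n => cabs (b n) `^ q) + \sum_(N <= n < N.*2) F n.
  rewrite /tmean -big_split /= big_nat [RHS]big_nat; apply: eq_bigr => n /andP[h _].
  by rewrite E//; apply: leq_trans h; exact: ltnW.
move: (uphalf N) => M in M0 MN NM EM *; rewrite lerD2l.
have F0 n : 0 <= F n by rewrite /F; case: ifP => // _; rewrite !mulr_ge0 ?wt_ge0 ?potential_ge0.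
(* If [N] is odd, the range loses its first index [N], where [F] vanishes. *)
have -> : \sum_(N <= n < N.*2) F n = \sum_(M.*2 <= n < N.*2) F n.
  have [on|on] := boolP (odd N).
    by rewrite (big_ltn NN) {1}/F on add0r EM on add1n.
  by rewrite EM (negPf on).
rewrite sum_double.
apply: (@le_trans _ _ (\sum_(M <= n < M.*2) (F n.*2 + F n.*2.+1))).
  rewrite [leRHS](big_cat_nat MN NM)/=.
  by rewrite lerDl sumr_ge0// => n _; rewrite addr_ge0.
rewrite /tmean mulr_sumr big_nat [leRHS]big_nat; apply: ler_sum => n /andP[h _].
have n0 : (0 < n)%N by exact: leq_trans h.
rewrite /F /= odd_double /= addr0 doubleK wt_double//.
by rewrite le_eqVlt; apply/orP; left; apply/eqP; ring.
Qed.

End Remainder.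

Section VanishingRecursion.
Variable R : realType.

(** The recursion first bounds [u] by strong induction; iterated j times it then leaves e / 2 + k^j
    U. *)
Lemma vanishes_rec (u v : nat -> R) (k : R) : (forall n, 0 <= u n) -> 0 <= k -> k < 1 ->
  (forall n, (1 < n)%N -> u n <= v n + k * u (uphalf n)) -> vanishes v -> vanishes u.
Proof.
move=> u0 k0 k1 uv v0; have k1' : 0 < 1 - k by rewrite subr_gt0.
have [N0 HN0] := v0 1 ltr01.
pose V := 1 + \sum_(i < N0) `|v i|.
have V0 : 0 <= V by rewrite addr_ge0// sumr_ge0.
have vV n : v n <= V.
  apply: le_trans (ler_norm _) _; have [Nn|nN] := leqP N0 n.
    by apply: le_trans (HN0 n Nn) _; rewrite lerDl sumr_ge0.
  by rewrite /V (bigD1 (Ordinal nN))//= addrCA lerDl addr_ge0// sumr_ge0.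
(* Covers the two starting values and satisfies V + k U <= U. *)
pose U := u 0%N + u 1%N + V / (1 - k).
have U0 : 0 <= U by rewrite !addr_ge0 ?divr_ge0 ?(ltW k1').
have uU n : u n <= U.
  have [m] := ubnP n; elim: m n => // m IH [|[|n]] nm.
  - by rewrite /U -addrA lerDl addr_ge0 ?divr_ge0 ?(ltW k1').
  - by rewrite /U addrAC lerDr addr_ge0 ?divr_ge0 ?(ltW k1').
  apply: le_trans (uv n.+2 isT) _.
  have h : u (uphalf n.+2) <= U by apply: IH; lia.
  have VU : V <= (1 - k) * U.
    rewrite /U mulrDr [X in _ + X]mulrC divfK ?gt_eqF// lerDr mulr_ge0 ?(ltW k1')//.
    exact: addr_ge0.
  have : k * u (uphalf n.+2) <= k * U by rewrite ler_wpM2l.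
  by have := vV n.+2; lra.
move=> e e0; have e2 : 0 < e / 2 * (1 - k) by rewrite mulr_gt0 ?divr_gt0.
have [N1 HN1] := v0 _ e2.
pose N := maxn N1 2.
have step j n : (2 ^ j * N <= n)%N -> u n <= e / 2 + k ^+ j * U.
  elim: j n => [|j IH] n; first by rewrite mul1r => _; apply: le_trans (uU n) _; rewrite lerDr ltW// divr_gt0.
  move=> h; have nN : (N <= n)%N by apply: leq_trans h; rewrite leq_pmull ?expn_gt0.
  have n1 : (1 < n)%N by apply: leq_trans nN; rewrite leq_maxr.
  have := uv n n1; have := HN1 n (leq_trans (leq_maxl _ _) nN).
  move=> /(le_trans (ler_norm _)) hv hu.
  have hj : u (uphalf n) <= e / 2 + k ^+ j * U.
    apply: IH; move: h; rewrite expnS -mulnA; set x := (2 ^ j * N)%N; lia.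
  have : k * u (uphalf n) <= k * (e / 2 + k ^+ j * U) by rewrite ler_wpM2l.
  by rewrite exprS -mulrA; move: (k ^+ j * U) => w; lra.
have [j Hj] := vanishesZ U (vanishes_geom k0 k1) (divr_gt0 e0 (ltr0n R 2)).
exists (2 ^ j * N)%N => n /step h; rewrite ger0_norm//.
have := Hj j (leqnn j); rewrite ger0_norm ?mulr_ge0 ?exprn_ge0// mulrC.
by move: (k ^+ j * U) h => w; lra.
Qed.

End VanishingRecursion.

(** * Haar expansions converge in L^q *)

Section HaarConvergence.
Variable R : realType.
Local Notation C := R[i].
Local Notation mu := (@lebesgue_measure R).
Local Notation I := (@I01 R).
Variables (q : R).
Hypotheses (q1 : 1 < q).

Let q0 : 0 < q. Proof. exact: lt_trans ltr01 q1. Qed.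

Definition evanishes (U : nat -> \bar R) :=
  forall e : R, 0 < e -> exists N, forall n, (N <= n)%N -> (U n <= e%:E)%E.

Lemma evanishes_cvg (U : nat -> \bar R) : (forall n, (0 <= U n)%E) ->
  evanishes U <-> U @ \oo --> 0%E.
Proof.
move=> U0; split=> [H|/fine_cvgP[[N _ fU] /vanishesP H] e e0].
  apply/fine_cvgP; split.
    have [N HN] := H 1 ltr01; exists N => // n /= Nn.
    by rewrite ge0_fin_numE//; apply: le_lt_trans (HN n Nn) _; exact: ltry.
  apply/vanishesP => e /H[N HN]; exists N => n Nn.
  have h := HN n Nn; rewrite /= ger0_norm ?fine_ge0// -lee_fin fineK//.
  by rewrite ge0_fin_numE//; apply: le_lt_trans h _; exact: ltry.
have [M HM] := H e e0; exists (maxn N M) => n; rewrite geq_max => /andP[Nn Mn].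
have := HM n Mn; rewrite /= ger0_norm ?fine_ge0// -lee_fin fineK//.
exact: fU.
Qed.

Lemma dominated_evanishes (F : nat -> R -> R) (M : R -> R) :
  (forall n, measurable_fun I (F n)) -> mu.-integrable I (EFin \o M) ->
  (forall n t, I t -> 0 <= F n t <= M t) -> (forall t, I t -> vanishes (fun n => F n t)) ->
  evanishes (fun n => \int[mu]_(t in I) (F n t)%:E)%E.
Proof.
move=> mF iM FM F0.
have Fn0 n t : I t -> (0 <= (F n t)%:E)%E.
  by move=> It; rewrite lee_fin; have /andP[] := FM n t It.
apply/evanishes_cvg; first by move=> n; apply: integral_ge0 => t It; exact: Fn0.
rewrite (_ : 0%E = \int[mu]_(t in I) (cst 0%E t))%E; last by rewrite integral0.
apply: (@dominated_cvg _ _ _ mu I _ (fun n t => (F n t)%:E) (cst 0%E) (EFin \o M)).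
- exact: measurable_I01.
- by move=> n; apply/measurable_EFinP; exact: mF.
- move=> t It; apply: cvg_EFin; first by apply: nearW.
  by apply/vanishesP; exact: F0.
- by [].
- exact: iM.
- by move=> n t It; rewrite gee0_abs ?Fn0// lee_fin; have /andP[] := FM n t It.
Qed.

Lemma vanishes_powR (u : nat -> R) : (forall n, 0 <= u n) -> vanishes u ->
  vanishes (fun n => u n `^ q).
Proof.
move=> u0 vu e e0; have h : 0 < e `^ q^-1 by rewrite powR_gt0.
have [N HN] := vu _ h; exists N => n Nn.
rewrite ger0_norm ?powR_ge0// -(powR_q_inv q1 (ltW e0)).
apply: ge0_ler_powR; rewrite ?nnegrE ?u0 ?powR_ge0 ?(ltW q0)//.
by have := HN n Nn; rewrite ger0_norm.
Qed.

Lemma trunc_approx (g : R -> C) (e : R) : inLq q g -> 0 < e ->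
  exists A : R, exists2 gA : R -> C, 0 <= A & [/\ cmeasurable gA, forall t, cabs (gA t) <= A &
    (intpow q (fsub g gA) <= e%:E)%E].
Proof.
move=> ig e0; have [[mr mi] fg] := ig.
have mc := cmeasurable_cabs ig.1.
pose tr (n : nat) t : C := (\1_(I `&` [set t | cabs (g t) <= n%:R]) t)%:C%C * g t.
have mS n : measurable (I `&` [set t | cabs (g t) <= n%:R]).
  have := mc (@measurable_I01 R) `]-oo, n%:R]%classic (measurable_itv _).
  by congr measurable; apply/seteqP; split => t /=; rewrite in_itv.
have mtr n : cmeasurable (tr n).
  have m1 : measurable_fun I (\1_(I `&` [set t | cabs (g t) <= n%:R]) : R -> R).
    by apply: measurable_indic; exact: mS.
  split.
    rewrite (_ : (fun t => _) = (fun t => \1_(I `&` [set t | cabs (g t) <= n%:R]) t * complex.Re (g t))).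
      exact: measurable_funM.
    by apply/funext => t; rewrite /tr; case: (g t) => a b /=; rewrite mul0r subr0.
  rewrite (_ : (fun t => _) = (fun t => \1_(I `&` [set t | cabs (g t) <= n%:R]) t * complex.Im (g t))).
    exact: measurable_funM.
  by apply/funext => t; rewrite /tr; case: (g t) => a b /=; rewrite mul0r addr0.
have H : evanishes (fun n => intpow q (fsub g (tr n))).
  apply: (dominated_evanishes _ (integrable_pow ig)).
  - move=> n; apply/measurable_EFinP; apply: cmeasurable_pow.
    exact: cmeasurable_fsub ig.1 (mtr n).
  - move=> n t It; rewrite powR_ge0 /=; apply: ge0_ler_powR; rewrite ?nnegrE ?cabs_ge0 ?(ltW q0)//.
    rewrite /fsub /tr indicE; case: (_ \in _); first by rewrite mul1r subrr cabs0 cabs_ge0.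
    by rewrite mul0r subr0.
  - move=> t It; apply: vanishes_powR; first by move=> n; exact: cabs_ge0.
    move=> d d0; exists (Num.truncn (cabs (g t))).+1 => n Nn.
    rewrite /fsub /tr indicE mem_set; first by rewrite mul1r subrr cabs0 normr0 ltW.
    split => //=; apply: ltW; apply: lt_le_trans (Num.Theory.truncnS_gt _) _.
    by rewrite ler_nat.
have [N HN] := H e e0.
exists N%:R, (tr N); first exact: ler0n.
split; [exact: mtr| |exact: HN (leqnn N)].
move=> t; rewrite /tr indicE; case: (boolP (t \in _)) => [|_]; last by rewrite mul0r cabs0 ler0n.
by rewrite inE => -[_ h]; rewrite mul1r.
Qed.

(** Truncation to [-A, A]; written with absolute values it is visibly continuous and 1-Lipschitz. *)
Definition clip (A x : R) : R := (`|x + A| - `|x - A|) / 2.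

Lemma clip_lip A x y : `|clip A x - clip A y| <= `|x - y|.
Proof.
have h1 := ler_dist_dist (x + A) (y + A).
have h2 := ler_dist_dist (x - A) (y - A).
move: h1 h2; rewrite (_ : x + A - (y + A) = x - y); last ring.
rewrite (_ : x - A - (y - A) = x - y); last ring.
rewrite /clip; move: `|x + A| `|y + A| `|x - A| `|y - A| => a b c d.
rewrite !ler_norml => /andP[h1 h2] /andP[h3 h4].
by apply/andP; split; lra.
Qed.

Lemma clip_id A x : `|x| <= A -> clip A x = x.
Proof.
rewrite ler_norml => /andP[h1 h2]; rewrite /clip ger0_norm; last lra.
by rewrite ler0_norm; lra.
Qed.

Lemma clip_bound A x : 0 <= A -> `|clip A x| <= A.
Proof.
move=> A0; have h := ler_dist_dist (x + A) (x - A).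
move: h; rewrite (_ : x + A - (x - A) = 2 * A); last ring.
rewrite (@ger0_norm _ (2 * A)) ?mulr_ge0// /clip.
move: `|x + A| `|x - A| => a b; rewrite !ler_norml => /andP[h1 h2].
by apply/andP; split; lra.
Qed.

Lemma clip_continuous A (h : R -> R) : continuous h -> continuous (fun t => clip A (h t)).
Proof.
move=> ch t; rewrite /clip; apply: cvgMl; apply: cvgB; apply: cvg_norm.
  by apply: cvgD; [exact: ch|exact: cvg_cst].
by apply: cvgB; [exact: ch|exact: cvg_cst].
Qed.

Lemma bounded_integrable (u : R -> R) A : measurable_fun I u -> (forall t, `|u t| <= A) ->
  mu.-integrable I (EFin \o u).
Proof.
move=> mu_ uA; have h := (cintegrable_cst A%:C%C).1.
apply: le_integrable h; [exact: measurable_I01|exact/measurable_EFinP|].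
by move=> t _ /=; rewrite lee_fin (le_trans (uA t))// ler_norm.
Qed.

(** Density of continuous functions in L^1; clipping restores the bound [A] and does not increase
    the error. *)
Lemma continuous_approx_real (u : R -> R) (A e : R) : measurable_fun I u ->
  (forall t, `|u t| <= A) -> 0 <= A -> 0 < e ->
  exists h : R -> R, [/\ continuous h, forall t, `|h t| <= A &
    (\int[mu]_(t in I) (`|u t - h t|)%:E <= e%:E)%E].
Proof.
move=> mu_ uA A0 e0; have iu := bounded_integrable mu_ uA.
have mI : (mu I < +oo)%E by rewrite -nodeI1 [X in (X < _)%E]mu_nodeI ltry.
have [g [cg ig Hg]] := approximation_continuous_integrable (@measurable_I01 R) mI iu.
have [|N HN] := (proj2 (evanishes_cvg (U := fun n => (\int[mu]_(z in I) `|(u z - g n z)%:E|)%E) _) Hg) e e0.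
  by move=> n; apply: integral_ge0.
have mg : measurable_fun I (g N) by have /integrableP[/measurable_EFinP] := ig N.
exists (fun t => clip A (g N t)); split.
- exact: clip_continuous.
- by move=> t; exact: clip_bound.
apply: le_trans (HN N (leqnn N)).
have mc : measurable_fun I (fun t => clip A (g N t)).
  apply: measurable_funTS; apply: continuous_measurable_fun; exact: clip_continuous.
apply: ge0_le_integral.
- exact: measurable_I01.
- by move=> t _; rewrite lee_fin.
- by apply/measurable_EFinP; apply: measurableT_comp => //; apply: measurable_funB.
- by apply: measurableT_comp => //; apply/measurable_EFinP; apply: measurable_funB.
move=> t _; rewrite lee_fin -{1}(clip_id (uA t)); exact: clip_lip.
Qed.

Lemma continuous_approx (g : R -> C) (A e : R) : cmeasurable g -> (forall t, cabs (g t) <= A) ->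
  0 < A -> 0 < e ->
  exists f : R -> C, [/\ continuous (fun t => complex.Re (f t)), continuous (fun t => complex.Im (f t)),
    forall t, cabs (f t) <= 2 * A & (intpow q (fsub g f) <= e%:E)%E].
Proof.
move=> [mr mi] gA A0 e0.
(* The difference is at most 2A + 2A, so its q-th power is at most (4A)^(q-1) times itself: L^1
   approximation suffices. *)
pose K := (4 * A) `^ (q - 1); have K0 : 0 < K by apply: powR_gt0; rewrite mulr_gt0.
have eK : 0 < e / (2 * K) by rewrite divr_gt0 ?mulr_gt0.
have rA t : `|complex.Re (g t)| <= A by exact: le_trans (ler_Re_cabs _) (gA t).
have iA t : `|complex.Im (g t)| <= A by exact: le_trans (ler_Im_cabs _) (gA t).
have [h [ch hA Hh]] := continuous_approx_real mr rA (ltW A0) eK.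
have [k [ck kA Hk]] := continuous_approx_real mi iA (ltW A0) eK.
exists (fun t => (h t +i* k t)%C); split => //.
  by move=> t; apply: le_trans (cabs_le_ReIm _) _; have := hA t; have := kA t; rewrite /=; lra.
have mh : measurable_fun I h by apply: measurable_funTS; apply: continuous_measurable_fun; exact: ch.
have mk : measurable_fun I k by apply: measurable_funTS; apply: continuous_measurable_fun; exact: ck.
have m1 : measurable_fun I (fun t => (`|complex.Re (g t) - h t|)%:E).
  by apply/measurable_EFinP; apply: measurableT_comp => //; apply: measurable_funB.
have m2 : measurable_fun I (fun t => (`|complex.Im (g t) - k t|)%:E).
  by apply/measurable_EFinP; apply: measurableT_comp => //; apply: measurable_funB.
have H : (intpow q (fsub g (fun t => (h t +i* k t)%C)) <=
    \int[mu]_(t in I) (K%:E * ((`|complex.Re (g t) - h t|)%:E + (`|complex.Im (g t) - k t|)%:E)))%E.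
  apply: ge0_le_integral.
  - exact: measurable_I01.
  - by move=> t _; rewrite lee_fin powR_ge0.
  - by apply: cmeasurable_pow; apply: cmeasurable_fsub; split.
  - by apply: measurable_funeM; apply: emeasurable_funD.
  move=> t _; rewrite -EFinD -EFinM lee_fin.
  set x := cabs _; set D := `|_| + `|_|.
  have xD : x <= D by apply: le_trans (cabs_le_ReIm _) _; rewrite /fsub ReD ImD ReN ImN.
  have x0 : 0 <= x by exact: cabs_ge0.
  have D4 : D <= 4 * A.
    have := ler_normB (complex.Re (g t)) (h t); have := ler_normB (complex.Im (g t)) (k t).
    by have := rA t; have := iA t; have := hA t; have := kA t; rewrite /D; lra.
  have [->|xn0] := eqVneq x 0.
    by rewrite powR0 ?gt_eqF// mulr_ge0 ?(ltW K0) ?addr_ge0.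
  have -> : x `^ q = x `^ (q - 1) * x.
    rewrite -[X in _ * X](powRr1 x0) -powRD ?subrK//.
    by apply/implyP.
  apply: ler_pM; rewrite ?powR_ge0//.
  apply: ge0_ler_powR; rewrite ?nnegrE ?mulr_ge0 ?(ltW A0)//; last exact: le_trans D4.
  by rewrite subr_ge0 ltW.
apply: le_trans H _; rewrite ge0_integralZl_EFin; last 4 first.
- exact: measurable_I01.
- by move=> t _; rewrite adde_ge0// lee_fin.
- exact: emeasurable_funD.
- exact: ltW.
rewrite ge0_integralD; last 5 first.
- exact: measurable_I01.
- by move=> t _; rewrite lee_fin.
- exact: m1.
- by move=> t _; rewrite lee_fin.
- exact: m2.
have -> : e%:E = (K%:E * ((e / (2 * K))%:E + (e / (2 * K))%:E))%E.
  by rewrite -EFinD -EFinM; congr EFin; field; rewrite gt_eqF.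
apply: lee_wpmul2l; first by rewrite lee_fin ltW.
exact: leeD Hh Hk.
Qed.

(** The conditional expectation of g on the partition given by the window of [N]. *)
Definition happrox N (g : R -> C) : R -> C :=
  fun t => avg 1 g + psum (fun m => coef m g) haar_sys N t.

Lemma happrox_node N g n t : cintegrable g -> (0 < N)%N -> (N <= n < N.*2)%N -> nodeI n t ->
  happrox N g t = avg n g.
Proof.
move=> ig N0 nN nt; have n0 : (0 < n)%N by case/andP : nN => h _; exact: leq_trans h.
by rewrite /happrox (psum_haar_node _ N0 nN nt) (avg_treeval n0 ig).
Qed.

Lemma cmeasurable_happrox N g : cmeasurable (happrox N g).
Proof.
apply: cmeasurable_add; first exact: cmeasurable_cst.
by rewrite haar_sysE; exact: cmeasurable_psum.
Qed.

Lemma ravg_near n (u : R -> R) a e : (0 < n)%N -> mu.-integrable I (EFin \o u) ->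
  (forall t, nodeI n t -> `|u t - a| <= e) -> `|ravg n u - a| <= e.
Proof.
move=> n0 iu H.
have le u1 u2 : mu.-integrable I (EFin \o u1) -> mu.-integrable I (EFin \o u2) ->
    (forall t, nodeI n t -> u1 t <= u2 t) -> ravg n u1 <= ravg n u2.
  move=> /(integrable_node n0) i1 /(integrable_node n0) i2 u12.
  rewrite /ravg ler_wpM2l ?exprn_ge0//; apply: le_Rintegral => //.
  exact: measurable_nodeI.
have ic (k : R) : mu.-integrable I (EFin \o (fun=> k)) by exact: (cintegrable_cst k%:C%C).1.
have h1 : ravg n u <= a + e.
  rewrite -(ravg_cst n (a + e)); apply: le => // t /H; rewrite ler_norml => /andP[_]; lra.
have h2 : a - e <= ravg n u.
  rewrite -(ravg_cst n (a - e)); apply: le => // t /H; rewrite ler_norml => /andP[]; lra.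
by rewrite ler_norml; apply/andP; split; lra.
Qed.

Lemma nodeI_diam N n (s t : R) : (0 < N)%N -> (N <= n)%N -> nodeI n s -> nodeI n t ->
  `|s - t| * N%:R <= 2.
Proof.
move=> N0 Nn; rewrite /nodeI /tau /= => hs ht.
have n0 : (0 < n)%N by exact: leq_trans Nn.
have two0 : 0 < 2 ^+ lev n :> R by rewrite exprn_gt0.
have h : `|s - t| * 2 ^+ lev n <= 1.
  rewrite -[X in _ * X](ger0_norm (ltW two0)) -normrM ler_norml mulrBl.
  by move: hs ht; rewrite ![_ ^+ _ * _]mulrC => hs ht; apply/andP; split; lra.
have N2 : N%:R <= 2 ^+ lev n * 2 :> R.
  have /andP[_ h2] := lev_bounds n0.
  by rewrite -exprSr -natrX ler_nat; apply: leq_trans Nn (ltnW h2).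
apply: (@le_trans _ _ (`|s - t| * (2 ^+ lev n * 2))); first by rewrite ler_wpM2l.
by rewrite mulrA; lra.
Qed.

(** Dominated convergence: the nodes around t shrink to it, and |f| + 2A <= 3A. *)
Lemma continuous_happrox (f : R -> C) (A : R) : continuous (fun t => complex.Re (f t)) ->
  continuous (fun t => complex.Im (f t)) -> (forall t, cabs (f t) <= A) ->
  evanishes (fun N => intpow q (fsub f (happrox N.+1 f))).
Proof.
move=> cr ci fA.
have A0 : 0 <= A := le_trans (cabs_ge0 _) (fA 0).
have mr : measurable_fun I (fun t => complex.Re (f t)) by apply: measurable_funTS; apply: continuous_measurable_fun; exact: cr.
have mi : measurable_fun I (fun t => complex.Im (f t)) by apply: measurable_funTS; apply: continuous_measurable_fun; exact: ci.
have rA t : `|complex.Re (f t)| <= A by exact: le_trans (ler_Re_cabs _) (fA t).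
have iA t : `|complex.Im (f t)| <= A by exact: le_trans (ler_Im_cabs _) (fA t).
have ir := bounded_integrable mr rA; have ii := bounded_integrable mi iA.
have fc : cintegrable f by split.
have avgA n : (0 < n)%N -> cabs (avg n f) <= 2 * A.
  move=> n0; apply: le_trans (cabs_le_ReIm _) _; rewrite /avg /=.
  have h1 : `|ravg n (fun t => complex.Re (f t)) - 0| <= A.
    by apply: ravg_near => // t _; rewrite subr0.
  have h2 : `|ravg n (fun t => complex.Im (f t)) - 0| <= A.
    by apply: ravg_near => // t _; rewrite subr0.
  by rewrite !subr0 in h1 h2; lra.
have mM : mu.-integrable I (EFin \o (fun=> (3 * A) `^ q)).
  exact: (cintegrable_cst ((3 * A) `^ q)%:C%C).1.
apply: (dominated_evanishes _ mM).
- move=> N; apply/measurable_EFinP; apply: cmeasurable_pow.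
  by apply: cmeasurable_fsub; [split|exact: cmeasurable_happrox].
- move=> N t It; rewrite powR_ge0 /=.
  have [n nN nt] := nodeI_exists (isT : (0 < N.+1)%N) It.
  have n0 : (0 < n)%N by case/andP : nN => h _; exact: leq_trans h.
  apply: ge0_ler_powR; rewrite ?nnegrE ?cabs_ge0 ?mulr_ge0 ?(ltW q0)//.
  rewrite /fsub (happrox_node fc _ nN nt)//; apply: le_trans (ler_cabsB _ _) _.
  by have := fA t; have := avgA n n0; lra.
move=> t It; apply: vanishes_powR; first by move=> n; exact: cabs_ge0.
move=> e e0; have e2 : 0 < e / 2 by rewrite divr_gt0.
have /cvgrPdist_le/(_ _ e2)/nbhs_ballP[d1 /= d10 H1] := cr t.
have /cvgrPdist_le/(_ _ e2)/nbhs_ballP[d2 /= d20 H2] := ci t.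
pose d := Num.min d1 d2; have d0 : 0 < d by rewrite lt_min d10 d20.
exists (Num.truncn (2 / d)).+1 => N HN; rewrite ger0_norm ?cabs_ge0//.
have [n nN nt] := nodeI_exists (isT : (0 < N.+1)%N) It.
have n0 : (0 < n)%N by case/andP : nN => h _; exact: leq_trans h.
rewrite /fsub (happrox_node fc _ nN nt)//.
have near s : nodeI n s -> `|t - s| < d.
  move=> ns; have Nn : (N.+1 <= n)%N by case/andP : nN.
  have h := nodeI_diam (isT : (0 < N.+1)%N) Nn nt ns.
  have hN : 2 / d < N.+1%:R.
    apply: lt_le_trans (Num.Theory.truncnS_gt _) _; rewrite ler_nat; exact: leqW HN.
  rewrite ltr_pdivrMr// in hN.
  have NR : 0 < N.+1%:R :> R by [].
  by rewrite -(ltr_pM2r NR) [ltRHS]mulrC; apply: le_lt_trans h hN.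
have h1 : `|ravg n (fun t => complex.Re (f t)) - complex.Re (f t)| <= e / 2.
  apply: ravg_near => // s /near; rewrite lt_min => /andP[s1 _].
  by rewrite distrC; apply: H1; rewrite /ball /=.
have h2 : `|ravg n (fun t => complex.Im (f t)) - complex.Im (f t)| <= e / 2.
  apply: ravg_near => // s /near; rewrite lt_min => /andP[_ s2].
  by rewrite distrC; apply: H2; rewrite /ball /=.
apply: le_trans (cabs_le_ReIm _) _; rewrite ReD ImD ReN ImN /avg /=.
rewrite distrC (distrC (complex.Im _)); lra.
Qed.

Lemma happrox_bound (g : R -> C) N : (0 < N)%N -> inLq q g ->
  (intpow q (fsub g (happrox N g)) <= (2 `^ q * (1 + 4 `^ q))%:E * intpow q g)%E.
Proof.
move=> N0 ig; have mh := cmeasurable_happrox N g; have fc := inLq_cintegrable q1 ig.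
have h1 := intpow_add_le q0 (cmeasurable_fsub ig.1 mh) ig.1 mh (fun t _ => ler_cabsB (g t) (happrox N g t)).
have h2 : intpow q (happrox N g) = (tmean N (fun n => cabs (avg n g) `^ q))%:E.
  by apply: intpow_node_cst => // n t nN nt; exact: happrox_node fc N0 nN nt.
have h3 := tmean_avg_pow_le q1 N0 ig; rewrite -h2 in h3.
have fin := inLq_fin_num ig.
apply: (le_trans h1); rewrite EFinM -muleA; apply: lee_wpmul2l; first by rewrite lee_fin powR_ge0.
rewrite EFinD ge0_muleDl; [|by rewrite lee_fin|by rewrite lee_fin powR_ge0].
rewrite mul1e.
by apply: leeD; [exact: lexx|exact: h3].
Qed.

(** By density: [happrox_bound] is uniform in N, and convergence is known for bounded continuous
    functions. *)
Theorem haar_convergence (g : R -> C) : inLq q g ->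
  evanishes (fun N => intpow q (fsub g (happrox N.+1 g))).
Proof.
move=> ig e e0.
pose K := 2 `^ q * (1 + 4 `^ q); have K0 : 0 <= K by rewrite mulr_ge0 ?addr_ge0 ?powR_ge0.
have t0 : 0 < 2 `^ q by rewrite powR_gt0.
(* Each use of [intpow_add_le] costs 2^q and splits in two, and K e2 <= e1 pays for
   [happrox_bound]. *)
pose e1 := e / (2 * 2 `^ q); have e10 : 0 < e1 by rewrite divr_gt0 ?mulr_gt0.
pose e2 := e1 / (K + 1); have e20 : 0 < e2 by rewrite divr_gt0 ?ltr_wpDl.
pose e3 := e2 / (2 * 2 `^ q); have e30 : 0 < e3 by apply: divr_gt0 => //; rewrite mulr_gt0.
have [A [gA A0 [mA gAA HA]]] := trunc_approx ig e30.
have gA1 t : cabs (gA t) <= A + 1 by apply: le_trans (gAA t) _; rewrite lerDl ler01.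
have [|f [cr ci fA Hf]] := continuous_approx mA gA1 _ e30; first by rewrite ltr_wpDl.
have mf : cmeasurable f.
  by split; [apply: measurable_funTS; apply: continuous_measurable_fun; exact: cr|apply: measurable_funTS; apply: continuous_measurable_fun; exact: ci].
have Hr : (intpow q (fsub g f) <= e2%:E)%E.
  have h := intpow_add_le q0 (cmeasurable_fsub ig.1 mf) (cmeasurable_fsub ig.1 mA) (cmeasurable_fsub mA mf) _.
  apply: (le_trans (h _)).
    move=> t _; have := ler_cabsD (g t - gA t) (gA t - f t).
    by rewrite addrA subrK.
  have -> : e2%:E = ((2 `^ q)%:E * (e3%:E + e3%:E))%E.
    by rewrite -EFinD -EFinM; congr EFin; rewrite /e3; field; rewrite gt_eqF.
  by apply: lee_wpmul2l; [rewrite lee_fin powR_ge0|exact: leeD HA Hf].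
have ir : inLq q (fsub g f).
  by split; [exact: cmeasurable_fsub ig.1 mf|apply: le_lt_trans Hr _; exact: ltry].
have iF : cintegrable f.
  have B0 t : `|complex.Re (f t)| <= 2 * (A + 1) by exact: le_trans (ler_Re_cabs _) (fA t).
  have B1 t : `|complex.Im (f t)| <= 2 * (A + 1) by exact: le_trans (ler_Im_cabs _) (fA t).
  by split; [exact: bounded_integrable mf.1 B0|exact: bounded_integrable mf.2 B1].
have [N HN] := continuous_happrox cr ci fA e10.
exists N => n Nn; have {}HN := HN n Nn.
have Hr2 : (intpow q (fsub (fsub g f) (happrox n.+1 (fsub g f))) <= e1%:E)%E.
  apply: (le_trans (happrox_bound (isT : (0 < n.+1)%N) ir)).
  apply: (@le_trans _ _ (K%:E * e2%:E)%E).
    by apply: lee_wpmul2l; [rewrite lee_fin|exact: Hr].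
  rewrite -EFinM lee_fin /e2 mulrA ler_pdivrMr ?ltr_wpDl// mulrC ler_wpM2l ?(ltW e10)//.
  by rewrite lerDl.
have mh1 := cmeasurable_happrox n.+1 f; have mh2 := cmeasurable_happrox n.+1 (fsub g f).
have mh := cmeasurable_happrox n.+1 g.
have h := intpow_add_le q0 (cmeasurable_fsub ig.1 mh) (cmeasurable_fsub mf mh1)
  (cmeasurable_fsub (cmeasurable_fsub ig.1 mf) mh2) _.
apply: (le_trans (h _)).
  move=> t It; have [m mN mt] := nodeI_exists (isT : (0 < n.+1)%N) It.
  have m0 : (0 < m)%N by case/andP : mN => hh _; exact: leq_trans hh.
  have gc := inLq_cintegrable q1 ig; have rc := inLq_cintegrable q1 ir.
  rewrite /fsub (happrox_node gc _ mN mt)// (happrox_node iF _ mN mt)//.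
  rewrite -/(fsub g f) (happrox_node rc _ mN mt)//.
  have -> : avg m (fsub g f) = avg m g - avg m f.
    rewrite (eq_avg (g2 := fun t => -1 * f t + g t)); last by move=> s _; rewrite mulN1r addrC.
    by rewrite avg_comb// mulN1r addrC.
  rewrite (_ : g t - avg m g = (f t - avg m f) + (g t - f t - (avg m g - avg m f))); last ring.
  exact: ler_cabsD.
have -> : e%:E = ((2 `^ q)%:E * (e1%:E + e1%:E))%E.
  by rewrite -EFinD -EFinM; congr EFin; rewrite /e1; field; rewrite gt_eqF.
by apply: lee_wpmul2l; [rewrite lee_fin powR_ge0|exact: leeD HN Hr2].
Qed.

End HaarConvergence.

(** * Existence and uniqueness of the expansion *)

Section Expansion.
Variable R : realType.
Local Notation C := R[i].
Variables (q kap eta : R).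
Hypotheses (q1 : 1 < q) (kap0 : 0 <= kap) (kap1 : kap < 1) (eta0 : 0 < eta) (eta2 : eta `^ q < 2).

Let q0 : 0 < q. Proof. exact: lt_trans ltr01 q1. Qed.
Let th20 : 0 <= eta `^ q / 2. Proof. by rewrite divr_ge0 ?powR_ge0. Qed.
Let th21 : eta `^ q / 2 < 1. Proof. by rewrite ltr_pdivrMr ?mul1r. Qed.

Lemma inLq0P g : inLq0 q g <-> inLq q g /\ avg 1 g = 0.
Proof.
rewrite /inLq0 /avg /ravg lev1 expr0 !mul1r nodeI1.
split=> [[ig [-> ->]]|[ig [-> ->]]]; split=> //; exact: ig.
Qed.

Lemma inLq0_psum B (a c : nat -> C) N : cgrowth kap eta B c -> inLq0 q (psum a (dil (chaosf c)) N).
Proof.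
move=> Bc; apply/inLq0P; split; first exact: (inLq_psum q1 kap0 kap1 eta0 eta2 a N Bc).
case: N => [|N]; last by rewrite (avg_psum q1 kap0 kap1 eta0 eta2 a Bc)// treeval1.
rewrite (eq_avg (g2 := fun=> 0)); first exact: avg_cst.
by move=> t _; rewrite /psum big_geq.
Qed.

Lemma psum_single (x : nat -> R -> C) n : (0 < n)%N ->
  psum (fun m => (m == n)%:R) x n.+1 = x n.
Proof.
move=> n0; apply/funext => t; rewrite psumS// eqxx mul1r /psum big_nat big1 ?add0r// => m /andP[_ mn].
by rewrite (ltn_eqF mn) mul0r.
Qed.

Lemma inLq0_dil B (c : nat -> C) n : cgrowth kap eta B c -> (0 < n)%N -> inLq0 q (dil (chaosf c) n).
Proof. by move=> Bc n0; rewrite -(psum_single _ n0); exact: (inLq0_psum _ _ Bc). Qed.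

(** On a node of the window [happrox N g] is constant and has no Haar coefficient there, so the
    coefficients of g are those of the error. *)
Lemma tmean_coef_pow_le N g : (0 < N)%N -> inLq q g ->
  tmean N (fun n => cabs (coef n g) `^ q) <=
  2 `^ q * (2 * 4 `^ q) * fine (intpow q (fsub g (happrox N g))).
Proof.
move=> N0 ig; have fc := inLq_cintegrable q1 ig.
pose r := fsub g (happrox N g).
have ih : inLq q (happrox N g).
  rewrite (_ : happrox N g = fun t => 1 * psum (fun m => coef m g) haar_sys N t + avg 1 g).
    apply: (inLq_comb q1); last exact: inLq_cst.
    by rewrite haar_sysE; exact: (inLq_psum q1 kap0 kap1 eta0 eta2 _ _ (cgrowth_delta0 kap0 eta0)).
  by apply/funext => t; rewrite mul1r addrC.
have ir : inLq q r by exact: (inLq_fsub q1 ig ih).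
have E n : (N <= n < N.*2)%N -> coef n g = coef n r.
  move=> nN; have n0 : (0 < n)%N by case/andP : nN => h _; exact: leq_trans h.
  rewrite (coef_fsub q1 n0 ig ih) (_ : coef n (happrox N g) = 0) ?subr0// /coef.
  rewrite (eq_avg (g2 := fun=> avg n g)).
    rewrite (eq_avg (n := n.*2.+1) (g2 := fun=> avg n g)); first by rewrite !avg_cst subrr mul0r.
    by move=> t ht; apply: (happrox_node fc N0 nN); rewrite nodeI_split//; right.
  by move=> t ht; apply: (happrox_node fc N0 nN); rewrite nodeI_split//; left.
(* A coefficient is read off the two children, which fill the window of [N.*2]. *)
have h := tmean_avg_pow_le q1 (_ : 0 < N.*2)%N ir.
have {}h := h ltac:(by rewrite double_gt0).
rewrite -(fineK (inLq_fin_num ir)) -EFinM lee_fin in h.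
apply: (@le_trans _ _ (2 `^ q * (2 * tmean N.*2 (fun n => cabs (avg n r) `^ q)))); last first.
  by rewrite -!mulrA !ler_wpM2l ?powR_ge0.
rewrite /tmean sum_double !mulr_sumr big_nat [leRHS]big_nat; apply: ler_sum => n nN.
have n0 : (0 < n)%N by case/andP : nN => h' _; exact: leq_trans h'.
rewrite wt_double// wt_doubleS// E//.
have arith (k w x y : R) : k * (2 * (w / 2 * x + w / 2 * y)) = w * (k * (x + y)) by field.
rewrite arith.
rewrite ler_wpM2l ?wt_ge0//; apply: le_trans (powRD_le q0 (cabs_ge0 _) (cabs_ge0 _)).
apply: ge0_ler_powR; rewrite ?nnegrE ?addr_ge0 ?cabs_ge0 ?(ltW q0)//.
rewrite /coef cabsM; apply: (@le_trans _ _ (cabs (avg n.*2 r - avg n.*2.+1 r))); last exact: ler_cabsB.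
rewrite ler_piMr ?cabs_ge0// cabsV -[2 in leLHS](rmorph_nat (real_complex R)) cabs_real ger0_norm.
  by rewrite invf_le1 ?ltr0n ?ler1n.
by rewrite ler0n.
Qed.

Variables (B : R) (c d : nat -> C).
Hypotheses (Bc : cgrowth kap eta B c) (Bd : cgrowth kap eta B d)
  (cd : forall k, cprod c d k = delta0 C k).

Lemma remainder_evanishes (b : nat -> C) :
  vanishes (fun N => tmean N (fun n => cabs (b n) `^ q)) ->
  evanishes (fun N => intpow q (fsub (psum (tconv d b) (dil (chaosf c)) N.+1) (psum b haar_sys N.+1))).
Proof.
move=> vb; have [D D0 HD] := remainder_bound q1 kap0 kap1 eta0 eta2 Bc Bd cd.
have p0 N : 0 <= tmean N (potential q eta b).
  by apply: sumr_ge0 => n _; rewrite mulr_ge0 ?wt_ge0// potential_ge0.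
have vp : vanishes (fun N => tmean N (potential q eta b)).
  apply: (vanishes_rec p0 th20 th21 _ vb) => N N1.
  exact: tmean_potential_rec.
move=> e e0; have [N HN] := vanishesZ D vp e0.
exists N => n Nn; apply: le_trans (HD b n.+1 isT) _; rewrite lee_fin.
by apply: le_trans (HN n.+1 (leqW Nn)); exact: ler_norm.
Qed.

Lemma expansion_evanishes g : inLq0 q g ->
  evanishes (fun N => intpow q (fsub g (psum (tconv d (fun m => coef m g)) (dil (chaosf c)) N.+1))).
Proof.
move=> /inLq0P[ig g0]; set b := fun m => coef m g.
have hE N : happrox N g = psum b haar_sys N.
  by apply/funext => t; rewrite /happrox g0 add0r.
have hv := haar_convergence q1 ig.
have vb : vanishes (fun N => tmean N (fun n => cabs (b n) `^ q)).
  move=> e e0; pose K := 2 `^ q * (2 * 4 `^ q).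
  have K0 : 0 < K by rewrite !mulr_gt0 ?powR_gt0.
  have [N HN] := hv (e / K) (divr_gt0 e0 K0).
  exists N.+1 => -[//|n] Nn; rewrite ger0_norm; last first.
    by apply: sumr_ge0 => m _; rewrite mulr_ge0 ?wt_ge0 ?powR_ge0.
  apply: (le_trans (tmean_coef_pow_le (isT : (0 < n.+1)%N) ig)).
  have h := HN n Nn.
  rewrite -/K mulrC -ler_pdivlMr// -lee_fin fineK//.
  rewrite ge0_fin_numE; last exact: intpow_ge0.
  by apply: le_lt_trans h _; exact: ltry.
have rv := remainder_evanishes vb.
move=> e e0; have t0 : 0 < 2 `^ q by rewrite powR_gt0.
have e1 : 0 < e / (2 * 2 `^ q) by rewrite divr_gt0 ?mulr_gt0.
have [N1 H1] := hv _ e1; have [N2 H2] := rv _ e1.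
exists (maxn N1 N2) => n; rewrite geq_max => /andP[n1 n2].
have mf := cmeasurable_psum (tconv d b) c n.+1.
have mh : cmeasurable (psum b haar_sys n.+1) by rewrite haar_sysE; exact: cmeasurable_psum.
have h1 := H1 n n1; rewrite hE in h1.
have h2 := H2 n n2.
have h := intpow_add_le q0 (cmeasurable_fsub ig.1 mf) (cmeasurable_fsub ig.1 mh) (cmeasurable_fsub mf mh) _.
apply: (le_trans (h _)).
  move=> t _; rewrite /fsub.
  have := ler_cabsB (g t - psum b haar_sys n.+1 t) (psum (tconv d b) (dil (chaosf c)) n.+1 t - psum b haar_sys n.+1 t).
  by rewrite opprB addrA subrK.
have -> : e%:E = ((2 `^ q)%:E * ((e / (2 * 2 `^ q))%:E + (e / (2 * 2 `^ q))%:E))%E.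
  by rewrite -EFinD -EFinM; congr EFin; field; rewrite gt_eqF.
by apply: lee_wpmul2l; [rewrite lee_fin powR_ge0|exact: leeD h1 h2].
Qed.

Lemma expands_toP a (x : nat -> R -> C) g :
  expands_to q a x g <-> evanishes (fun N => intpow q (fsub g (psum a x N.+1))).
Proof.
rewrite /expands_to; split => [h|h].
  apply/evanishes_cvg; first by move=> n; exact: intpow_ge0.
  by rewrite -(cvg_shiftS (fun N => intpow q (fsub g (psum a x N)))) in h.
rewrite -cvg_shiftS; apply/evanishes_cvg => //.
by move=> n; exact: intpow_ge0.
Qed.

(** The coefficient of index [n] of the partial sums is constant once they pass [n]; continuity
    carries it to the limit. *)
Lemma expansion_coef (a : nat -> C) g n : inLq q g -> (0 < n)%N ->
  expands_to q a (dil (chaosf c)) g -> tconv c a n = coef n g.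
Proof.
move=> ig n0 /expands_toP h; apply/eqP; rewrite eq_sym -subr_eq0 -cabs_eq0.
apply: contraT => xn0.
have x0 : 0 < cabs (coef n g - tconv c a n) by rewrite lt_def xn0 cabs_ge0.
pose K := 2 `^ q * (2 * (4 `^ q * 2 ^+ (lev n).+1)).
have K0 : 0 < K by rewrite !mulr_gt0 ?powR_gt0 ?exprn_gt0.
pose y := cabs (coef n g - tconv c a n) `^ q; have y0 : 0 < y by rewrite powR_gt0.
have [N HN] := h (y / (2 * K)) (divr_gt0 y0 (mulr_gt0 (ltr0n R 2) K0)).
pose M := maxn N n; have {}HN := HN M (leq_maxl _ _).
have ip := inLq_psum q1 kap0 kap1 eta0 eta2 a M.+1 Bc.
have ir := inLq_fsub q1 ig ip.
have := coef_pow_le q1 n0 ir.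
rewrite (coef_fsub q1 n0 ig ip) (coef_psum q1 kap0 kap1 eta0 eta2 a Bc); last first.
  by rewrite n0 ltnS leq_maxr.
rewrite -/y -/K => hy.
have : fine (intpow q (fsub g (psum a (dil (chaosf c)) M.+1))) <= y / (2 * K).
  by rewrite -lee_fin (fineK (inLq_fin_num ir)).
move=> /(ler_wpM2l (ltW K0))/(le_trans hy).
have -> : K * (y / (2 * K)) = y / 2 by field; rewrite gt_eqF.
by lra.
Qed.

Lemma expansion_unique (a b : nat -> C) g n : inLq q g -> (0 < n)%N ->
  expands_to q a (dil (chaosf c)) g -> expands_to q b (dil (chaosf c)) g -> a n = b n.
Proof.
move=> ig n0 ha hb.
have dc k : cprod d c k = delta0 C k by rewrite cprodC.
rewrite -(tconvK a dc n0) -(tconvK b dc n0); apply: eq_tconv => // m /andP[m0 _].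
by rewrite (expansion_coef ig m0 ha) (expansion_coef ig m0 hb).
Qed.

Lemma dilations_schauder_basis : schauder_basis_Lq0 q (dil (chaosf c)).
Proof.
split=> [n n0|g ig]; first exact: inLq0_dil Bc n0.
exists (tconv d (fun m => coef m g)).
have ha : expands_to q (tconv d (fun m => coef m g)) (dil (chaosf c)) g.
  by apply/expands_toP; exact: expansion_evanishes.
split; first exact: ha.
by move=> b hb n n0; exact: (expansion_unique ig.1 n0 hb ha).
Qed.

End Expansion.

(** * Non-equivalence *)

Lemma le_eps_affine (R : realFieldType) (L x y : R) : 0 <= L ->
  (forall e, 0 < e -> y <= L * (e + x)) -> y <= L * x.
Proof.
move=> L0 H; apply/ler_addgt0Pr => e e0.
have d0 : 0 < e / (L + 1) by rewrite divr_gt0 ?ltr_wpDl.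
apply: le_trans (H _ d0) _; rewrite mulrDr addrC lerD2l.
by rewrite mulrA ler_pdivrMr ?ltr_wpDl// mulrC ler_wpM2l ?(ltW e0)// lerDl.
Qed.

Section Equivalence.
Variable R : realType.
Local Notation C := R[i].
Variables (q kap eta : R).
Hypotheses (q1 : 1 < q) (kap0 : 0 <= kap) (kap1 : kap < 1) (eta0 : 0 < eta) (eta2 : eta `^ q < 2).

Let q0 : 0 < q. Proof. exact: lt_trans ltr01 q1. Qed.

Lemma Lq_eq_trans g1 g2 g3 : cmeasurable g1 -> cmeasurable g2 -> cmeasurable g3 ->
  Lq_eq q g1 g2 -> Lq_eq q g2 g3 -> Lq_eq q g1 g3.
Proof.
move=> m1 m2 m3 e1 e2; apply/eqP; rewrite eq_le; apply/andP; split; last exact: intpow_ge0.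
have h := intpow_add_le q0 (cmeasurable_fsub m1 m3) (cmeasurable_fsub m1 m2) (cmeasurable_fsub m2 m3) _.
apply: (le_trans (h _)); last by rewrite e1 e2 adde0 mule0.
by move=> t _; have := ler_cabsD (g1 t - g2 t) (g2 t - g3 t); rewrite addrA subrK.
Qed.

Lemma Lq_eq_fcomb (a : C) g1 g2 h1 h2 : cmeasurable g1 -> cmeasurable g2 -> cmeasurable h1 ->
  cmeasurable h2 -> Lq_eq q g1 h1 -> Lq_eq q g2 h2 -> Lq_eq q (fcomb a g1 g2) (fcomb a h1 h2).
Proof.
move=> mg1 mg2 mh1 mh2 e1 e2; apply/eqP; rewrite eq_le; apply/andP; split; last exact: intpow_ge0.
have m1 := cmeasurable_fsub mg1 mh1; have m2 := cmeasurable_fsub mg2 mh2.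
have m3 := cmeasurable_fsub (cmeasurable_comb a mg1 mg2) (cmeasurable_comb a mh1 mh2).
have h := intpow_add_le q0 m3 (cmeasurable_scale a m1) m2 _.
apply: (le_trans (h _)).
  move=> t _; have := ler_cabsD (a * (g1 t - h1 t)) (g2 t - h2 t).
  rewrite (_ : a * (g1 t - h1 t) + (g2 t - h2 t) = a * g1 t + g2 t - (a * h1 t + h2 t)); last by ring.
  exact.
rewrite [X in (_ + X)%E]e2 adde0.
have h' := intpow_le (q := q) (k := cabs a `^ q) (cmeasurable_scale a m1) m1 (powR_ge0 _ _) _.
apply: (@le_trans _ _ ((2 `^ q)%:E * ((cabs a `^ q)%:E * 0))%E); last by rewrite mule0 mule0.
apply: lee_wpmul2l; first by rewrite lee_fin powR_ge0.
rewrite (e1 : intpow q (fsub g1 h1) = 0%E) in h'; apply: h' => t _.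
by rewrite cabsM powRM ?cabs_ge0.
Qed.

Lemma Lq_eq_intpow_le g1 g2 : cmeasurable g1 -> cmeasurable g2 -> Lq_eq q g1 g2 ->
  (intpow q g1 <= (2 `^ q)%:E * intpow q g2)%E.
Proof.
move=> m1 m2 e; have h := intpow_add_le q0 m1 (cmeasurable_fsub m1 m2) m2 _.
apply: (le_trans (h _)); last by rewrite e add0e.
by move=> t _; have := ler_cabsD (g1 t - g2 t) (g2 t); rewrite subrK.
Qed.

Lemma Lq_eq_sym g1 g2 : Lq_eq q g1 g2 -> Lq_eq q g2 g1.
Proof.
by rewrite /Lq_eq => <-; apply: eq_integral => t _; rewrite /fsub cabsB.
Qed.

Lemma Lqnorm_le_intpow (K : R) g1 g2 : inLq q g1 -> inLq q g2 -> Lqnorm q g1 <= K * Lqnorm q g2 ->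
  (intpow q g1 <= (`|K| `^ q)%:E * intpow q g2)%E.
Proof.
have le_root a b : 0 <= a -> 0 <= b -> a `^ q^-1 <= K * b `^ q^-1 -> a <= `|K| `^ q * b.
  move=> a0 b0 h; rewrite -(powR_q_inv q1 a0) -[X in _ * X](powR_q_inv q1 b0) -powRM ?powR_ge0//.
  apply: ge0_ler_powR; rewrite ?nnegrE ?mulr_ge0 ?powR_ge0 ?(ltW q0)//.
  by apply: (le_trans h); rewrite ler_wpM2r ?powR_ge0// ler_norm.
move=> i1 i2 h.
have f1 := fine_ge0 (intpow_ge0 q g1); have f2 := fine_ge0 (intpow_ge0 q g2).
rewrite -(fineK (inLq_fin_num i1)) -(fineK (inLq_fin_num i2)) -EFinM lee_fin.
exact: (le_root _ _ f1 f2 h).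
Qed.

Lemma psum1 (x : nat -> C) (y : nat -> R -> C) : psum x y 1 = fun=> 0.
Proof. by apply/funext => t; rewrite /psum big_geq. Qed.

Lemma psum_fcomb (x : nat -> C) (y : nat -> R -> C) N :
  psum x y N.+2 = fcomb (x N.+1) (y N.+1) (psum x y N.+1).
Proof. by apply/funext => t; rewrite psumS// /fcomb addrC. Qed.

(** The image of a Haar sum is identified only up to [Lq_eq]; passing to a representative costs a
    factor 2^q. *)
Lemma equivalent_bases_norms B (c : nat -> C) : cgrowth kap eta B c ->
  equivalent_bases q haar_sys (dil (chaosf c)) ->
  exists2 K : R, 0 <= K & forall x N,
    ((intpow q (psum x (dil (chaosf c)) N.+1) <= K%:E * intpow q (psum x haar_sys N.+1)) /\
     (intpow q (psum x haar_sys N.+1) <= K%:E * intpow q (psum x (dil (chaosf c)) N.+1)))%E.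
Proof.
move=> Bc [T [iT [linT [[K1 HK1] [[K2 HK2] [_ Th]]]]]].
have ih x N : inLq0 q (psum x haar_sys N).
  by rewrite haar_sysE; exact: (inLq0_psum q1 kap0 kap1 eta0 eta2 x N (cgrowth_delta0 kap0 eta0)).
have ih1 n : (0 < n)%N -> inLq0 q (haar_sys n).
  by move=> n0; rewrite haar_sysE; exact: (inLq0_dil q1 kap0 kap1 eta0 eta2 (cgrowth_delta0 kap0 eta0) n0).
have jf x N := inLq0_psum q1 kap0 kap1 eta0 eta2 x N Bc.
have jf1 n n0 := inLq0_dil q1 kap0 kap1 eta0 eta2 (n := n) Bc n0.
have m0 g : inLq0 q g -> cmeasurable g by case=> -[].
have TE x N : Lq_eq q (T (psum x haar_sys N.+1)) (psum x (dil (chaosf c)) N.+1).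
  elim: N => [|N IH].
    (* With coefficient -1, linearity at the zero function reads T 0 = - T 0 + T 0, that is, T 0 =
       0. *)
    have := linT (-1) _ _ (ih x 1%N) (ih x 1%N).
    rewrite (_ : fcomb (-1) (psum x haar_sys 1) _ = psum x haar_sys 1); last first.
      by apply/funext => t; rewrite /fcomb psum1 mulr0 addr0.
    rewrite (_ : fcomb (-1) (T _) _ = psum x (dil (chaosf c)) 1)//.
    by apply/funext => t; rewrite /fcomb !psum1 mulN1r addNr.
  rewrite !psum_fcomb.
  have mT1 := m0 _ (iT _ (ih1 N.+1 isT)); have mT2 := m0 _ (iT _ (ih x N.+1)).
  have mf1 := m0 _ (jf1 N.+1 isT); have mf2 := m0 _ (jf x N.+1).
  have mT3 := m0 _ (iT _ (ih x N.+2)); rewrite psum_fcomb in mT3.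
  apply: (Lq_eq_trans mT3 (cmeasurable_comb _ mT1 mT2) (cmeasurable_comb _ mf1 mf2)).
    exact: linT _ (ih1 N.+1 isT) (ih x N.+1).
  by apply: (Lq_eq_fcomb (x N.+1) mT1 mT2 mf1 mf2 _ IH); exact: (Th N.+1 isT).
pose K := Num.max (2 `^ q * `|K1| `^ q) (`|K2| `^ q * 2 `^ q).
exists K; first by rewrite le_max mulr_ge0 ?powR_ge0.
move=> x N; have iTx := iT _ (ih x N.+1).
have mT := m0 _ iTx; have mf := m0 _ (jf x N.+1).
split.
  apply: (le_trans (Lq_eq_intpow_le mf mT (Lq_eq_sym (TE x N)))).
  apply: (@le_trans _ _ ((2 `^ q * `|K1| `^ q)%:E * intpow q (psum x haar_sys N.+1))%E).
    rewrite EFinM -muleA; apply: lee_wpmul2l; first by rewrite lee_fin powR_ge0.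
    exact: (Lqnorm_le_intpow iTx.1 (ih x N.+1).1 (HK1 _ (ih x N.+1))).
  apply: lee_wpmul2r; first exact: intpow_ge0.
  by rewrite lee_fin le_max lexx.
apply: (le_trans (Lqnorm_le_intpow (ih x N.+1).1 iTx.1 (HK2 _ (ih x N.+1)))).
apply: (@le_trans _ _ ((`|K2| `^ q * 2 `^ q)%:E * intpow q (psum x (dil (chaosf c)) N.+1))%E).
  rewrite EFinM -muleA; apply: lee_wpmul2l; first by rewrite lee_fin powR_ge0.
  exact: (Lq_eq_intpow_le mT mf (TE x N)).
apply: lee_wpmul2r; first exact: intpow_ge0.
by rewrite lee_fin le_max lexx orbT.
Qed.

Lemma intpow_psum_haar (x : nat -> C) N : (0 < N)%N ->
  intpow q (psum x haar_sys N) = (tmean N (fun n => cabs (treeval x n) `^ q))%:E.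
Proof.
move=> N0; apply: (intpow_node_cst q N0).
  by rewrite haar_sysE; exact: cmeasurable_psum.
by move=> n t nN nt; exact: (psum_haar_node _ N0 nN nt).
Qed.

Variables (B : R) (c d : nat -> C).
Hypotheses (Bc : cgrowth kap eta B c) (Bd : cgrowth kap eta B d)
  (cd : forall k, cprod c d k = delta0 C k).
Hypothesis ceq : equivalent_bases q haar_sys (dil (chaosf c)).

(** By [avg_psum] the values of the Haar sum of c * x are averages of the [f]-sum of x, and
    averaging is bounded. *)
Lemma equivalent_tconv_bounded : tconv_bounded q c.
Proof.
have [K K0 HK] := equivalent_bases_norms Bc ceq.
exists (4 `^ q * K) => x [//|N] _; have [h _] := HK x N.
have ip := inLq_psum q1 kap0 kap1 eta0 eta2 x N.+1 Bc.
have Ex := intpow_psum_haar x (isT : (0 < N.+1)%N).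
set y := tconv c x; pose A := 4 `^ q * K.
suff : ((tmean N.+1 (fun n => cabs (treeval y n) `^ q))%:E <= A%:E * intpow q (psum x haar_sys N.+1))%E.
  by rewrite Ex -EFinM lee_fin.
rewrite (@eq_tmean _ _ _ (fun n => cabs (avg n (psum x (dil (chaosf c)) N.+1)) `^ q)).
  apply: (le_trans (tmean_avg_pow_le q1 (isT : (0 < N.+1)%N) ip)).
  rewrite /A EFinM -muleA; apply: lee_wpmul2l; first by rewrite lee_fin powR_ge0.
  exact: h.
move=> n nN; rewrite (avg_psum q1 kap0 kap1 eta0 eta2 x Bc)//.
by case/andP : nN => h1 ->; rewrite (leq_trans _ h1).
Qed.

(* Cutting [x] off at [N] changes neither mean, and makes the remainder between
   the two partial sums vanish as their length tends to infinity. *)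
Lemma equivalent_tconv_inverse_bounded : tconv_bounded q d.
Proof.
have [K K0 HK] := equivalent_bases_norms Bc ceq.
exists (4 `^ q * (K * 2 `^ q)) => x N N0.
pose x' n : C := if (n < N)%N then x n else 0.
pose y := tconv d x'.
have Eh (u v : nat -> C) : (forall n, (0 < n < N)%N -> u n = v n) ->
    psum u haar_sys N = psum v haar_sys N.
  move=> uv; apply/funext => t; rewrite /psum big_nat [RHS]big_nat; apply: eq_bigr => n nN.
  by rewrite uv.
pose X := tmean N (fun n => cabs (treeval x n) `^ q).
pose Y := tmean N (fun n => cabs (treeval y n) `^ q).
have Ey : tmean N (fun n => cabs (treeval (tconv d x) n) `^ q) = Y.
  have h1 := intpow_psum_haar (tconv d x) N0; have h2 := intpow_psum_haar y N0.
  rewrite (Eh (tconv d x) y) in h1; first by apply: EFin_inj; exact: (etrans (esym h1) h2).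
  move=> n /andP[n0 nN].
  by apply: eq_tconv => // m /andP[_ mn]; rewrite /x' ifT//; exact: leq_ltn_trans nN.
have Ex M : (N <= M)%N -> intpow q (psum x' haar_sys M) = X%:E.
  move=> NM; have h := intpow_psum_haar x N0; rewrite -/X in h.
  rewrite -h (Eh x x'); last by move=> n /andP[_ nN]; rewrite /x' nN.
  congr intpow; apply/funext => t; rewrite /psum (big_cat_nat _ NM)//=.
  rewrite [X in _ + X]big_nat [X in _ + X]big1 ?addr0// => n /andP[Nn _].
  by rewrite /x' ltnNge Nn mul0r.
have vx : vanishes (fun M => tmean M (fun n => cabs (x' n) `^ q)).
  move=> e e0; exists N => M NM; rewrite /tmean big_nat big1 ?normr0 ?(ltW e0)// => n /andP[Mn _].
  by rewrite /x' ltnNge (leq_trans NM Mn)/= cabs0 powR0 ?mulr0// gt_eqF.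
have rv := remainder_evanishes q1 kap0 kap1 eta0 eta2 Bc Bd cd vx.
(* For large [M] the [f]-sum of y differs from the Haar sum of x' by at most [r] in the q-th power;
   equivalence returns this to the Haar sum of y, and averaging over the window of [N] to [Y]. *)
have step (r : R) : 0 < r -> Y <= 4 `^ q * (K * 2 `^ q) * (r + X).
  move=> r0; have [M0 HM0] := rv r r0; pose M := maxn M0 N.
  have {HM0} hr := HM0 M (leq_maxl _ _); rewrite -/y in hr.
  have NM : (N <= M.+1)%N by apply: leqW; exact: leq_maxr.
  have ih : inLq q (psum y haar_sys M.+1).
    by rewrite haar_sysE; exact: (inLq_psum q1 kap0 kap1 eta0 eta2 y M.+1 (cgrowth_delta0 kap0 eta0)).
  have [_ h2] := HK y M.
  have mf := cmeasurable_psum y c M.+1.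
  have mh : cmeasurable (psum x' haar_sys M.+1) by rewrite haar_sysE; exact: cmeasurable_psum.
  have h3 := intpow_add_le q0 mf (cmeasurable_fsub mf mh) mh _.
  have {}h3 := h3 (fun t _ => _); rewrite (Ex _ NM) in h3.
  rewrite -lee_fin.
  have -> : Y = tmean N (fun n => cabs (avg n (psum y haar_sys M.+1)) `^ q).
    apply: eq_tmean => n /andP[Nn nN]; congr (cabs _ `^ _).
    have nM : (0 < n < M.+1.*2)%N.
      by rewrite (leq_trans N0 Nn); apply: leq_trans nN _; rewrite leq_double.
    rewrite haar_sysE (avg_psum q1 kap0 kap1 eta0 eta2 y (cgrowth_delta0 kap0 eta0) (isT : (0 < M.+1)%N) nM).
    by apply: eq_treeval; [exact: leq_trans Nn|move=> m _; rewrite tconv_delta0].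
  apply: (le_trans (tmean_avg_pow_le q1 N0 ih)).
  rewrite -mulrA EFinM; apply: lee_wpmul2l; first by rewrite lee_fin powR_ge0.
  apply: (le_trans h2); rewrite -mulrA EFinM; apply: lee_wpmul2l; first by rewrite lee_fin.
  apply: (@le_trans _ _ ((2 `^ q)%:E * (intpow q (fsub (psum y (dil (chaosf c)) M.+1) (psum x' haar_sys M.+1)) + X%:E))%E).
    apply: h3 => t; have := ler_cabsD (psum y (dil (chaosf c)) M.+1 t - psum x' haar_sys M.+1 t) (psum x' haar_sys M.+1 t).
    by rewrite subrK.
  rewrite EFinM EFinD; apply: lee_wpmul2l; first by rewrite lee_fin powR_ge0.
  exact: leeD hr (lexx _).
rewrite Ey; apply: le_eps_affine step; first by rewrite !mulr_ge0 ?powR_ge0.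
Qed.

(** Both sequences are O(2^(k/2)), so both series converge geometrically in the disc and their
    Cauchy product shows that the bounded symbol of d is the reciprocal of that of c. *)
Lemma equivalent_symbol_invertible : q <= 2 -> symbol_H_infty_invertible c (2 `^ (- 2^-1)).
Proof.
move=> q2; have Qc := equivalent_tconv_bounded; have Qd := equivalent_tconv_inverse_bounded.
have [Mc HMc] := bounded_symbol q1 q2 Qc; have [Md HMd] := bounded_symbol q1 q2 Qd.
have [Kc Kc0 HKc] := bounded_symbol_coef q1 q2 Qc.
have [Kd Kd0 HKd] := bounded_symbol_coef q1 q2 Qd.
exists (Num.max Mc Md) => z zr; have [s hs sM] := HMc z zr; have [t ht tM] := HMd z zr.
pose a := Num.sqrt 2 * cabs z.
have a0 : 0 <= a by rewrite mulr_ge0 ?sqrtr_ge0 ?cabs_ge0.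
have s20 : 0 < Num.sqrt 2 :> R by rewrite sqrtr_gt0.
have a1 : a < 1.
  rewrite /a mulrC -ltr_pdivlMr// mul1r; move: zr.
  by rewrite powRN -powR12_sqrt.
pose K := Num.max Kc Kd.
have bnd (u : nat -> C) Ku : Ku <= K -> (forall k, cabs (u k) <= Ku * Num.sqrt 2 ^+ k) ->
    forall k, cabs (u k * z ^+ k) <= K * a ^+ k.
  move=> KuK Hu k; rewrite cabsM cabsX /a exprMn mulrA ler_wpM2r ?exprn_ge0 ?cabs_ge0//.
  by apply: le_trans (Hu k) _; rewrite ler_wpM2r ?exprn_ge0 ?(ltW s20).
have bc := bnd c Kc _ HKc; have bd := bnd d Kd _ HKd.
have st := ccvg_cprod a0 a1 (bc _) (bd _) hs ht.
have {}st : s * t = 1.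
  apply: (ccvg_unique (st _ _)); rewrite ?le_max ?lexx ?orbT//.
  move=> e e0; exists 1%N => -[//|n] _.
  rewrite (_ : \sum_(k < n.+1) _ = 1) ?subrr ?cabs0 ?normr0 ?(ltW e0)//.
  have E k : cprod (fun k => c k * z ^+ k) (fun k => d k * z ^+ k) k = delta0 C k.
    transitivity (cprod c d k * z ^+ k).
      rewrite /cprod mulr_suml; apply: eq_bigr => i _.
      by rewrite mulrACA -exprD subnKC// -ltnS.
    by rewrite cd /delta0; case: k => [|k]; rewrite ?mulr1// mul0r.
  rewrite big_ord_recl E big1 ?addr0// => i _; exact: E.
have s0 : s != 0 by apply: contraPneq st => ->; rewrite mul0r => /esym/eqP; rewrite oner_eq0.
exists s; split=> //; first exact/cseries_toP.
  by rewrite le_max sM.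
have -> : s^-1 = t by rewrite -[LHS]mulr1 -st mulKf.
by rewrite le_max tM orbT.
Qed.

End Equivalence.

Theorem theorem3 (R : realType) (p : R) (c : nat -> R[i]) (f : R -> R[i]) :
  1 < p -> p <= 2 ->
  haar_chaos c f -> inLq 1 f ->
  symbol_analytic_on c (2 `^ (- p^-1)) ->
  symbol_nonvanishing_on c (2 `^ (- p^-1)) ->
  ~ symbol_H_infty_invertible c (2 `^ (- 2^-1)) ->
  forall q : R, 1 < q -> q < p ->
    schauder_basis_Lq0 q (dil f) /\ ~ equivalent_bases q haar_sys (dil f).
Proof.
move=> p1 p2 /haar_chaosE -> _ an nv nH q q1 qp.
have q0 : 0 < q := lt_trans ltr01 q1.
have p0 : 0 < p := lt_trans ltr01 p1.
have pq : p^-1 < q^-1 by rewrite ltf_pV2.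
(* Two exponents strictly between 1/p and 1/q: v < 1/q gives eta^q < 2, u < v gives kap < 1, and 1/p
   < u puts rho = 2^(-u) inside the zero-free disc. *)
pose v := (p^-1 + q^-1) / 2; pose u := (p^-1 + v) / 2.
have vq : v < q^-1 by rewrite /v; lra.
have uv : u < v by rewrite /u /v; lra.
have pu : p^-1 < u by rewrite /u /v; lra.
have ltp (a b : R) : a < b -> 2 `^ a < 2 `^ b.
  by move=> ab; rewrite /powR pnatr_eq0 ltr_expR ltr_pM2r ?ln_gt0 ?ltr1n.
pose kap : R := 2 `^ (u - v); pose eta : R := 2 `^ v; pose rho : R := 2 `^ (- u).
have eta0 : 0 < eta by exact: powR_gt0.
have kap0 : 0 <= kap by exact: powR_ge0.
have kap1 : kap < 1 by rewrite -[ltRHS](powRr0 2); apply: ltp; rewrite subr_lt0.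
have eta2 : eta `^ q < 2.
  by rewrite /eta -powRrM -[ltRHS](@powRr1 _ 2)//; apply: ltp; rewrite -ltr_pdivlMr// mul1r.
have rho0 : 0 < rho by exact: powR_gt0.
have rhor : rho < 2 `^ (- p^-1) by apply: ltp; rewrite ltrN2.
have ke : kap * eta = rho^-1.
  by rewrite /rho -powRN opprK /kap /eta -powRD ?subrK// (_ : (2 : R) == 0 = false) ?implybT// pnatr_eq0.
(* The symbol takes the value c_0 at the origin. *)
have c0 : c 0 != 0.
  apply: (nv 0); first by rewrite cabs0 powR_gt0.
  apply/cseries_toP => e e0; exists 1%N => -[//|n] _.
  rewrite big_ord_recl expr0 mulr1 big1 ?addr0 ?subrr ?cabs0 ?normr0 ?(ltW e0)// => i _.
  by rewrite exprS mul0r mulr0.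
have [d cd] := cprod_inv c0.
have [B1 HB1] := symbol_coef_bound an rho0 rhor.
have [B2 HB2] := reciprocal_symbol_coef_bound an nv cd rho0 rhor.
have growth B (x : nat -> R[i]) : (forall n, cabs (x n) * rho ^+ n <= B) -> B <= Num.max B1 B2 ->
    cgrowth kap eta (Num.max B1 B2) x.
  move=> HB BB k; rewrite ke exprVn ler_pdivlMr ?exprn_gt0//.
  exact: le_trans (HB k) BB.
have Bc : cgrowth kap eta (Num.max B1 B2) c by apply: (growth B1); rewrite // le_max lexx.
have Bd : cgrowth kap eta (Num.max B1 B2) d by apply: (growth B2); rewrite // le_max lexx orbT.
split; first exact: (dilations_schauder_basis q1 kap0 kap1 eta0 eta2 Bc Bd cd).
move=> ceq; apply: nH.
by apply: (equivalent_symbol_invertible q1 kap0 kap1 eta0 eta2 Bc Bd cd ceq); apply: ltW; exact: lt_le_trans p2.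
Qed.
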